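(* Let $g$ be a fixed integer with $|g|\ge2$. For all but $o(Q/\log Q)$ primes $p\le Q$, as $Q\to\infty$, every residue class modulo $p$ can be represented as $\ell+g^k+g^m+g^n$ with a prime $\ell<p$ and positive integers $k,m,n\le p-1$. That is, if $N_g(Q)$ denotes the number of primes $p\le Q$ for which there exists a residue class modulo $p$ that is not congruent modulo $p$ to any number $\ell+g^k+g^m+g^n$ with $\ell<p$ prime and $k,m,n$ integers satisfying $1\le k,m,n\le p-1$, then $N_g(Q)=o(Q/\log Q)$ as $Q\to\infty$. *)

(* Defs.v *)
From HB Require Import structures.
From mathcomp Require Import all_boot all_order all_algebra.
From mathcomp Require Import all_classical all_reals all_analysis.
Set Implicit Arguments.
Unset Strict Implicit.
Unset Printing Implicit Defensive.
Import Order.TTheory GRing.Theory Num.Theory.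
Import numFieldNormedType.Exports.
Local Open Scope ring_scope.

Definition representable (g : int) (p : nat) (a : int) : Prop :=
  exists l k m n : nat,
    [/\ prime l /\ (l < p)%N, (1 <= k <= p.-1)%N, (1 <= m <= p.-1)%N,
        (1 <= n <= p.-1)%N
      & (a = l%:Z + g ^+ k + g ^+ m + g ^+ n %[mod p%:Z])%Z].

(* A residue class modulo p is given by any of its integer representatives. *)
Definition exceptional (g : int) (p : nat) : Prop :=
  exists a : int, ~ representable g p a.

(* For Q >= 0, [p < (Num.truncn Q).+1] means [p%:R <= Q]; for Q < 0,
   [Num.truncn Q] is 0 and the count is 0. *)
Definition num_exceptional {R : realType} (g : int) (Q : R) : nat :=
  \sum_(0 <= p < (Num.truncn Q).+1 | prime p && `[< exceptional g p >]) 1%N.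

(* Makes the [=o_] notation usable at infinity. *)
Canonical pinfty_filter_on (R : realType) : filter_on R :=
  FilterType (pinfty_nbhs R) _.

(* Main.v *)
Require Import Defs.
From HB Require Import structures.
From mathcomp Require Import all_boot all_order all_algebra.
From mathcomp Require Import all_classical all_reals all_analysis.
From mathcomp Require Import all_boot all_order all_algebra cyclic finfield.
From mathcomp Require Import ring lra zify.
Set Implicit Arguments.
Unset Strict Implicit.
Unset Printing Implicit Defensive.
Import Order.TTheory GRing.Theory Num.Theory.
Import numFieldNormedType.Exports.
Local Open Scope ring_scope.

(* FILE A1 *)
Section Stepanov.
Variables (F : finFieldType) (p : nat).
Hypothesis charFp : p \in [pchar F].

Lemma natr_neq0 k : (0 < k < p)%N -> (k%:R : F) != 0.
Proof.
case/andP=> k0 kp; rewrite -(dvdn_pcharf charFp).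
by apply/negP=> /(dvdn_leq k0); rewrite leqNgt kp.
Qed.

Definition nzcoef (P : {poly F}) := #|[set i : 'I_p | P`_i != 0]|.

Lemma sparse_mult n (P : {poly F}) : P != 0 -> (size P <= p)%N ->
  ('X - 1) ^+ n %| P -> (n < nzcoef P)%N.
Proof.
elim: n P => [|n IHn] P P0 sP.
  move=> _; apply/card_gt0P.
  have sP0 : (0 < size P)%N by rewrite size_poly_gt0.
  have kp : ((size P).-1 < p)%N by rewrite prednK.
  by exists (Ordinal kp); rewrite inE /= -lead_coefE lead_coef_eq0.
move=> dvd.
have sP0 : (0 < size P)%N by rewrite size_poly_gt0.
pose k := (size P).-1.
have kp : (k < p)%N by rewrite prednK.
pose Q := 'X * P^`() - k%:R *: P.
have coefQ i : Q`_i = (i%:R - k%:R) * P`_i.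
  rewrite coefB coefXM coefZ coef_deriv; case: i => [|i] /=.
    by rewrite !mulrBl !mul0r.
  by rewrite mulrBl !mulr_natl.
have dvdP : ('X - 1) ^+ n %| P by apply: dvdp_trans dvd; exact: dvdp_exp2l.
have dvdP' : ('X - 1) ^+ n %| P^`().
  case/dvdpP: dvd => R ->; rewrite derivM deriv_exp /= derivB derivX -[1]/(1%:P) derivC subr0 mul1r.
  apply: dvdp_add; first by rewrite exprS mulrCA dvdp_mull ?dvdp_mulIr // mulrC dvdp_mull.
  by rewrite -mulr_natl mulrCA !dvdp_mull.
have dvdQ : ('X - 1) ^+ n %| Q by rewrite dvdp_sub ?dvdp_mull // -mul_polyC dvdp_mull.
have Q0 : Q != 0.
  apply/eqP=> Q0.
  have Pk i : i != k -> P`_i = 0.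
    move=> ik; have := coefQ i; rewrite Q0 coef0 => /esym/eqP; rewrite mulf_eq0.
    case: (ltnP i (size P)) => [ilt|ige _]; last by rewrite nth_default.
    have ilek : (i <= k)%N by rewrite -ltnS prednK.
    rewrite -opprB oppr_eq0 -natrB // => /orP[|/eqP//].
    rewrite (negbTE (@natr_neq0 _ _)) // subn_gt0 ltn_neqAle ik ilek /=.
    by rewrite (leq_ltn_trans _ kp) // leq_subr.
  have P1 : P.[1] = 0.
    apply/eqP; case/dvdpP: dvd => R ->; rewrite hornerM horner_exp !hornerE.
    by rewrite subrr expr0n mulr0.
  move: P1; rewrite horner_coef => P1.
  move: P0; rewrite -lead_coef_eq0 lead_coefE -/k => /negP; apply; apply/eqP.
  rewrite -[RHS]P1 (bigD1 (Ordinal (m:=k) (n:=size P) _)) /= ?prednK // => H.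
  rewrite expr1n mulr1 big1 ?addr0 // => i ik.
  by rewrite Pk ?mul0r //; apply: contra ik => /eqP ik; apply/eqP/val_inj.
have sQ : (size Q <= p)%N.
  apply: (leq_trans _ sP); apply/leq_sizeP => j hj.
  by rewrite coefQ nth_default // mulr0.
apply: leq_ltn_trans (IHn Q Q0 sQ dvdQ) _.
apply: proper_card; apply/properP; split.
  by apply/subsetP=> i; rewrite !inE coefQ mulf_eq0 negb_or => /andP[].
exists (Ordinal kp); rewrite !inE /=.
  by rewrite -lead_coefE lead_coef_eq0.
by rewrite coefQ subrr mul0r eqxx.
Qed.


Section Independence.
Variables (A B t : nat).
Hypotheses (ABt : (A * B <= t)%N) (tBp : (t * B <= p)%N).
Variable x : 'I_A -> 'I_B -> 'I_B -> F.

Let f (c : 'I_B) : {poly F} := \sum_(b < B) \sum_(a < A) x a b c *: 'X^(a + t * b).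

Lemma ltn_digit (a : 'I_A) (b : 'I_B) : (a + t * b < t * B)%N.
Proof.
have B0 : (0 < B)%N by case: (B) b => // -[].
have At : (A <= t)%N by apply: leq_trans ABt; rewrite leq_pmulr.
apply: (@leq_trans (t * b.+1)); first by rewrite mulnS ltn_add2r (leq_trans (ltn_ord a)).
by rewrite leq_mul2l ltn_ord orbT.
Qed.

Lemma digit_inj (a a' : 'I_A) (b b' : 'I_B) :
  (a + t * b == a' + t * b')%N = (a == a') && (b == b').
Proof.
have B0 : (0 < B)%N by case: (B) b => // -[].
have At : (A <= t)%N by apply: leq_trans ABt; rewrite leq_pmulr.
apply/eqP/andP=> [e|[/eqP-> /eqP->]//].
have lt_t (i : 'I_A) : (i < t)%N by apply: leq_trans At.
have t0 : (0 < t)%N by apply: leq_ltn_trans (lt_t a).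
split; apply/eqP/val_inj => /=.
  by have := congr1 (modn^~ t) e; rewrite /= ![(t * _)%N]mulnC ![(_ + _ * t)%N]addnC !modnMDl !modn_small.
have := congr1 (divn^~ t) e.
by rewrite /= ![(t * _)%N]mulnC ![(_ + _ * t)%N]addnC !divnMDl // !divn_small // !addn0.
Qed.

Lemma coef_digit c (a : 'I_A) (b : 'I_B) : (f c)`_(a + t * b)%N = x a b c.
Proof.
rewrite coef_sum (bigD1 b) //= coef_sum (bigD1 a) //= coefZ coefXn eqxx mulr1.
rewrite big1 ?addr0 => [|a' /negbTE ne].
  rewrite big1 ?addr0 // => b' /negbTE ne.
  rewrite coef_sum big1 // => a' _.
  by rewrite coefZ coefXn digit_inj (eq_sym b) ne andbF mulr0.
by rewrite coefZ coefXn digit_inj (eq_sym a) ne mulr0.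
Qed.

Lemma size_digit c : (size (f c) <= t * B)%N.
Proof.
apply: (leq_trans (size_sum _ _ _)); apply/bigmax_leqP => b _.
apply: (leq_trans (size_sum _ _ _)); apply/bigmax_leqP => a _.
by apply: (leq_trans (size_scale_leq _ _)); rewrite size_polyXn ltn_digit.
Qed.

Lemma nzcoef_digit c : (nzcoef (f c) <= A * B)%N.
Proof.
have p0 : (0 < p)%N by rewrite prime_gt0 // (pcharf_prime charFp).
pose h (ab : 'I_A * 'I_B) : 'I_p := insubd (Ordinal p0) (ab.1 + t * ab.2)%N.
apply: (@leq_trans #|h @: setT|); last first.
  by apply: leq_trans (leq_imset_card _ _) _; rewrite cardsT card_prod !card_ord.
apply/subset_leq_card/subsetP => i; rewrite inE.
apply: contraR => /imsetP noim; apply/eqP; rewrite coef_sum big1 // => b _.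
rewrite coef_sum big1 // => a _; rewrite coefZ coefXn.
case: eqP => [e|]; last by rewrite mulr0.
case: noim; exists (a, b) => //; apply/val_inj.
by rewrite val_insubd /= -e ltn_ord.
Qed.

Lemma stepanov_indep :
  \sum_(c < B) f c * ('X - 1) ^+ (t * c) = 0 -> forall a b c, x a b c = 0.
Proof.
move=> sum0 a b c; rewrite -coef_digit.
suff -> : f c = 0 by rewrite coef0.
have [n] := ubnP (c : nat); elim: n c => // n IHn c cn.
have below (c' : 'I_B) : (c' < c)%N -> f c' = 0 by move=> lt; apply: IHn; apply: leq_trans lt _.
apply/eqP; apply/negPn/negP => f0.
have t0 : (0 < t)%N.
  by rewrite lt0n; apply/eqP => t0; move: (ltn_digit a b); rewrite {2}t0.
suff dvd : ('X - 1) ^+ t %| f c.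
  have := sparse_mult f0 (leq_trans (size_digit c) tBp) dvd.
  by rewrite ltnNge (leq_trans (nzcoef_digit c)).
have D0 : ('X - 1 : {poly F}) ^+ (t * c) != 0 by rewrite expf_neq0 // -[1]/(1%:P) polyXsubC_eq0.
rewrite -(dvdp_mul2r _ _ D0) -exprD.
move: sum0; rewrite (bigD1 c) //= => /eqP; rewrite addr_eq0 => /eqP ->.
rewrite dvdpNr; apply: (big_ind (fun q => _ %| q)) => [|u v|c' ne]; first exact: dvdp0.
  exact: dvdp_add.
have [lt|ge] := ltnP c' c; first by rewrite below // mul0r.
rewrite dvdp_mull // dvdp_exp2l // -mulnS leq_mul2l ltn_neqAle ge andbT.
by rewrite (_ : _ != _) ?orbT // eq_sym.
Qed.
End Independence.

Definition zeta (P : {poly F}) : {poly F} := 'X * ('X - 1) * P^`().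

Lemma iter_zeta_root k y (g : {poly F}) :
  (iter k zeta (('X - y%:P) ^+ k * g)).[y] = (y * (y - 1)) ^+ k * k`!%:R * g.[y].
Proof.
elim: k g => [|k IHk] g; first by rewrite expr0 mul1r /= expr0 mulr1 mul1r.
rewrite iterSr.
have -> : zeta (('X - y%:P) ^+ k.+1 * g) =
   ('X - y%:P) ^+ k * ('X * ('X - 1) * (k.+1%:R *: g + ('X - y%:P) * g^`())).
  rewrite /zeta derivM deriv_exp derivB derivX derivC subr0 mul1r /= exprS.
  rewrite -mulr_natl -mul_polyC -polyC_natr.
  by ring.
rewrite IHk !(hornerM, hornerD, hornerN, hornerX, hornerC, hornerZ) subrr mul0r addr0.
rewrite factS natrM exprS.
by ring.
Qed.

Lemma fact_neq0 k : (k < p)%N -> (k`!%:R : F) != 0.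
Proof.
elim: k => [|k IHk] kp; first by rewrite oner_eq0.
by rewrite factS natrM mulf_eq0 negb_or natr_neq0 //= IHk // ltnW.
Qed.

Lemma zeta_dvdp D y (P : {poly F}) : y != 0 -> y != 1 -> (D <= p)%N ->
  (forall k, (k < D)%N -> (iter k zeta P).[y] = 0) -> ('X - y%:P) ^+ D %| P.
Proof.
move=> y0 y1; elim: D => [|D IHD] Dp van; first by rewrite expr0 dvd1p.
have /dvdpP[g defP] : ('X - y%:P) ^+ D %| P.
  by apply: IHD => [|k kD]; [exact: ltnW|apply: van; apply: ltnW].
have := van D (ltnSn D); rewrite defP mulrC iter_zeta_root => /eqP.
rewrite !mulf_eq0 expf_eq0 mulf_eq0 subr_eq0 (negbTE y0) (negbTE y1) andbF.
rewrite (negbTE (fact_neq0 Dp)) /= -/(root g y) -dvdp_XsubCl.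
by rewrite exprSr => /(dvdp_mul (dvdpp _)); apply.
Qed.


Definition zeta_coef (n m : nat) (P : {poly F}) : {poly F} :=
  'X * ('X - 1) * P^`() + (n%:R *: (('X - 1) * P) + m%:R *: ('X * P)).

Lemma zeta_monomial n m (P : {poly F}) :
  zeta (P * ('X^n * ('X - 1) ^+ m)) = zeta_coef n m P * ('X^n * ('X - 1) ^+ m).
Proof.
have dX : 'X * ('X^n)^`() = n%:R *: 'X^n :> {poly F}.
  by rewrite derivXn; case: n => [|n]; rewrite ?mulr0n ?mulr0 ?scale0r // scaler_nat mulrnAr /= -exprS.
have dY : ('X - 1) * (('X - 1) ^+ m)^`() = m%:R *: ('X - 1) ^+ m :> {poly F}.
  rewrite deriv_exp derivB derivX -[1]/(1%:P) derivC subr0 mul1r.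
  by case: m => [|m]; rewrite ?mulr0n ?mulr0 ?scale0r // scaler_nat mulrnAr /= -exprS.
rewrite /zeta /zeta_coef 2!derivM.
transitivity ('X * ('X - 1) * P^`() * ('X^n * ('X - 1) ^+ m)
   + (P * ('X - 1) * ('X - 1) ^+ m * ('X * ('X^n)^`())
   + P * 'X * 'X^n * (('X - 1) * (('X - 1) ^+ m)^`()))); first by ring.
by rewrite dX dY -!mul_polyC; ring.
Qed.

Lemma iter_zeta_monomial k n m (P : {poly F}) :
  iter k zeta (P * ('X^n * ('X - 1) ^+ m)) =
  iter k (zeta_coef n m) P * ('X^n * ('X - 1) ^+ m).
Proof. by elim: k => //= k ->; rewrite zeta_monomial. Qed.

Lemma size_zeta_coef k n m (P : {poly F}) :
  (size (iter k (zeta_coef n m) P) <= size P + k)%N.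
Proof.
elim: k => [|k IHk]; first by rewrite addn0.
rewrite iterS; set Q := iter _ _ _ in IHk *.
have sX1 : size ('X - 1 : {poly F}) = 2%N by rewrite -[1]/(1%:P) size_XsubC.
have sX : size ('X : {poly F}) = 2%N by rewrite size_polyX.
have mul2 (S T : {poly F}) : size S = 2%N -> (size (S * T)%R <= (size T).+1)%N.
  by move=> sS; apply: leq_trans (size_polyMleq _ _) _; rewrite sS.
rewrite addnS; apply: leq_trans (_ : (size Q).+1 <= _)%N; last by rewrite ltnS.
apply: leq_trans (size_polyD _ _) _; rewrite geq_max; apply/andP; split; last first.
  apply: leq_trans (size_polyD _ _) _; rewrite geq_max.
  by rewrite !(leq_trans (size_scale_leq _ _)) ?mul2.
rewrite -mulrA; apply: leq_trans (mul2 _ _ sX) _; rewrite ltnS.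
have [->|Q0] := eqVneq Q 0; first by rewrite linear0 mulr0 size_poly0.
by apply: leq_trans (mul2 _ _ sX1) _; apply: lt_size_deriv.
Qed.

Lemma iter_zeta_sum (U : finType) (x : U -> F) (P : U -> {poly F}) k :
  iter k zeta (\sum_u x u *: P u) = \sum_u x u *: iter k zeta (P u).
Proof.
elim: k => //= k ->; rewrite /zeta linear_sum mulr_sumr; apply: eq_bigr => u _ /=.
by rewrite derivZ scalerAr.
Qed.

Lemma nontrivial_solution (U E : finType) (M : U -> E -> F) : (#|E| < #|U|)%N ->
  exists x : U -> F, (exists u, x u != 0) /\ forall e, \sum_u x u * M u e = 0.
Proof.
move=> lt; pose m := \matrix_(i < #|U|, j < #|E|) M (enum_val i) (enum_val j).
have /rowV0Pn[v /sub_kermxP vm /rV0Pn[i vi]] : kermx m != 0.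
  by rewrite -mxrank_eq0 mxrank_ker -lt0n subn_gt0 (leq_ltn_trans (rank_leq_col _)).
exists (fun u => v 0 (enum_rank u)); split=> [|e].
  by exists (enum_val i); rewrite enum_valK.
have := congr1 (fun w : 'rV_ _ => w 0 (enum_rank e)) vm; rewrite mxE mxE => {2}<-.
rewrite [RHS](reindex (@enum_rank U)) /=; last by apply: onW_bij; apply: enum_rank_bij.
by apply: eq_bigr => j _; rewrite mxE !enum_rankK.
Qed.

Lemma size_multiple_roots D (s : seq F) (P : {poly F}) : P != 0 -> uniq s ->
  (forall y, y \in s -> ('X - y%:P) ^+ D %| P) -> (D * size s < size P)%N.
Proof.
move=> P0 us dvd.
suff /(dvdp_leq P0) : (\prod_(y <- s) ('X - y%:P)) ^+ D %| P.
  apply: leq_trans; have := size_exp (\prod_(y <- s) ('X - y%:P)) D.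
  rewrite size_prod_XsubC /= mulnC => <-; rewrite prednK // size_poly_gt0 expf_neq0 //.
  by rewrite -size_poly_gt0 size_prod_XsubC.
elim: s us dvd => [|y s IHs] /=; first by rewrite big_nil expr1n dvd1p.
case/andP=> ys us dvd; rewrite big_cons exprMn Gauss_dvdp.
  by rewrite dvd ?mem_head // IHs // => z zs; apply: dvd; rewrite inE zs orbT.
rewrite coprimep_expl // coprimep_expr // coprimep_sym coprimep_XsubC.
by rewrite root_prod_XsubC.
Qed.

Theorem stepanov (t B : nat) (I : {set F * F}) :
  (2 * #|I| * t < B ^ 3)%N -> (B <= t)%N -> (t * B <= p)%N ->
  (#|[set y : F | [&& y != 0, y != 1 & (y ^+ t, (y - 1) ^+ t) \in I]%R]| <= 4 * B ^ 2)%N.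
Proof.
move=> JtB Bt tBp; set Y := [set y | _].
have B0 : (0 < B)%N by case: B JtB {Bt tBp}.
pose A := (t %/ B)%N.
have A0 : (0 < A)%N by rewrite divn_gt0.
have ABt : (A * B <= t)%N by apply: leq_trunc_div.
have tAB : (t < A.+1 * B)%N by apply: ltn_ceil.
pose U := ('I_A * 'I_B * 'I_B)%type.
pose E := ({i | i \in I} * 'I_A * 'I_(2 * A))%type.
pose G (u : U) k := iter k (zeta_coef (t * u.1.2) (t * u.2)) 'X^(u.1.1).
pose M (u : U) (e : E) := (val e.1.1).1 ^+ u.1.2 * (val e.1.1).2 ^+ u.2 * (G u e.1.2)`_e.2.
have [|x [[u xu] sol]] := @nontrivial_solution _ _ M.
  rewrite !card_prod !card_ord card_sig.
  have -> : #|[pred i in I]| = #|I| by apply: eq_card => i; rewrite inE.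
  nia.
pose Psi := \sum_u x u *: ('X^(u.1.1) * ('X^(t * u.1.2) * ('X - 1) ^+ (t * u.2))).
have Psi0 : Psi != 0.
  apply: contraNneq xu => Psi0; case: u => -[a b] c.
  apply/eqP; move: a b c.
  apply: (@stepanov_indep A B t ABt tBp (fun a b c => x (a, b, c))).
  rewrite -[RHS]Psi0 /Psi (eq_bigr (fun u : U => (fun ab c => x (ab, c) *:
     ('X^(ab.1) * ('X^(t * ab.2) * ('X - 1) ^+ (t * c)))) u.1 u.2)); last by case.
  rewrite -(pair_bigA _ (fun ab c => x (ab, c) *: ('X^(ab.1) * ('X^(t * ab.2) * ('X - 1) ^+ (t * c))))) /=.
  rewrite exchange_big; apply: eq_bigr => c _ /=.
  rewrite (eq_bigr (fun ab : 'I_A * 'I_B => (fun a b => x (a, b, c) *: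
     ('X^a * ('X^(t * b) * ('X - 1) ^+ (t * c)))) ab.1 ab.2)); last by case.
  rewrite -(pair_bigA _ (fun a b => x (a, b, c) *: ('X^a * ('X^(t * b) * ('X - 1) ^+ (t * c))))) /=.
  rewrite exchange_big mulr_suml; apply: eq_bigr => b _ /=.
  rewrite mulr_suml; apply: eq_bigr => a _.
  by rewrite -scalerAl exprD mulrA.
have sPsi : (size Psi <= 2 * t * B)%N.
  apply: leq_trans (size_sum _ _ _) _; apply/bigmax_leqP => -[[a b] c] _ /=.
  apply: leq_trans (size_scale_leq _ _) _.
  rewrite mulrA -exprD -[1]/(1%:P).
  apply: leq_trans (size_polyMleq _ _) _; rewrite size_polyXn size_exp_XsubC addnS /=.
  by have := ltn_ord a; have := ltn_ord b; have := ltn_ord c; nia.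
have root_Psi y : y \in enum Y -> ('X - y%:P) ^+ A %| Psi.
  rewrite mem_enum inE => /and3P[y0 y1 yI].
  apply: zeta_dvdp => // [|k kA]; first by nia.
  rewrite iter_zeta_sum horner_sum.
  pose e (j : 'I_(2 * A)) : E := (exist (fun i => i \in I) (y ^+ t, (y - 1) ^+ t) yI, Ordinal kA, j).
  transitivity (\sum_(j < 2 * A) y ^+ j * \sum_u x u * M u (e j)).
    rewrite (eq_bigr (fun j : 'I__ => \sum_u y ^+ j * (x u * M u (e j)))); last by move=> j _; rewrite mulr_sumr.
    rewrite exchange_big; apply: eq_bigr => -[[a b] c] _ /=.
    rewrite iter_zeta_monomial hornerZ !hornerM (@horner_coef_wide _ (2 * A)); last first.
      apply: leq_trans (size_zeta_coef _ _ _ _) _; rewrite size_polyXn.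
      by rewrite mul2n -addnn leq_add ?ltn_ord ?(ltnW kA).
    rewrite hornerXn horner_exp hornerD hornerN hornerX hornerC !exprM mulr_suml mulr_sumr.
    by apply: eq_bigr => j _; rewrite /M /G /=; ring.
  by rewrite big1 // => j _; rewrite sol mulr0.
have := size_multiple_roots Psi0 (enum_uniq _) root_Psi.
rewrite -cardE => lt.
have : (A * #|Y| < 2 * t * B)%N by apply: leq_trans lt _.
nia.
Qed.

End Stepanov.

(* FILE A2 *)
Section Fibers.
Variables (X Z : finType) (R : pzRingType) (S : {set X}) (f : X -> Z).

Lemma sum_fiber (T : {set Z}) (g : Z -> R) : (forall x, x \in S -> f x \in T) ->
  \sum_(x in S) g (f x) = \sum_(z in T) g z * #|[set x in S | f x == z]|%:R.
Proof.
move=> fST; rewrite (partition_big f (mem T)) //=; apply: eq_bigr => z _.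
rewrite (eq_bigr (fun=> g z)); last by move=> x /andP[_ /eqP->].
rewrite sumr_const mulr_natr; congr (_ *+ _).
by apply: eq_card => x; rewrite !inE.
Qed.

Lemma sum_fiber_sq (T : {set Z}) : (forall x, x \in S -> f x \in T) ->
  \sum_(z in T) (#|[set x in S | f x == z]|%:R ^+ 2 : R) =
  #|[set xy in setX S S | f xy.1 == f xy.2]|%:R.
Proof.
move=> fST; under eq_bigr do rewrite expr2.
rewrite -(@sum_fiber T (fun z => #|[set x in S | f x == z]|%:R)) //.
rewrite -natr_sum; congr (_%:R).
rewrite -sum1_card (eq_bigl (fun xy : X * X => (xy.1 \in S) && ((xy.2 \in S) && (f xy.1 == f xy.2)))); last first.
  by move=> [x y]; rewrite !inE -andbA.
rewrite -(pair_big_dep (mem S) (fun x y => (y \in S) && (f x == f y)) (fun _ _ => 1%N)) /=.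
apply: eq_bigr => x _; rewrite -sum1_card; apply: eq_bigl => y.
by rewrite !inE eq_sym.
Qed.
End Fibers.

Lemma sqr_dev_le (R : realFieldType) (a n k nu : R) :
  0 <= nu -> nu <= a -> a < n -> 0 <= k -> k <= n -> (k - nu) ^+ 2 <= n ^+ 2.
Proof. by move=> *; rewrite -subr_ge0 subr_sqr mulr_ge0 //; lra. Qed.

Section CubeSums.
Variables (T : finType) (R : realFieldType).
Variables (D : {set T}) (tau : T -> T) (N : T -> nat) (A0 : nat) (nu : R).
Hypotheses (tauD : forall x, x \in D -> tau x \in D)
  (tau_inj : {in D &, injective tau}) (nu0 : 0 <= nu) (nuA : nu <= A0%:R).

Lemma reindex_tau (f : T -> R) : \sum_(x in D) f (tau x) = \sum_(x in D) f x.
Proof.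
have imD : tau @: D = D.
  apply/eqP; rewrite eqEcard card_in_imset // leqnn andbT.
  by apply/subsetP => _ /imsetP[x xD ->]; apply: tauD.
by rewrite -[in RHS]imD big_imset.
Qed.

Lemma skew_variance :
  \sum_(x in D) (N x)%:R * ((N (tau x))%:R - nu) ^+ 2 <=
  A0%:R * \sum_(x in D) ((N x)%:R - nu) ^+ 2
  + 2 * \sum_(x in D | (A0 < N x)%N) (N x)%:R ^+ 3.
Proof.
pose big x : R := if (A0 < N x)%N then (N x)%:R ^+ 3 else 0.
have big0 x : 0 <= big x by rewrite /big; case: ifP => // _; rewrite exprn_ge0.
have pt x : (N x)%:R * ((N (tau x))%:R - nu) ^+ 2 <=
    A0%:R * ((N (tau x))%:R - nu) ^+ 2 + (big x + big (tau x)).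
  have [le|gt] := leqP (N x) A0.
    rewrite ler_wpDr ?addr_ge0 // ler_wpM2r ?sqr_ge0 // ler_nat //.
  apply: (@le_trans _ _ (big x + big (tau x))); last by rewrite lerDr mulr_ge0 ?sqr_ge0.
  have gtR : (A0%:R : R) < (N x)%:R by rewrite ltr_nat.
  have k0 : (0 : R) <= (N (tau x))%:R by [].
  have n0 : (0 : R) <= (N x)%:R by [].
  have [lek|ltk] := leqP (N (tau x)) (N x).
    apply: (@le_trans _ _ (big x)); last by rewrite lerDl.
    rewrite /big gt exprS ler_wpM2l //.
    have lekR : ((N (tau x))%:R : R) <= (N x)%:R by rewrite ler_nat.
    exact: sqr_dev_le nu0 nuA gtR k0 lekR.
  apply: (@le_trans _ _ (big (tau x))); last by rewrite lerDr.
  rewrite /big (ltn_trans gt ltk) exprS.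
  have ltkR : ((N x)%:R : R) < (N (tau x))%:R by rewrite ltr_nat.
  apply: ler_pM => //; first by rewrite sqr_ge0.
    exact: ltW.
  exact: sqr_dev_le nu0 nuA (lt_trans gtR ltkR) k0 (lexx _).
apply: le_trans (ler_sum _ (fun x _ => pt x)) _.
rewrite big_split /= big_split /= -mulr_sumr.
rewrite (reindex_tau (fun x => ((N x)%:R - nu) ^+ 2)) (reindex_tau big).
by rewrite lerD2l -[leLHS]mulr2n mulr_natl lerMn2r /= /big -big_mkcondr.
Qed.

Lemma cube_sum_dyadic (t K : nat) :
  (forall x, x \in D -> (N x <= t)%N) ->
  (forall (I : {set T}) k, (forall x, x \in I -> [/\ x \in D, (A0 < N x)%N & (2 ^ k <= N x)%N]) ->
    (2 ^ k) ^ 3 * #|I| <= K)%N ->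
  \sum_(x in D | (A0 < N x)%N) ((N x)%:R ^+ 3 : R) <= (8 * K * (trunc_log 2 t).+1)%:R.
Proof.
move=> Nt HI.
have bound : (\sum_(x in D | (A0 < N x)%N) (N x) ^ 3 <= 8 * K * (trunc_log 2 t).+1)%N.
  rewrite (partition_big (fun x => inord (trunc_log 2 (N x)) : 'I_(trunc_log 2 t).+1) xpredT) //=.
  apply: (@leq_trans (\sum_(k < (trunc_log 2 t).+1) 8 * K)%N); last first.
    by rewrite sum_nat_const card_ord mulnC.
  apply: leq_sum => k _.
  pose I := [set x in D | (A0 < N x)%N && (inord (trunc_log 2 (N x)) == k)].
  have Ik x : x \in I -> [/\ x \in D, (A0 < N x)%N & trunc_log 2 (N x) = k].
    rewrite inE => /andP[xD /andP[Ax /eqP e]]; split=> //.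
    by rewrite -e inordK // ltnS leq_trunc_log // Nt.
  apply: (@leq_trans (\sum_(x in I) 8 * (2 ^ k) ^ 3)%N).
    rewrite (eq_bigl (mem I)); last by move=> x; rewrite !inE andbA.
    apply: leq_sum => x /Ik[_ _ <-].
    have := trunc_log_ltn (N x) (ltnSn 1); rewrite expnS => lt.
    apply: leq_trans (_ : (2 * 2 ^ trunc_log 2 (N x)) ^ 3 <= _)%N; first by rewrite leq_exp2r // ltnW.
    by rewrite expnMn.
  rewrite sum_nat_const mulnC -mulnA leq_mul2l /=; apply: HI => x /Ik[xD Ax e]; split=> //.
  by rewrite -e trunc_logP // (leq_ltn_trans _ Ax).
rewrite (eq_bigr (fun x => ((N x) ^ 3)%:R)); last by move=> x _; rewrite natrX.
by rewrite -natr_sum ler_nat.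
Qed.
End CubeSums.

(* FILE A3 *)
Section Energy.
Variables (F : finFieldType) (p t : nat).
Hypotheses (charFp : p \in [pchar F]) (cardF : #|F| = p) (t0 : (0 < t)%N).

Definition unity_set := [set x : F | x ^+ t == 1].
Local Notation H := unity_set.
Hypothesis cardH : #|H| = t.

Let S := [set y : F | (y != 0) && (y != 1)].
Definition pair_class (y : F) := (y ^+ t, (y - 1) ^+ t).
Definition power_set := [set x ^+ t | x in [set x : F | x != 0]].
Definition class_pairs := setX power_set power_set.
Definition class_size (th : F * F) := #|[set y in S | pair_class y == th]|.
Local Notation N := class_size.
Local Notation T := class_pairs.
Local Notation c := pair_class.

Lemma unity_neq0 u : u \in H -> u != 0.
Proof. by rewrite inE; apply: contraTneq => ->; rewrite expr0n gtn_eqF // eq_sym oner_eq0. Qed.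

Lemma unityP (x y : F) : y != 0 -> (x ^+ t == y ^+ t) = (x / y \in H).
Proof.
move=> y0; rewrite inE expr_div_n; apply/eqP/eqP => [->|h]; last exact: divr1_eq h.
by rewrite divff ?expf_neq0.
Qed.

Lemma card_power_fiber a : a \in power_set -> #|[set x : F | (x != 0) && (x ^+ t == a)]| = t.
Proof.
case/imsetP=> y; rewrite inE => y0 ->; transitivity #|H|; last exact: cardH.
rewrite -[RHS](card_imset _ (mulIf y0)).
apply: eq_card => x; apply/idP/imsetP => [|[u uH ->]].
  by rewrite inE => /andP[x0]; rewrite unityP // => uH; exists (x / y); rewrite ?divfK.
by rewrite inE unityP // mulfK // uH andbT mulf_neq0 // unity_neq0.
Qed.

Lemma card_nonzero : #|[set x : F | x != 0]| = p.-1.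
Proof. by rewrite -cardF -(cardC1 (0 : F)); apply: eq_card => x; rewrite !inE. Qed.

Lemma card_power_set : (#|power_set| * t = p.-1)%N.
Proof.
rewrite -card_nonzero -[RHS]sum1_card (partition_big (fun x : F => x ^+ t) (mem power_set)) /=.
  rewrite -sum_nat_const; apply: eq_bigr => a /card_power_fiber {1}<-.
  by rewrite -sum1_card; apply: eq_bigl => x; rewrite !inE.
by move=> x x0; apply/imsetP; exists x.
Qed.

Lemma cardS : #|S| = p.-2.
Proof.
have -> : S = [set x : F | x != 0] :\ 1 by apply/setP => x; rewrite !inE andbC.
by have := cardsD1 1 [set x : F | x != 0]; rewrite card_nonzero inE oner_eq0 /= add1n => ->.
Qed.

Lemma power_setP x : x != 0 -> x ^+ t \in power_set.
Proof. by move=> x0; apply/imsetP; exists x; rewrite ?inE. Qed.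

Lemma pair_class_in y : y \in S -> c y \in T.
Proof.
by rewrite inE => /andP[y0 y1]; rewrite inE /= !power_setP // subr_eq0.
Qed.

Lemma class_size_sum : (\sum_(th in T) N th = p.-2)%N.
Proof.
rewrite -cardS -sum1_card (partition_big c (mem T)) //=; last exact: pair_class_in.
by apply: eq_bigr => th _; rewrite /N -sum1_card; apply: eq_bigl => y; rewrite inE.
Qed.

Lemma class_size_sq : (\sum_(th in T) N th ^ 2 <= p + t ^ 2)%N.
Proof.
have := @sum_fiber_sq _ _ int S c T pair_class_in.
rewrite (eq_bigr (fun th => (N th ^ 2)%:R)); last by move=> th _; rewrite natrX.
rewrite -natr_sum => /eqP; rewrite eqr_nat => /eqP ->.
pose f (yz : F * F) := (yz.2 / yz.1, (yz.2 - 1) / (yz.1 - 1)).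
rewrite -cardH -cardF.
have -> : (#|F| + #|H| ^ 2 = #|[set: F]| + #|setX H H|)%N by rewrite cardsT cardsX.
set P := [set _ in _ | _].
have sub : P \subset [set (y, y) | y in [set: F]] :|: [set yz in P | yz.1 != yz.2].
  by apply/subsetP => -[y z] yzP; rewrite inE [X in _ || X]inE yzP /=;
     case: (eqVneq y z) => [->|_]; rewrite ?orbT //; apply/orP; left; apply/imsetP; exists z.
apply: leq_trans (subset_leq_card sub) _; apply: leq_trans (leq_card_setU _ _) _.
apply: leq_add; first exact: leq_imset_card.
have PP y z : (y, z) \in P -> [/\ y != 0, y - 1 != 0, z / y \in H & (z - 1) / (y - 1) \in H].
  rewrite !inE /= => /andP[/andP[/andP[y0 y1] /andP[z0 z1]]].
  rewrite -subr_eq0 in y1.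
  rewrite eq_sym /pair_class xpair_eqE !unityP //.
  by rewrite !inE => /andP[].
rewrite -(@card_in_imset _ _ f).
  apply/subset_leq_card/subsetP => _ /imsetP[[y z] yzP ->].
  by move: yzP; rewrite inE => /andP[/PP[y0 y1 zy zy1] _]; rewrite inE /= zy.
move=> [y z] [y' z']; rewrite inE => /andP[/PP[y0 y1 _ _] yz].
rewrite inE => /andP[/PP[y'0 y'1 _ _] _] [e1 e2]; rewrite /= in yz.
have u1 : z = (z / y) * y by rewrite divfK.
have v1 : z - 1 = ((z - 1) / (y - 1)) * (y - 1) by rewrite divfK.
have u2 : z' = (z / y) * y' by rewrite e1 divfK.
have v2 : z' - 1 = ((z - 1) / (y - 1)) * (y' - 1) by rewrite e2 divfK.
move: (z / y) ((z - 1) / (y - 1)) u1 v1 u2 v2 => u v u1 v1 u2 v2.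
have uv : u - v != 0.
  apply: contraNneq yz => /eqP; rewrite subr_eq0 => /eqP uv; apply/eqP; subst v.
  have : u = 1 by move: v1; rewrite u1 => /eqP; rewrite -subr_eq0 => /eqP h; apply/eqP; rewrite -subr_eq0 -h; apply/eqP; ring.
  by move=> u_1; rewrite u1 u_1 mul1r.
have yy : y = y'.
  apply: (mulfI uv); transitivity (1 - v).
    by apply/eqP; rewrite -subr_eq0; apply/eqP; transitivity ((u * y - 1) - v * (y - 1)); [ring|rewrite -u1 -v1 subrr].
  by apply/esym/eqP; rewrite -subr_eq0; apply/eqP; transitivity ((u * y' - 1) - v * (y' - 1)); [ring|rewrite -u2 -v2 subrr].
by rewrite u1 u2 yy.
Qed.

End Energy.

(* FILE A4 *)
Section Energy2.
Variables (F : finFieldType) (p t : nat).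
Hypotheses (charFp : p \in [pchar F]) (cardF : #|F| = p) (t0 : (0 < t)%N).
Local Notation H := (unity_set F t).
Hypothesis cardH : #|H| = t.
Hypothesis pt2 : (p <= t ^ 2)%N.
Local Notation N := (class_size t).
Local Notation T := (class_pairs F t).
Local Notation c := (pair_class t).

Lemma level_bound (I : {set F * F}) tau : I \subset T ->
  (forall th, th \in I -> (tau <= N th)%N) -> (112 * t ^ 4 * #|I| <= p ^ 3)%N ->
  (tau ^ 3 * #|I| <= 2 ^ 14 * t ^ 2)%N.
Proof.
move=> IT Itau few; have [->|I0] := posnP #|I|; first by rewrite muln0.
set J := #|I| in few I0 *.
have exB : exists B, (2 * J * t < B ^ 3)%N by exists (2 * J * t).+1; nia.
case: (ex_minnP exB) => B BJ Bmin.
have B2 : (1 < B)%N by rewrite ltnNge; apply/negP => B1; have := BJ; nia.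
have Bpred : (B.-1 ^ 3 <= 2 * J * t)%N.
  by rewrite leqNgt; apply/negP => /Bmin; rewrite leqNgt prednK ?leqnn // ltnW.
have B16 : (B ^ 3 <= 16 * (J * t))%N.
  have : (B <= 2 * B.-1)%N by lia.
  by rewrite -(@leq_exp2r _ _ 3) // expnMn; lia.
have tB3 : ((t * B) ^ 3 <= p ^ 3)%N.
  rewrite expnMn; apply: leq_trans few.
  apply: (@leq_trans (t ^ 3 * (16 * (J * t)))%N); first by rewrite leq_mul2l B16 orbT.
  by rewrite (_ : t ^ 3 * (16 * (J * t)) = 16 * t ^ 4 * J)%N ?leq_mul2r ?leq_mul2l ?orbT //; ring.
have tBp : (t * B <= p)%N by rewrite -(@leq_exp2r _ _ 3).
have Bt : (B <= t)%N by rewrite -(leq_pmul2l t0) mulnn (leq_trans tBp).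
have := @stepanov F p charFp t B I BJ Bt tBp.
set Y := [set y | _] => cY.
have sumN : (\sum_(th in I) N th = #|Y|)%N.
  rewrite -[RHS]sum1_card (partition_big c (mem I)) /=; last by move=> y; rewrite inE => /and3P[].
  apply: eq_bigr => th thI; rewrite /class_size -sum1_card; apply: eq_bigl => y.
  rewrite !inE -[(_, _)]/(c y); case: (c y =P th) => [->|_]; last by rewrite !andbF.
  by rewrite thI !andbT.
have tauJ : (tau * J <= 4 * B ^ 2)%N.
  apply: leq_trans cY; rewrite -sumN mulnC -sum_nat_const.
  by apply: leq_sum => th /Itau.
have cube : ((tau * J) ^ 3 <= (4 * B ^ 2) ^ 3)%N by rewrite leq_exp2r.
have sq : ((B ^ 3) ^ 2 <= (16 * (J * t)) ^ 2)%N by rewrite leq_exp2r.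
have J2 : (0 < J ^ 2)%N by rewrite expn_gt0 I0.
rewrite -(leq_pmul2r J2).
rewrite (_ : tau ^ 3 * J * J ^ 2 = (tau * J) ^ 3)%N; last by ring.
apply: leq_trans cube _.
rewrite (_ : (4 * B ^ 2) ^ 3 = 64 * (B ^ 3) ^ 2)%N; last by ring.
rewrite (_ : 2 ^ 14 * t ^ 2 * J ^ 2 = 64 * (16 * (J * t)) ^ 2)%N; last by ring.
by rewrite leq_mul2l sq orbT.
Qed.

Lemma p_gt1 : (1 < p)%N.
Proof. by rewrite prime_gt1 // (pcharf_prime charFp). Qed.

Variable R : realFieldType.
Definition mean_size : R := (t ^ 2)%:R / (p.-1)%:R.
Local Notation mu := mean_size.

Lemma pred_p_gt0 : 0 < (p.-1)%:R :> R.
Proof. by rewrite ltr0n -ltnS prednK ?p_gt1 // ltnW // p_gt1. Qed.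

Lemma leq_t_p : (t <= p.-1)%N.
Proof.
have := card_power_set cardF t0 cardH => <-; rewrite leq_pmull //.
apply/card_gt0P; exists (1 ^+ t); apply: power_setP; exact: oner_neq0.
Qed.

Lemma dispersion (e : bool) :
  \sum_(th in T) ((N th)%:R - (mu + e%:R)) ^+ 2 <= 8 * p%:R.
Proof.
have p1 := pred_p_gt0.
pose m := #|power_set F t|.
have mt : (m * t = p.-1)%N by apply: card_power_set.
have cT : #|T| = (m ^ 2)%N by rewrite cardsX.
have muE : mu * (p.-1)%:R = t%:R ^+ 2 by rewrite /mean_size divfK ?gt_eqF // natrX.
have mum : mu * m%:R = t%:R.
  have tn0 : (t%:R : R) != 0 by rewrite pnatr_eq0 -lt0n.
  by apply: (mulIf tn0); rewrite -mulrA -natrM mt muE expr2.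
have mu0 : 0 <= mu by rewrite divr_ge0.
have mut : mu <= p%:R.
  rewrite ler_pdivrMr // -natrM ler_nat; have := leq_t_p; have := p_gt1; nia.
have base : \sum_(th in T) ((N th)%:R - mu) ^+ 2 <= 3 * p%:R.
  have -> : \sum_(th in T) ((N th)%:R - mu) ^+ 2 =
      \sum_(th in T) ((N th ^ 2)%:R : R) + (- (2 * mu)) * \sum_(th in T) (N th)%:R + mu ^+ 2 * (m ^ 2)%:R.
    rewrite -cT -[X in mu ^+ 2 * X]mulr_natl mulr1 -sumr_const mulr_sumr mulr_sumr -!big_split /=.
    by apply: eq_bigr => th _; rewrite natrX; ring.
  rewrite -!natr_sum (class_size_sum _ cardF).
  have := class_size_sq cardF cardH; rewrite -(ler_nat R) natrD natrX => sq.
  have p2 : (p.-2)%:R = (p.-1)%:R - 1 :> R.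
    by rewrite -subn1 natrB // -ltnS prednK ?p_gt1 // ltnW // p_gt1.
  rewrite p2 natrX -exprMn mum.
  have -> : - (2 * mu) * ((p.-1)%:R - 1) = - (2 * t%:R ^+ 2) + 2 * mu by rewrite -muE; ring.
  lra.
have m2p : (m ^ 2 <= p)%N.
  have : (m ^ 2 * t ^ 2 <= p * t ^ 2)%N.
    by rewrite -expnMn mt; have := p_gt1; nia.
  by rewrite leq_pmul2r // expn_gt0 t0.
apply: (@le_trans _ _ (\sum_(th in T) (2 * ((N th)%:R - mu) ^+ 2 + 2))).
  apply: ler_sum => th _; case: e; last first.
    by rewrite addr0; have := sqr_ge0 ((N th)%:R - mu); lra.
  rewrite -subr_ge0 (_ : _ - _ = ((N th)%:R - mu + 1) ^+ 2) ?sqr_ge0 //=; ring.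
rewrite big_split /= -mulr_sumr sumr_const cT -mulr_natr.
have : ((m ^ 2)%:R : R) <= p%:R by rewrite ler_nat.
lra.
Qed.

End Energy2.

(* FILE A5 *)
Section Sumset.
Variables (F : finFieldType) (p t : nat).
Hypotheses (charFp : p \in [pchar F]) (cardF : #|F| = p) (t0 : (0 < t)%N).
Local Notation H := (unity_set F t).
Hypothesis cardH : #|H| = t.
Hypothesis pt2 : (p <= t ^ 2)%N.
Local Notation N := (class_size t).
Local Notation T := (class_pairs F t).
Local Notation c := (pair_class t).
Local Notation S := [set y : F | (y != 0) && (y != 1)].

Definition shift_set := [set u in H | 1 + u != 0].
Local Notation U := shift_set.
Definition mul_rep (z : F) := #|[set uv in setX U U | (1 + uv.1) * (1 + uv.2) == z]|.
Definition div_rep (z : F) := #|[set uv in setX U U | (1 + uv.1) / (1 + uv.2) == z]|.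

Lemma unity1 : 1 \in H. Proof. by rewrite inE expr1n. Qed.
Lemma unityM x y : x \in H -> y \in H -> x * y \in H.
Proof. by rewrite !inE exprMn => /eqP-> /eqP->; rewrite mulr1. Qed.
Lemma unity_div x y : x \in H -> y \in H -> x / y \in H.
Proof. by rewrite !inE expr_div_n => /eqP-> /eqP->; rewrite divr1. Qed.

Lemma variance_mul_div (R : comPzRingType) (mu : R) :
  \sum_(z in [set z : F | z != 0]) ((mul_rep z)%:R - mu) ^+ 2 =
  \sum_(z in [set z : F | z != 0]) ((div_rep z)%:R - mu) ^+ 2.
Proof.
pose Z := [set z : F | z != 0].
have expand (f : F -> nat) : \sum_(z in Z) ((f z)%:R - mu) ^+ 2 =
   \sum_(z in Z) (f z)%:R ^+ 2 - 2 * mu * \sum_(z in Z) 1 * (f z)%:R + \sum_(z in Z) mu ^+ 2.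
  rewrite mulr_sumr -sumrB -big_split /=; apply: eq_bigr => z _; ring.
have UZ uv : uv \in setX U U -> (1 + uv.1 != 0) && (1 + uv.2 != 0).
  by rewrite !inE => /andP[/andP[_ ->] /andP[_ ->]].
have mulZ uv : uv \in setX U U -> (1 + uv.1) * (1 + uv.2) \in Z.
  by move=> /UZ /andP[u v]; rewrite inE mulf_neq0.
have divZ uv : uv \in setX U U -> (1 + uv.1) / (1 + uv.2) \in Z.
  by move=> /UZ /andP[u v]; rewrite inE mulf_neq0 ?invr_eq0.
rewrite !expand.
rewrite -(sum_fiber (fun=> 1) mulZ) -(sum_fiber (fun=> 1) divZ).
rewrite (sum_fiber_sq _ mulZ) (sum_fiber_sq _ divZ).
congr (_%:R - _ + _).
pose sw (q : (F * F) * (F * F)) := ((q.1.1, q.2.2), (q.2.1, q.1.2)).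
have swK : involutive sw by case=> -[a b] [a' b'].
rewrite -[LHS](card_preimset _ (inv_inj swK)); apply: eq_card => -[[a b] [a' b']].
rewrite in_set !in_set /=.
case: (boolP (1 + b == 0)) => b0; first by rewrite ?andbF.
case: (boolP (1 + b' == 0)) => b'0; first by rewrite ?andbF.
rewrite eqr_div //; congr (_ && _).
by case: (a ^+ t == 1) (1 + a != 0) (b ^+ t == 1) (a' ^+ t == 1) (1 + a' != 0) (b' ^+ t == 1) => [] [] [] [] [] [].
Qed.

Definition line_class (th : F * F) := (th.2^-1, th.1 / th.2).

Lemma line_classE s : line_class (c s) = ((s - 1)^-1 ^+ t, (s / (s - 1)) ^+ t).
Proof. by rewrite /line_class /= exprVn expr_div_n. Qed.

Lemma card_line s : s \in S ->
  #|[set uv in setX H H | 1 + uv.1 == s * (1 + uv.2)]| = N (line_class (c s)).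
Proof.
rewrite inE => /andP[s0]; rewrite -subr_eq0 => s1.
have s1i : (s - 1)^-1 != 0 by rewrite invr_eq0.
have ss1 : s / (s - 1) != 0 by rewrite mulf_neq0.
rewrite line_classE -(@card_in_imset _ _ (fun uv => uv.1 / (s - 1))).
  apply: eq_card => y; apply/imsetP/idP => [[[u v]]|].
    rewrite in_set in_setX /= => /andP[/andP[uH vH] /eqP e] ->.
    have u0 := unity_neq0 t0 uH; have v0 := unity_neq0 t0 vH.
    have y1 : u / (s - 1) - 1 = v * (s / (s - 1)).
      have -> : u = s * (1 + v) - 1 by rewrite -e; ring.
      by field.
    rewrite !in_set mulf_neq0 //= -subr_eq0 y1 mulf_neq0 //= xpair_eqE.
    by rewrite !unityP // y1 !mulfK // uH vH.
  rewrite in_set xpair_eqE !unityP // in_set => /andP[/andP[y0 y1] /andP[uH vH]].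
  exists (y / (s - 1)^-1, (y - 1) / (s / (s - 1))); last by rewrite /= divfK ?invrK ?mulfK.
  rewrite in_set in_setX uH vH /=; apply/eqP; field.
  by rewrite s0 s1 oner_eq0.
move=> [u v] [u' v']; rewrite !in_set /= => /andP[_ /eqP e] /andP[_ /eqP e'].
move/(mulIf s1i) => uu; rewrite uu in e *; congr (_, _).
by have := mulfI s0 (etrans (esym e) e'); apply: addrI.
Qed.

Lemma div_rep_line s : s \in S -> (div_rep s + ((-1)%R \in H) = N (line_class (c s)))%N.
Proof.
move=> sS; rewrite -card_line //; move: sS; rewrite inE => /andP[s0 s1].
set L := [set uv in _ | _].
rewrite (cardsD1 (-1, -1) L) addnC; congr (_ + _)%N.
  congr nat_of_bool.
  by rewrite /L !inE /= andbb subrr mulr0 eqxx andbT.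
apply: eq_card => -[u v]; rewrite /L !inE /=.
have addN x : (1 + x == 0) = (x == -1) by rewrite addrC addr_eq0.
rewrite xpair_eqE !addN.
have [->|v1] := eqVneq v (-1).
  rewrite andbT !andbF /=; case: (eqVneq u (-1)) => //= u1.
  by rewrite subrr mulr0 addN (negbTE u1) andbF.
rewrite andbF /= andbT.
have [->|u1] := eqVneq u (-1).
  rewrite andbF /= subrr (eq_sym 0) mulf_eq0 (negbTE s0) /= addN (negbTE v1).
  by rewrite andbF.
rewrite andbT /=; congr (_ && _); rewrite -(inj_eq (mulIf (_ : 1 + v != 0))) ?addN //.
by rewrite divfK ?addN.
Qed.


Lemma line_class_in th : th \in T -> line_class th \in T.
Proof.
case: th => a b; rewrite !in_setX /= => /andP[/imsetP[x]].
rewrite in_set => x0 -> /imsetP[y]; rewrite in_set => y0 ->.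
by rewrite -exprVn -exprMn !power_setP ?mulf_neq0 ?invr_eq0.
Qed.

Lemma line_class_inj : {in T &, injective line_class}.
Proof.
move=> [a b] [a' b'] _; rewrite in_setX /= => /andP[_ /imsetP[y]].
rewrite in_set => y0 b'E [/invr_inj bb]; rewrite bb => /mulIf -> //.
by rewrite invr_eq0 b'E expf_neq0.
Qed.

Lemma class_size_le (th : F * F) : (N th <= t)%N.
Proof.
have [Pth|nPth] := boolP (th.1 \in power_set F t).
  rewrite -[leqRHS](card_power_fiber t0 cardH Pth); apply/subset_leq_card/subsetP => y.
  by rewrite !in_set => /andP[/andP[-> _] /eqP <-] /=.
rewrite /class_size (_ : [set _ in _ | _] = set0) ?cards0 //; apply/setP => y.
rewrite !in_set; apply/negbTE; apply: contra nPth => /andP[/andP[y0 _] /eqP <-].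
exact: power_setP.
Qed.

Lemma final_arith (R : realFieldType) (q d V AS S3 AP tt L : R) :
  q <= d + V -> d <= tt -> V <= AS + 2 * S3 -> AS <= AP -> AP <= 1024 * tt ->
  0 <= tt -> tt <= tt * L -> S3 <= 8 * (2 ^+ 14 * tt) * L -> q <= 2 ^+ 20 * tt * L.
Proof.
move=> h1 h2 h3 h4 h5 tt0 h6; rewrite -!mulrA; move: (tt * L) h6 => u h6 h7; lra.
Qed.

Lemma sumset_complement_field (R : realFieldType) (E : {set F}) :
  (forall x h1 h2 h3, x \in E -> h1 \in H -> h2 \in H -> h3 \in H -> x != h1 + h2 + h3) ->
  ((#|E| - 1) * t ^ 2 <= 2 ^ 20 * p ^ 2 * (trunc_log 2 t).+1)%N.
Proof.
move=> Efree.
pose mu : R := mean_size p t R; pose e : bool := -1 \in H.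
pose Z := [set z : F | z != 0].
pose Q := [set z in Z | z - 1 \in E].
have pt := leq_t_p cardF t0 cardH.
have p1 := p_gt1 charFp.
have pp1 : 0 < (p.-1)%:R :> R := pred_p_gt0 charFp R.
have muE : mu * (p.-1)%:R = (t ^ 2)%:R by rewrite /mu /mean_size divfK ?gt_eqF.
have mu1 : 1 <= mu by rewrite ler_pdivlMr // mul1r ler_nat; apply: leq_trans pt2; apply: leq_pred.
have mut : mu <= t%:R by rewrite ler_pdivrMr // -natrM ler_nat -mulnn leq_mul2l pt orbT.
pose nu : R := mu + e%:R.
have e01 : 0 <= (e%:R : R) <= 1 by case: (e); rewrite ?lexx ?ler01.
have nu0 : 0 <= nu by rewrite /nu; lra.
pose M := (t ^ 2 %/ p.-1).+1.
pose A0 := (32 * M)%N.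
have p1n : (0 < p.-1)%N by rewrite -ltnS prednK // ltnW.
have muM : mu < M%:R.
  by rewrite ltr_pdivrMr // -natrM ltr_nat /M ltn_ceil.
have Mmu : M%:R <= 2 * mu.
  suff : (t ^ 2 %/ p.-1)%:R <= mu by rewrite /M -natr1; lra.
  by rewrite ler_pdivlMr // -natrM ler_nat leq_trunc_div.
have A0R : (A0%:R : R) = 32 * M%:R by rewrite /A0 natrM.
have nuA : nu <= A0%:R by rewrite A0R /nu; lra.
have disp := dispersion charFp cardF t0 cardH pt2 R e; rewrite -/nu in disp.
have EQ : (#|E| <= #|Q| + 1)%N.
  rewrite -(card_imset _ (addrI (1 : F))) addnC -[1%N](cards1 (0 : F)).
  apply: leq_trans (leq_card_setU _ _); apply/subset_leq_card/subsetP => _ /imsetP[x xE ->].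
  rewrite in_setU in_set1 !in_set (addrC 1) addrK xE andbT. by rewrite orbN.
have varE : (#|Q|)%:R * mu ^+ 2 <= \sum_(z in Z) ((mul_rep z)%:R - mu) ^+ 2.
  have -> : (#|Q|)%:R * mu ^+ 2 = \sum_(z in Q) ((mul_rep z)%:R - mu) ^+ 2.
    rewrite mulr_natl -sumr_const; apply: eq_bigr => z.
    rewrite !in_set => /andP[z0 zE]; rewrite /mul_rep.
    rewrite (_ : [set _ in _ | _] = set0) ?cards0 ?sub0r ?sqrrN //.
    apply/setP => -[u v]; rewrite in_set in_setX [RHS]in_set0 /=.
    apply/negbTE/negP => /andP[/andP[]]; rewrite in_set => /andP[uH _].
    rewrite in_set => /andP[vH _] /eqP uvz.
    have /eqP[] := Efree _ _ _ _ zE uH vH (unityM uH vH).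
    by rewrite -uvz; ring.
  apply: (@le_trans _ _ (\sum_(z in Z | z - 1 \in E) ((mul_rep z)%:R - mu) ^+ 2)).
    by rewrite (eq_bigl (fun z => (z \in Z) && (z - 1 \in E))) // => z; rewrite in_set.
  by rewrite [leRHS](bigID (fun z => z - 1 \in E)) /= lerDl sumr_ge0 // => z _; rewrite sqr_ge0.
rewrite variance_mul_div in varE.
have splitZ : \sum_(z in Z) ((div_rep z)%:R - mu) ^+ 2 =
    ((div_rep 1)%:R - mu) ^+ 2 + \sum_(s in S) ((div_rep s)%:R - mu) ^+ 2.
  rewrite (bigD1 1) /= ?in_set ?oner_eq0 //; congr (_ + _).
  by apply: eq_bigl => z; rewrite !in_set.
have div1 : ((div_rep 1)%:R - mu) ^+ 2 <= t%:R ^+ 2.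
  have : (div_rep 1%R <= t)%N.
    apply: (@leq_trans #|H|); last by rewrite cardH.
    rewrite /div_rep -(@card_in_imset _ _ (fun uv => uv.1)).
      apply/subset_leq_card/subsetP => _ /imsetP[[u v] uvX ->].
      by move: uvX; rewrite in_set in_setX => /andP[/andP[]]; rewrite in_set => /andP[].
    move=> [u v] [u' v']; rewrite in_set => /andP[X1 /eqP e1].
    rewrite in_set => /andP[X2 /eqP e2] /= uu.
    move: X1 X2 e1 e2; rewrite !in_setX /= => _ _ /divr1_eq/addrI uv /divr1_eq/addrI uv'.
    by rewrite -uv -uv' uu.
  rewrite -(ler_nat R) => le; have n0 : 0 <= ((div_rep 1)%:R : R) by [].
  rewrite -subr_ge0 subr_sqr mulr_ge0 //; lra.
have tail : \sum_(th in T | (A0 < N th)%N) ((N th)%:R ^+ 3 : R)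
    <= (8 * (2 ^ 14 * t ^ 2) * (trunc_log 2 t).+1)%:R.
  apply: cube_sum_dyadic => [th _|I k Ik]; first exact: class_size_le.
  apply: (level_bound charFp cardF t0 cardH pt2); first by apply/subsetP => th /Ik[].
    by move=> th /Ik[].
  have IT : #|I|%:R * (30 * mu) ^+ 2 <= 8 * p%:R.
    apply: le_trans disp; rewrite mulr_natl -sumr_const.
    rewrite [leRHS](bigID (mem I)) /= ler_wpDr ?sumr_ge0 // => [th _|]; first by rewrite sqr_ge0.
    rewrite [leRHS](eq_bigl (mem I)); last first.
      by move=> th /=; case: (boolP (th \in I)) => [/Ik[->]|]; rewrite ?andbF.
    apply: ler_sum => th /Ik[_ AN _].
    have : (A0%:R : R) < (N th)%:R by rewrite ltr_nat.
    rewrite A0R => big; rewrite -subr_ge0 subr_sqr mulr_ge0 //; rewrite /nu; lra.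
  have : #|I|%:R * (30 * mu) ^+ 2 * (p.-1)%:R ^+ 2 <= 8 * p%:R * (p.-1)%:R ^+ 2.
    by rewrite ler_wpM2r ?sqr_ge0.
  have -> : #|I|%:R * (30 * mu) ^+ 2 * (p.-1)%:R ^+ 2 = #|I|%:R * 900 * (mu * (p.-1)%:R) ^+ 2 by ring.
  rewrite muE -!natrX -!natrM ler_nat => le1.
  have le2 : (p.-1 ^ 2 <= p ^ 2)%N by rewrite leq_exp2r // leq_pred.
  have le3 : (8 * p * p.-1 ^ 2 <= 8 * p * p ^ 2)%N by rewrite leq_mul2l le2 orbT.
  have {le1 le2 le3} := leq_trans le1 le3.
  rewrite -expnM (_ : #|I| * 900 * t ^ (2 * 2) = 900 * (t ^ 4 * #|I|))%N; last by ring.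
  rewrite (_ : 8 * p * p ^ 2 = 8 * p ^ 3)%N; last by ring.
  rewrite -mulnA; move: (t ^ 4 * #|I|)%N (p ^ 3)%N => X Y; clear; lia.
have skew := skew_variance N line_class_in line_class_inj nu0 nuA.
have sumS : \sum_(s in S) ((div_rep s)%:R - mu) ^+ 2 =
    \sum_(th in T) (N th)%:R * ((N (line_class th))%:R - nu) ^+ 2.
  under [RHS]eq_bigr do rewrite mulrC.
  rewrite -(@sum_fiber _ _ R S c T (fun th => ((N (line_class th))%:R - nu) ^+ 2)); last exact: pair_class_in.
  apply: eq_bigr => s sS; rewrite -div_rep_line // natrD /nu -/e; ring.
rewrite splitZ sumS in varE.
have fin : #|Q|%:R * mu ^+ 2 <= 2 ^+ 20 * t%:R ^+ 2 * (trunc_log 2 t).+1%:R.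
  have A0p : A0%:R * (8 * p%:R) <= 1024 * t%:R ^+ 2 :> R.
    have p2 : p%:R <= 2 * (p.-1)%:R :> R.
      by rewrite -natrM ler_nat mul2n -addnn -{1}(ltn_predK p1) -addn1 leq_add2l.
    have : A0%:R * (8 * p%:R) <= (64 * mu) * (8 * (2 * (p.-1)%:R)).
      by apply: ler_pM => //; rewrite ?mulr_ge0 // ?A0R; lra.
    have -> : 64 * mu * (8 * (2 * (p.-1)%:R)) = 1024 * (mu * (p.-1)%:R) by ring.
    by rewrite muE natrX.
  have A0d : A0%:R * \sum_(th in T) ((N th)%:R - nu) ^+ 2 <= A0%:R * (8 * p%:R) by rewrite ler_wpM2l.
  have l1 : 1 <= (trunc_log 2 t).+1%:R :> R by rewrite ler1n.
  have tl : t%:R ^+ 2 <= t%:R ^+ 2 * (trunc_log 2 t).+1%:R :> R by rewrite ler_peMr ?sqr_ge0.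
  have tt0 : 0 <= t%:R ^+ 2 :> R by rewrite sqr_ge0.
  move: tail; rewrite natrM (natrM _ 8) (natrM _ (2 ^ 14)) !natrX => tail.
  exact: final_arith varE div1 skew A0d A0p tt0 tl tail.
have : #|Q|%:R * mu ^+ 2 * (p.-1)%:R ^+ 2 <= 2 ^+ 20 * t%:R ^+ 2 * (trunc_log 2 t).+1%:R * (p.-1)%:R ^+ 2.
  by rewrite ler_wpM2r ?sqr_ge0.
rewrite -mulrA -exprMn muE -!natrX -!natrM ler_nat => le.
have t2 : (0 < t ^ 2)%N by rewrite expn_gt0 t0.
have leQ : (#|Q| * t ^ 2 <= 2 ^ 20 * p.-1 ^ 2 * (trunc_log 2 t).+1)%N.
  rewrite -(leq_pmul2r t2); move: le; move: (2 ^ 20)%N (p.-1 ^ 2)%N => K P.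
  rewrite (_ : #|Q| * (t ^ 2) ^ 2 = #|Q| * t ^ 2 * t ^ 2)%N; last by ring.
  by rewrite (_ : K * t ^ 2 * (trunc_log 2 t).+1 * P = K * P * (trunc_log 2 t).+1 * t ^ 2)%N; last ring.
have EQ' : (#|E| - 1 <= #|Q|)%N by rewrite leq_subLR addnC.
apply: leq_trans (leq_trans leQ _); first by rewrite leq_mul2r EQ' orbT.
by rewrite leq_mul2r leq_mul2l leq_exp2r // leq_pred !orbT.
Qed.

Theorem sumset_complement (E : {set F}) :
  (forall x h1 h2 h3, x \in E -> h1 \in H -> h2 \in H -> h3 \in H -> x != h1 + h2 + h3) ->
  ((#|E| - 1) * t ^ 2 <= 2 ^ 20 * p ^ 2 * (trunc_log 2 t).+1)%N.
Proof. exact: (sumset_complement_field rat). Qed.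

End Sumset.

(* FILE B1 *)
Section EulerProduct.
Variables (R : realFieldType) (z : nat).
Implicit Types (Q A : {set 'I_z.+1}) (w : 'I_z.+1 -> nat -> R).

Lemma sum_exponents Q A w :
  (forall q, q \in Q -> prime q) -> (forall q j, q \in Q -> 0 <= w q j) ->
  (forall n : 'I_z.+1, n \in A -> (0 < n)%N) ->
  (forall n q : 'I_z.+1, n \in A -> prime q -> q %| n -> q \in Q)%N ->
  \sum_(n in A) \prod_(q in Q) w q (logn q n) <= \prod_(q in Q) \sum_(j < z.+1) w q j.
Proof.
move=> Qp w0 A0 AQ.
pose F (q j : 'I_z.+1) : R := if q \in Q then w q j else (j == ord0)%:R.
have F0 q j : 0 <= F q j by rewrite /F; case: ifP => [/w0//|_]; rewrite ler0n.
have -> : \prod_(q in Q) \sum_(j < z.+1) w q j = \prod_q \sum_j F q j.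
  rewrite [RHS](bigID (mem Q)) /= [X in _ = _ * X]big1 ?mulr1.
    by apply: eq_bigr => q qQ; apply: eq_bigr => j _; rewrite /F qQ.
  move=> q /negbTE qQ; rewrite (bigD1 ord0) //= big1 ?addr0 /F ?qQ ?eqxx // => j /negbTE -> ; exact: mulr0n.
rewrite bigA_distr_bigA.
pose e (n : 'I_z.+1) : {ffun 'I_z.+1 -> 'I_z.+1} :=
  [ffun q : 'I_z.+1 => if q \in Q then inord (logn q n) else ord0].
have logz (q n : 'I_z.+1) : n \in A -> (logn q n < z.+1)%N.
  by move=> /A0 n0; apply: ltn_trans (ltn_logl q n0) (ltn_ord n).
have e_inj : {in A &, injective e}.
  move=> n m nA mA enm; apply/val_inj/eqn_from_log; rewrite ?A0 // => q.
  have [qp|qnp] := boolP (prime q); last by rewrite /logn (negbTE qnp).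
  have out (k : 'I_z.+1) : k \in A -> (z < q)%N -> logn q k = 0%N.
    by move=> kA zq; apply: ltn_log0; apply: leq_trans zq; apply: ltn_ord.
  have [zq|qz] := ltnP z q; first by rewrite !out.
  pose q' : 'I_z.+1 := Ordinal (qz : (q < z.+1)%N).
  have [qQ|qQ] := boolP (q' \in Q).
    have := congr1 (fun f : {ffun _ -> _} => val (f q')) enm.
    by rewrite /= !ffunE qQ /= !inordK //; apply: (logz q').
  have nd (k : 'I_z.+1) : k \in A -> logn q k = 0%N.
    move=> kA; rewrite lognE qp A0 //=; case: ifP => // qk.
    by move: qQ; rewrite (AQ k q').
  by rewrite !nd.
apply: (@le_trans _ _ (\sum_(f in [set e n | n in A]) \prod_q F q (f q))).
  rewrite big_imset //= le_eqVlt; apply/orP; left; apply/eqP; apply: eq_bigr => n nA.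
  rewrite [RHS](bigID (mem Q)) /= [X in _ = _ * X]big1 ?mulr1.
    by apply: eq_bigr => q qQ; rewrite /F ffunE qQ inordK // logz.
  by move=> q /negbTE qQ; rewrite /F ffunE qQ eqxx.
rewrite [leRHS](bigID (mem [set e n | n in A])) /= lerDl sumr_ge0 // => f _.
by apply: prodr_ge0.
Qed.

End EulerProduct.

(* FILE B2 *)
Section Subsets.
Variables (R : comNzRingType) (I : finType).

Lemma sum_subset_prod (S : {set I}) (f : I -> R) :
  \sum_(K : {set I} | K \subset S) \prod_(i in K) f i = \prod_(i in S) (f i + 1).
Proof.
rewrite [RHS]big_mkcond /=.
rewrite (eq_bigr (fun i => (if i \in S then f i else 0) + 1)); last first.
  by move=> i _; case: ifP => // _; rewrite add0r.
rewrite bigA_distr [LHS]big_mkcond; apply: eq_bigr => K _.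
case: (boolP (K \subset S)) => [/subsetP KS|/subsetPn[i iK iS]].
  rewrite big_mkcond; apply: eq_bigr => i _.
  by case: ifP => // /KS ->.
by rewrite (bigD1 i) //= iK (negbTE iS) mul0r.
Qed.

Lemma sum_sign_between (K L : {set I}) : K \subset L ->
  \sum_(M : {set I} | (K \subset M) && (M \subset L)) (-1) ^+ #|M| = (-1) ^+ #|K| * (K == L)%:R :> R.
Proof.
move=> KL.
pose f i : R := if i \in K then -1 else -1.
have -> : \sum_(M : {set I} | (K \subset M) && (M \subset L)) (-1) ^+ #|M|
   = \prod_(i : I) ((if i \in L then -1 else 0) + (if i \in K then 0 else 1)) :> R.
  rewrite bigA_distr [LHS]big_mkcond; apply: eq_bigr => M _.
  case: ifP => [/andP[/subsetP KM /subsetP ML]|].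
    rewrite -prodr_const big_mkcond; apply: eq_bigr => i _.
    case: ifP => [/ML -> //|iM]; case: ifP => // /KM; by rewrite iM.
  move/negbT; rewrite negb_and => /orP[/subsetPn[i iK iM]|/subsetPn[i iM iL]].
    by rewrite (bigD1 i) //= (negbTE iM) iK mul0r.
  by rewrite (bigD1 i) //= iM (negbTE iL) mul0r.
have [->|KnL] := eqVneq K L.
  rewrite mulr1 -prodr_const [RHS]big_mkcond; apply: eq_bigr => i _.
  by case: ifP => _; rewrite ?addr0 ?add0r.
have /properP[_ [i iL iK]] : K \proper L by rewrite properEneq KnL.
by rewrite (bigD1 i) //= iL (negbTE iK) addNr mul0r mulr0.
Qed.
End Subsets.

Section Selberg.
Variables (R : realFieldType) (d z : nat).
Hypotheses (d0 : (0 < d)%N) (z0 : (0 < z)%N).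
Implicit Types (S K L M : {set 'I_z.+1}).

Definition sieve_primes := [set q : 'I_z.+1 | prime q && ~~ (q %| d)%N].
Definition pr S := (\prod_(q in S) (q : nat))%N.
Definition sieve_sets := [set S : {set 'I_z.+1} | (S \subset sieve_primes) && (pr S <= z)%N].
Local Notation D := sieve_sets.
Definition phis S : R := \prod_(q in S) (q%:R - 1).
Definition selberg_mass : R := \sum_(S in D) (phis S)^-1.
Local Notation G := selberg_mass.
Definition selberg_weight S : R :=
  (-1) ^+ #|S| * (pr S)%:R / G * \sum_(L in D | S \subset L) (phis L)^-1.
Local Notation lam := selberg_weight.

Lemma sieve_primesP q : q \in sieve_primes -> prime q /\ ~~ (q %| d)%N.
Proof. by rewrite inE => /andP. Qed.

Lemma pr_gt0 S : S \subset sieve_primes -> (0 < pr S)%N.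
Proof. by move=> /subsetP SP; rewrite prodn_cond_gt0 // => q /SP/sieve_primesP[/prime_gt0]. Qed.

Lemma phis_gt0 S : S \subset sieve_primes -> 0 < phis S.
Proof.
by move=> /subsetP SP; rewrite prodr_gt0 // => q /SP/sieve_primesP[/prime_gt1]; rewrite subr_gt0 ltr1n.
Qed.

Lemma sieve_set_sub S : S \in D -> S \subset sieve_primes.
Proof. by rewrite inE => /andP[]. Qed.

Lemma sieve_set_down S K : S \in D -> K \subset S -> K \in D.
Proof.
rewrite !inE => /andP[SP Sz] KS; have KP := subset_trans KS SP; rewrite KP.
apply: leq_trans Sz; apply: dvdn_leq; first exact: pr_gt0.
rewrite /pr [X in (_ %| X)%N](bigID (mem K)) /= dvdn_mulr //.
rewrite [X in (_ %| X)%N](eq_bigl (mem K)) // => q /=.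
by case: (boolP (q \in K)) => qK; rewrite ?andbF // (subsetP KS).
Qed.

Lemma sieve_set0 : set0 \in D.
Proof. by rewrite inE sub0set /pr big_set0. Qed.

Lemma mass_gt0 : 0 < G.
Proof.
rewrite /G (bigD1 set0) ?sieve_set0 //= ltr_pwDl //.
  by rewrite invr_gt0 phis_gt0 ?sub0set.
by apply: sumr_ge0 => S /andP[/sieve_set_sub/phis_gt0 h _]; rewrite invr_ge0 ltW.
Qed.

Lemma weight0 : lam set0 = 1.
Proof.
rewrite /lam cards0 expr0 mul1r /pr big_set0 (eq_bigl (mem D)).
  by rewrite -/G div1r mulVf // gt_eqF // mass_gt0.
by move=> L; rewrite sub0set andbT.
Qed.

Lemma weight_le S : S \in D -> `|lam S| <= z%:R.
Proof.
move=> SD; have G0 := mass_gt0.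
rewrite /lam !normrM normrX normrN1 expr1n mul1r normfV.
rewrite [`|G|]gtr0_norm // ger0_norm ?ler0n // ger0_norm; last first.
  by apply: sumr_ge0 => L /andP[/sieve_set_sub/phis_gt0 h _]; rewrite invr_ge0 ltW.
rewrite -mulrA -[leRHS]mulr1; apply: ler_pM; rewrite ?ler0n ?mulr_ge0 ?invr_ge0 ?(ltW G0) //.
- by apply: sumr_ge0 => L /andP[/sieve_set_sub/phis_gt0 h _]; rewrite invr_ge0 ltW.
- by rewrite ler_nat; move: SD; rewrite inE => /andP[].
rewrite mulrC ler_pdivrMr // mul1r /G [leRHS](bigID (fun L => S \subset L)) /= lerDl.
by apply: sumr_ge0 => L /andP[/sieve_set_sub/phis_gt0 h _]; rewrite invr_ge0 ltW.
Qed.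

Lemma weight_dual K : K \in D ->
  \sum_(M in D | K \subset M) lam M / (pr M)%:R = (-1) ^+ #|K| / (G * phis K).
Proof.
move=> KD.
transitivity (G^-1 * \sum_(L in D) (phis L)^-1 *
   \sum_(M : {set 'I_z.+1} | (K \subset M) && (M \subset L)) (-1) ^+ #|M|).
  rewrite mulr_sumr.
  transitivity (\sum_(M in D | K \subset M) \sum_(L in D | M \subset L) G^-1 * ((phis L)^-1 * (-1) ^+ #|M|)).
    apply: eq_bigr => M /andP[MD KM]; rewrite /lam mulr_sumr mulr_suml; apply: eq_bigr => L _.
    have : (pr M)%:R != 0 :> R by rewrite pnatr_eq0 -lt0n pr_gt0 // sieve_set_sub.
    by move: (phis L)^-1 => a h; field; rewrite h gt_eqF ?mass_gt0.
  rewrite (exchange_big_dep (mem D)) /=; last by move=> M L _ /andP[].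
  apply: eq_bigr => L LD; rewrite !mulr_sumr; apply: eq_big => [M|//].
  rewrite LD /=; case: (boolP (M \subset L)) => ML; rewrite ?andbF ?andbT //.
  by rewrite (sieve_set_down LD ML).
rewrite (bigD1 K) //= (sum_sign_between _ (subxx K)) eqxx mulr1 big1 ?addr0.
  by rewrite invfM; ring.
move=> L /andP[LD LK]; have [KL|nKL] := boolP (K \subset L).
  by rewrite sum_sign_between // eq_sym (negbTE LK) !mulr0.
rewrite big_pred0 ?mulr0 // => M; apply/negbTE; apply: contra nKL => /andP[]; exact: subset_trans.
Qed.

Lemma prU S S' : (pr (S :|: S') * pr (S :&: S') = pr S * pr S')%N.
Proof.
rewrite /pr (@big_setID _ _ _ _ (S :|: S') S) /= (setUK S S') setDUl setDv set0U.
by rewrite (@big_setID _ _ _ _ S' S) /= setIC -mulnA [X in (_ * X = _)%N]mulnC.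
Qed.

Lemma quad_form :
  \sum_(S in D) \sum_(S' in D) lam S * lam S' / (pr (S :|: S'))%:R = G^-1.
Proof.
have prn0 S : S \in D -> (pr S)%:R != 0 :> R.
  by move=> SD; rewrite pnatr_eq0 -lt0n pr_gt0 // sieve_set_sub.
pose y S : R := lam S / (pr S)%:R.
transitivity (\sum_(S in D) \sum_(S' in D) \sum_(K in D | (K \subset S) && (K \subset S')) phis K * (y S * y S')).
  apply: eq_bigr => S SD; apply: eq_bigr => S' S'D.
  have SI : (pr (S :&: S'))%:R = \sum_(K in D | (K \subset S) && (K \subset S')) phis K :> R.
    rewrite /pr natr_prod (eq_bigr (fun q : 'I__ => (q%:R - 1) + 1)); last by move=> q _; rewrite subrK.
    rewrite -sum_subset_prod; apply: eq_bigl => K; rewrite subsetI.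
    case: (boolP (K \subset S)) => KS; rewrite ?andbF //=.
    by rewrite (sieve_set_down SD KS).
  rewrite -mulr_suml -SI /y.
  have UP : S :|: S' \subset sieve_primes by rewrite subUset !sieve_set_sub.
  have U0 : (pr (S :|: S'))%:R != 0 :> R by rewrite pnatr_eq0 -lt0n pr_gt0.
  have := congr1 (fun n => n%:R : R) (prU S S'); rewrite /= !natrM => e.
  have -> : (pr (S :&: S'))%:R = (pr S)%:R * (pr S')%:R / (pr (S :|: S'))%:R :> R by rewrite -e mulrC mulKf.
  by field; rewrite U0 !prn0.
transitivity (\sum_(K in D) phis K * (\sum_(S in D | K \subset S) y S) ^+ 2).
  transitivity (\sum_(S in D) \sum_(K in D) \sum_(S' in D | (K \subset S) && (K \subset S')) phis K * (y S * y S')).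
    apply: eq_bigr => S SD; rewrite (exchange_big_dep (mem D)) /=; last by move=> S' K _ /andP[].
    by apply: eq_bigr => K KD; apply: eq_bigl => S'; rewrite KD.
  rewrite exchange_big /=; apply: eq_bigr => K KD.
  rewrite expr2 big_distrl /= mulr_sumr [LHS](bigID (fun S => K \subset S)) /= [X in _ + X]big1 ?addr0; last first.
    by move=> S /andP[_ /negbTE h]; rewrite big_pred0 // => S'; rewrite h andbF.
  apply: eq_bigr => S /andP[SD KS]; rewrite mulr_sumr mulr_sumr.
  by apply: eq_bigl => S'; rewrite KS.
rewrite (eq_bigr (fun K => G^-1 ^+ 2 * (phis K)^-1)).
  by rewrite -mulr_sumr -/G expr2 -mulrA mulVf ?mulr1 // gt_eqF // mass_gt0.
move=> K KD; rewrite weight_dual // exprMn sqrr_sign mul1r invfM exprMn.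
have : phis K != 0 by rewrite gt_eqF // phis_gt0 // sieve_set_sub.
by move=> h; rewrite expr2 [(phis K)^-1 ^+ 2]expr2; field; rewrite h gt_eqF ?mass_gt0.
Qed.

End Selberg.

(* FILE B3 *)
Section Progressions.
Local Open Scope nat_scope.
Variables (d m : nat).
Hypotheses (m0 : 0 < m) (co : coprime d m).

Definition hits X := \sum_(e < X) (m %| d * e + 1).

Lemma cancel a b : a <= b -> d * a == d * b %[mod m] -> a = b %[mod m].
Proof.
move=> ab; rewrite eq_sym eqn_mod_dvd ?leq_mul2l ?ab ?orbT // -mulnBr.
by rewrite Gauss_dvdr 1?coprime_sym // -eqn_mod_dvd // eq_sym => /eqP.
Qed.

Lemma hits_period : hits m = 1.
Proof.
pose e1 := d ^ (totient m).-1 * m.-1.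
have e1P : m %| d * e1 + 1.
  rewrite /e1 mulnA -expnS prednK ?totient_gt0 //.
  rewrite /dvdn -modnDml -modnMml (Euler_exp_totient co) modnMml modnDml mul1n addn1 prednK // modnn //.
have eP (e : 'I_m) : (m %| d * e + 1) = (e == e1 %% m :> nat).
  apply/idP/eqP => [h|->].
    have : d * e + 1 == d * e1 + 1 %[mod m] by rewrite (eqP h) (eqP e1P).
    rewrite eqn_modDr => h2.
    have : e = e1 %[mod m].
      by have [/cancel/(_ h2)|/ltnW/cancel] := leqP e e1; [|rewrite eq_sym => /(_ h2)/esym].
    by rewrite modn_small.
  by rewrite /dvdn -modnDml modnMmr modnDml -/(dvdn _ _).
rewrite /hits (bigD1 (Ordinal (ltn_pmod e1 m0))) // eP eqxx big1 // => e ne.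
by rewrite eP; case: eqP => // h; case/eqP: ne; apply/val_inj.
Qed.

Lemma hitsD X : hits (m + X) = hits X + 1.
Proof.
rewrite /hits big_split_ord /= [in RHS]addnC; congr (_ + _); first exact: hits_period.
apply: eq_bigr => e _; congr nat_of_bool.
by rewrite mulnDr -addnA dvdn_addr // dvdn_mull.
Qed.

Lemma hits_bounds X : (hits X * m <= X + m) /\ (X <= hits X * m + m).
Proof.
have [n] := ubnP X; elim: n X => // n IHn X Xn.
have [Xm|mX] := ltnP X m; last first.
  have [|h1 h2] := IHn (X - m); first by lia.
  by rewrite -(subnKC mX) hitsD; lia.
split; last by lia.
have : hits X <= 1.
  rewrite -hits_period /hits -!(big_mkord xpredT (fun e => nat_of_bool (m %| d * e + 1))).
  by rewrite (@big_cat_nat _ _ _ X 0 m) //= ?leq_addr // ltnW.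
nia.
Qed.
End Progressions.

Lemma totient_ratio (R : numFieldType) n : (0 < n)%N ->
  n%:R / (totient n)%:R = \prod_(q <- primes n) (q%:R / (q.-1)%:R) :> R.
Proof.
move=> n0; rewrite totientE // {1}[n]prod_prime_decomp // prime_decompE big_map /=.
rewrite !natr_prod -prodfV -big_split /= !big_seq; apply: eq_bigr => q.
rewrite mem_primes => /and3P[qp _ qn].
have q1 : (q.-1)%:R != 0 :> R by rewrite pnatr_eq0 -lt0n -ltnS prednK ?prime_gt1 ?prime_gt0.
have q0 : q%:R != 0 :> R by rewrite pnatr_eq0 -lt0n prime_gt0.
have l0 : (0 < logn q n)%N by rewrite logn_gt0 mem_primes qp n0.
rewrite -[X in (q ^ X)%:R](prednK l0) natrM !natrX exprS.
by field; rewrite q1 expf_neq0.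
Qed.

Lemma geometric_le (R : realFieldType) (q z : nat) : (1 < q)%N ->
  \sum_(j < z.+1) (q%:R ^- j : R) <= q%:R / (q.-1)%:R.
Proof.
move=> q1; have q10 : 0 < (q.-1)%:R :> R by rewrite ltr0n -ltnS prednK // ltnW.
have qR : q%:R = (q.-1)%:R + 1 :> R by rewrite natr1 prednK // ltnW.
suff E : \sum_(j < z.+1) (q%:R ^- j : R) = (q%:R - q%:R ^- z) / (q.-1)%:R.
  by rewrite E ler_pM2r ?invr_gt0 // gerBl invr_ge0 exprn_ge0.
have q0 : q%:R != 0 :> R by rewrite pnatr_eq0 -lt0n ltnW.
elim: z => [|z IHz]; first by rewrite big_ord1 expr0 invr1 qR addrK divff // gt_eqF.
rewrite big_ord_recr IHz /= exprS qR.
by field; rewrite gt_eqF //= expf_neq0 ?andbT -?qR.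
Qed.

(* FILE B4 *)
Section Sieve.
Variables (R : realFieldType) (d z : nat).
Hypotheses (d0 : (0 < d)%N) (z0 : (0 < z)%N).
Implicit Types (S K L M : {set 'I_z.+1}).
Local Notation P := (sieve_primes d z).
Local Notation D := (sieve_sets d z).
Local Notation G := (selberg_mass R d z).
Local Notation lam := (selberg_weight R d).

Lemma prime_dvd_pr S (q : nat) : S \subset P -> prime q -> (q %| pr S)%N ->
  exists2 q' : 'I_z.+1, q' \in S & q = q'.
Proof.
move=> /subsetP SP qp; rewrite /pr Euclid_dvd_prod //.
rewrite big_has_cond => /hasP[q' _ /andP[q'S]].
by rewrite dvdn_prime2 // => [/eqP|]; [exists q'|case/SP/sieve_primesP: q'S].
Qed.

Lemma coprime_pr S n : S \subset P -> (forall q : 'I_z.+1, q \in S -> ~~ (q %| n)%N) -> coprime (pr S) n.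
Proof.
move=> SP nd; rewrite coprime_sym.
apply: contraT => nco; have g0 : (0 < gcdn n (pr S))%N by rewrite gcdn_gt0 (pr_gt0 SP) orbT.
have g1 : (1 < gcdn n (pr S))%N by rewrite ltn_neqAle eq_sym nco.
have := pdiv_dvd (gcdn n (pr S)); rewrite dvdn_gcd => /andP[qn qS].
have [q' q'S e] := prime_dvd_pr SP (pdiv_prime g1) qS.
by have := nd _ q'S; rewrite -e qn.
Qed.

Lemma dvdn_pr S n : S \subset P -> (pr S %| n)%N = [forall q in S, q %| n]%N.
Proof.
have [k] := ubnP #|S|; elim: k S => // k IHk S cS SP.
have [->|[q qS]] := set_0Vmem S.
  by rewrite /pr big_set0 dvd1n; apply/esym/forall_inP => q; rewrite inE.
have prS : pr S = (q * pr (S :\ q))%N by rewrite /pr (big_setD1 q).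
have SqP : S :\ q \subset P by apply: subset_trans SP; apply: subD1set.
have [qp _] := sieve_primesP (subsetP SP _ qS).
rewrite prS Gauss_dvd; last first.
  rewrite coprime_sym; apply: coprime_pr => // q'; rewrite in_setD1 => /andP[ne q'S].
  have [q'p _] := sieve_primesP (subsetP SP _ q'S).
  by rewrite dvdn_prime2.
rewrite IHk //; last by move: cS; rewrite (cardsD1 q) qS.
apply/andP/forall_inP => [[qn /forall_inP h] q' q'S|h].
  by have [->//|ne] := eqVneq q' q; apply: h; rewrite in_setD1 ne.
by split; [exact: h|apply/forall_inP => q'; rewrite in_setD1 => /andP[_ /h]].
Qed.

Lemma card_sieve_sets : (#|D| <= z.+1)%N.
Proof.
have inj : {in D &, injective (fun S => inord (pr S) : 'I_z.+1)}.
  move=> S S' SD S'D /(congr1 val) /=.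
  rewrite !inordK ?ltnS; try by move: SD S'D; rewrite !inE => /andP[_ ?] /andP[_ ?].
  move=> e; have sub (A B : {set 'I_z.+1}) : A \in D -> B \in D -> pr A = pr B -> A \subset B.
    move=> /sieve_set_sub AP /sieve_set_sub BP eAB; apply/subsetP => q qA.
    have [qp _] := sieve_primesP (subsetP AP _ qA).
    have : (q %| pr B)%N by rewrite -eAB /pr (big_setD1 q) //= dvdn_mulr.
    by move=> /(prime_dvd_pr BP qp)[q' q'B /val_inj ->].
  by apply/eqP; rewrite eqEsubset !sub.
by rewrite -(card_in_imset inj) (leq_trans (max_card _)) ?card_ord.
Qed.

Definition survivors X := (\sum_(e < X) [forall q in P, ~~ (q %| d * e + 1)])%N.

Lemma selberg_sieve X :
  (survivors X)%:R <= X%:R / G + ((z.+1 * z) ^ 2)%:R :> R.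
Proof.
have G0 := mass_gt0 R d z0.
pose dv S (e : nat) := [forall q in S, q %| d * e + 1]%N.
apply: (@le_trans _ _ (\sum_(e < X) (\sum_(S in D) (dv S e)%:R * lam S) ^+ 2)).
  rewrite /survivors natr_sum; apply: ler_sum => e _.
  case: forall_inP => [h|_]; last exact: sqr_ge0.
  rewrite (bigD1 set0) ?sieve_set0 //= big1 ?addr0 => [|S /andP[SD S0]].
    rewrite (weight0 _ _ z0) mulr1 (_ : dv _ _) ?expr1n //.
    by apply/forall_inP => q; rewrite inE.
  case/set0Pn: S0 => q qS; have qP := subsetP (sieve_set_sub SD) _ qS.
  rewrite (_ : dv S e = false) ?mul0r //; apply/negbTE/negP => /forall_inP/(_ q qS).
  by rewrite (negbTE (h q qP)).
have -> : \sum_(e < X) (\sum_(S in D) (dv S e)%:R * lam S) ^+ 2 =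
    \sum_(S in D) \sum_(S' in D) lam S * lam S' * (hits d (pr (S :|: S')) X)%:R.
  rewrite (eq_bigr (fun e : 'I_X => \sum_(S in D) \sum_(S' in D) lam S * lam S' * (dv S e && dv S' e)%:R)).
    rewrite exchange_big; apply: eq_bigr => S SD; rewrite exchange_big; apply: eq_bigr => S' S'D.
    rewrite -mulr_sumr /hits natr_sum; congr (_ * _); apply: eq_bigr => e _; congr (_%:R).
    rewrite dvdn_pr ?subUset ?sieve_set_sub //; congr nat_of_bool.
    apply/andP/forall_inP => [[/forall_inP h /forall_inP h'] q|h].
      by rewrite in_setU => /orP[/h|/h'].
    by split; apply/forall_inP => q qS; apply: h; rewrite in_setU qS ?orbT.
  move=> e _; rewrite expr2 mulr_suml; apply: eq_bigr => S _; rewrite mulr_sumr.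
  by apply: eq_bigr => S' _; rewrite -mulnb natrM; ring.
have hit_err S S' : S \in D -> S' \in D ->
    `|(hits d (pr (S :|: S')) X)%:R - X%:R / (pr (S :|: S'))%:R| <= 1 :> R.
  move=> SD S'D; have UP : S :|: S' \subset P by rewrite subUset !sieve_set_sub.
  have m0 := pr_gt0 UP.
  have co : coprime d (pr (S :|: S')).
    by rewrite coprime_sym; apply: coprime_pr => // q /(subsetP UP)/sieve_primesP[].
  have [h1 h2] := hits_bounds m0 co X.
  have mR : 0 < (pr (S :|: S'))%:R :> R by rewrite ltr0n.
  have hR1 : (hits d (pr (S :|: S')) X)%:R * (pr (S :|: S'))%:R <= X%:R + (pr (S :|: S'))%:R :> R.
    by rewrite -natrM -natrD ler_nat.
  have hR2 : X%:R <= (hits d (pr (S :|: S')) X)%:R * (pr (S :|: S'))%:R + (pr (S :|: S'))%:R :> R.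
    by rewrite -natrM -natrD ler_nat.
  move: (pr _)%:R (hits _ _ _)%:R mR hR1 hR2 => m c mR hR1 hR2.
  have -> : c - X%:R / m = (c * m - X%:R) / m by field; rewrite gt_eqF.
  by rewrite normrM normfV [`|m|]gtr0_norm // ler_pdivrMr // mul1r ler_norml; apply/andP; split; lra.
apply: (@le_trans _ _ (\sum_(S in D) \sum_(S' in D)
   (X%:R * (lam S * lam S' / (pr (S :|: S'))%:R) + z%:R ^+ 2))).
  apply: ler_sum => S SD; apply: ler_sum => S' S'D.
  have err := hit_err _ _ SD S'D.
  rewrite -lerBlDl.
  have -> : lam S * lam S' * (hits d (pr (S :|: S')) X)%:R - X%:R * (lam S * lam S' / (pr (S :|: S'))%:R)
    = lam S * lam S' * ((hits d (pr (S :|: S')) X)%:R - X%:R / (pr (S :|: S'))%:R) by ring.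
  apply: le_trans (ler_norm _) _; rewrite normrM (normrM (lam S)) -[leRHS]mulr1 expr2.
  apply: ler_pM => //; rewrite ?mulr_ge0 ?normr_ge0 //.
  by apply: ler_pM; rewrite ?normr_ge0 //; apply: weight_le.
rewrite (eq_bigr (fun S => X%:R * (\sum_(S' in D) lam S * lam S' / (pr (S :|: S'))%:R) + \sum_(S' in D) z%:R ^+ 2)); last first.
  by move=> S _; rewrite big_split /= mulr_sumr.
rewrite big_split /= -mulr_sumr (quad_form _ _ z0) lerD2l !sumr_const -natrX -!mulrnA ler_nat.
rewrite expnMn mulnC leq_mul // -mulnn leq_mul ?card_sieve_sets //.
Qed.

Lemma prod_prime_powers (Q : {set 'I_z.+1}) (n : 'I_z.+1) : (0 < n)%N ->
  (forall q : 'I_z.+1, prime q -> (q %| n)%N -> q \in Q) -> (\prod_(q in Q) q ^ logn q n = n)%N.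
Proof.
move=> n0 nQ; rewrite -[RHS](partnT n0) (@widen_partn z); last by rewrite -ltnS.
rewrite big_mkord [LHS]big_mkcond /=.
apply: eq_bigr => q _; case: ifP => // /negbT qQ.
suff -> : logn q n = 0%N by rewrite expn0.
rewrite lognE; case: ifP => // /and3P[qp _ qn]; by rewrite nQ in qQ.
Qed.

Lemma prod_primes_le : \prod_(q in [set q : 'I_z.+1 | prime q && (q %| d)%N]) (q%:R / (q.-1)%:R) <=
   d%:R / (totient d)%:R :> R.
Proof.
rewrite totient_ratio // [leRHS](bigID (fun q => q < z.+1)%N) /=.
have ge1 (q : nat) : prime q -> 1 <= q%:R / (q.-1)%:R :> R.
  move=> qp; rewrite ler_pdivlMr ?mul1r ?ler_nat ?leq_pred //.
  by rewrite ltr0n -ltnS prednK ?prime_gt1 ?prime_gt0.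
set Pd := [set _ | _].
have -> : \prod_(q in Pd) (q%:R / (q.-1)%:R) = \prod_(q <- primes d | (q < z.+1)%N) (q%:R / (q.-1)%:R) :> R.
  rewrite -(big_image _ _ val (mem Pd) (fun q : nat => q%:R / (q.-1)%:R : R)) /= -[RHS]big_filter.
  apply: perm_big; apply: uniq_perm; rewrite ?filter_uniq ?primes_uniq //.
    by rewrite map_inj_uniq ?enum_uniq //; apply: val_inj.
  move=> q; rewrite mem_filter mem_primes d0 /=; apply/mapP/and3P => [[q']|[qz qp qd]].
    by rewrite mem_enum inE => /andP[? ?] ->; split.
  by exists (Ordinal qz); rewrite ?mem_enum ?inE /= ?qp.
have low_ge0 : 0 <= \prod_(q <- primes d | (q < z.+1)%N) (q%:R / (q.-1)%:R) :> R.
  by apply: prodr_ge0 => q _; rewrite divr_ge0.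
rewrite ler_peMr //.
rewrite big_seq_cond; apply: (big_ind (fun x => 1 <= x)) => // [x y x1 y1|q].
  by rewrite -[1]mulr1 ler_pM.
by rewrite mem_primes => /andP[/and3P[qp _ _] _]; apply: ge1.
Qed.

Lemma mass_lower : \sum_(1 <= n < z.+1) n%:R^-1 <= d%:R / (totient d)%:R * G :> R.
Proof.
pose A := [set n : 'I_z.+1 | (0 < n)%N].
pose supp (n : 'I_z.+1) := [set q in P | q %| n]%N.
pose Pd := [set q : 'I_z.+1 | prime q && (q %| d)%N].
have -> : \sum_(1 <= n < z.+1) n%:R^-1 = \sum_(n in A) n%:R^-1 :> R.
  by rewrite big_geq_mkord; apply: eq_bigl => n; rewrite inE.
rewrite (partition_big supp (mem D)) /=; last first.
  move=> n; rewrite inE => n0.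
  have SP : supp n \subset P by apply/subsetP => q; rewrite inE => /andP[].
  rewrite inE SP; apply: (@leq_trans n); last by rewrite -ltnS.
  apply: dvdn_leq => //; rewrite dvdn_pr //; apply/forall_inP => q.
  by rewrite inE => /andP[].
rewrite /selberg_mass mulr_sumr; apply: ler_sum => S SD.
have SP := sieve_set_sub SD.
pose AS := [set n in A | supp n == S].
pose w (q : 'I_z.+1) j : R := if q \in S then (0 < j)%N%:R * q%:R ^- j else q%:R ^- j.
have disj q : q \in S -> q \in Pd = false.
  by move=> /(subsetP SP)/sieve_primesP[_ /negbTE h]; rewrite inE h andbF.
have Qprime q : q \in S :|: Pd -> prime q.
  by rewrite in_setU => /orP[/(subsetP SP)/sieve_primesP[]|]; rewrite ?inE // => /andP[].
have AQ (n q : 'I_z.+1) : n \in AS -> prime q -> (q %| n)%N -> q \in S :|: Pd.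
  rewrite !inE => /andP[n0 /eqP <-] qp qn; rewrite !inE qp qn /= andbT.
  by rewrite orNb.
have w0 q j : q \in S :|: Pd -> 0 <= w q j.
  by move=> _; rewrite /w; case: ifP => _; rewrite ?mulr_ge0 ?invr_ge0 ?exprn_ge0.
have A0 (n : 'I_z.+1) : n \in AS -> (0 < n)%N by rewrite !inE => /andP[].
have := sum_exponents Qprime w0 A0 AQ.
rewrite (eq_bigr (fun n : 'I__ => n%:R^-1)); last first.
  move=> n nAS; rewrite -[in RHS](prod_prime_powers (A0 _ nAS) (AQ n ^~ nAS)) natr_prod -prodfV.
  apply: eq_bigr => q qQ; rewrite natrX /w; case: ifP => // qS.
  suff -> : (0 < logn q n)%N by rewrite mul1r.
  move: nAS; rewrite !inE => /andP[n0 /eqP sn]; move: qS; rewrite -sn inE => /andP[/sieve_primesP[qp _] qn].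
  by rewrite logn_gt0 mem_primes qp n0.
rewrite (eq_bigl (fun n => (n \in A) && (supp n == S))); last by move=> n; rewrite inE.
move/le_trans; apply.
rewrite (bigID (mem S)) /= mulrC.
have pm1 q : prime q -> 0 < (q.-1)%:R :> R.
  by move=> qp; rewrite ltr0n -ltnS prednK ?prime_gt1 ?prime_gt0.
apply: ler_pM.
- by apply: prodr_ge0 => q /andP[qQ _]; apply: sumr_ge0 => j _; apply: w0.
- by apply: prodr_ge0 => q /andP[qQ _]; apply: sumr_ge0 => j _; apply: w0.
- apply: le_trans prod_primes_le.
  rewrite [leLHS](eq_bigl (fun q => q \in Pd)); last first.
    move=> q /=; rewrite in_setU; case: (boolP (q \in S)) => [qS|]; rewrite ?andbT //=.
    by rewrite disj.
  apply: ler_prod => q qPd; apply/andP; split.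
    by apply: sumr_ge0 => j _; apply: w0; rewrite in_setU qPd orbT.
  have qS : q \in S = false by apply/negbTE; apply: contraTN qPd => /disj ->.
  rewrite /w qS.
  by apply: geometric_le; apply: prime_gt1; apply: Qprime; rewrite in_setU qPd orbT.
rewrite /phis -prodfV [leLHS](eq_bigl (fun q => q \in S)); last first.
  by move=> q /=; rewrite in_setU; case: (q \in S); rewrite ?andbT ?andbF.
apply: ler_prod => q qS; apply/andP; split.
  by apply: sumr_ge0 => j _; apply: w0; rewrite in_setU qS.
have qp : prime q by apply: Qprime; rewrite in_setU qS.
have := geometric_le R z (prime_gt1 qp).
rewrite !big_ord_recl expr0 invr1 {1}/w qS mul0r add0r => h.
rewrite (eq_bigr (fun j : 'I_z => q%:R ^- (bump 0 j))); last by move=> j _; rewrite /w qS mul1r.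
have qR : q%:R - 1 = (q.-1)%:R :> R by rewrite -{1}(prednK (prime_gt0 qp)) -natr1 addrK.
rewrite qR; rewrite -lerBrDl in h; apply: le_trans h _.
rewrite -{1}(prednK (prime_gt0 qp)) -natr1 mulrDl divff ?gt_eqF ?pm1 // mul1r addrAC subrr add0r //.
Qed.

End Sieve.

(* FILE B5 *)
Definition primes_one_mod (N d : nat) := [set p : 'I_N.+1 | prime p && (d %| p.-1)%N].

Lemma primes_one_mod_sieve (R : realFieldType) (N d z : nat) : (0 < d)%N -> (0 < z)%N ->
  #|primes_one_mod N d|%:R <=
  z%:R + ((N %/ d).+1%:R / selberg_mass R d z + ((z.+1 * z) ^ 2)%:R) :> R.
Proof.
move=> d0 z0; apply: le_trans (lerD (lexx _) (selberg_sieve R d z0 _)).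
rewrite -natrD ler_nat.
pose small := [set p in primes_one_mod N d | p <= z]%N.
pose large := [set p in primes_one_mod N d | z < p]%N.
have -> : primes_one_mod N d = small :|: large.
  by apply/setP => p; rewrite !inE; case: leqP => _; rewrite ?andbT ?andbF ?orbF.
apply: leq_trans (leq_card_setU _ _) _; apply: leq_add.
  have zI (p : 'I_N.+1) : p \in small -> ((p : nat).-1 < z)%N.
    by rewrite !inE => /andP[/andP[/prime_gt0 p0 _] pz]; rewrite prednK.
  have inj : {in small &, injective (fun p : 'I_N.+1 => inord (p : nat).-1 : 'I_z.-1.+1)}.
    move=> p q ps qs /(congr1 val) /=; rewrite !inordK ?(prednK z0) ?zI // => e; apply/val_inj => /=.
    move: ps qs; rewrite !inE => /andP[/andP[/prime_gt0 p0 _] _] /andP[/andP[/prime_gt0 q0 _] _].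
    by rewrite -(prednK p0) -(prednK q0) e.
  by rewrite -(card_in_imset inj) (leq_trans (max_card _)) // card_ord prednK.
set X := (N %/ d).+1.
have eX (p : 'I_N.+1) : p \in large -> ((p : nat).-1 %/ d < X)%N.
  move=> _; rewrite ltnS leq_div2r //; apply: leq_trans (leq_pred _) _.
  by rewrite -ltnS ltn_ord.
have pE (p : 'I_N.+1) : p \in large -> (d * ((p : nat).-1 %/ d) + 1 = p)%N.
  rewrite !inE => /andP[/andP[/prime_gt0 p0 dp] _].
  by rewrite mulnC divnK // addn1 prednK.
have inj : {in large &, injective (fun p : 'I_N.+1 => inord ((p : nat).-1 %/ d) : 'I_X)}.
  move=> p q pl ql /(congr1 val) /=; rewrite !inordK ?eX // => e; apply/val_inj => /=.
  by rewrite -(pE p pl) -(pE q ql) e.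
rewrite -(card_in_imset inj) /survivors -sum1_card.
rewrite [leqRHS](bigID (fun e : 'I_X => e \in [set inord ((p : nat).-1 %/ d) | p : 'I_N.+1 in large])) /=.
apply: leq_trans (leq_addr _ _); apply: leq_sum => _ /imsetP[p pl ->].
rewrite inordK ?eX // pE //; case: forall_inP => // h; exfalso; apply: h => q.
rewrite inE => /andP[qp _]; move: pl; rewrite !inE => /andP[/andP[pp _] zp].
rewrite dvdn_prime2 //; apply/eqP => qpE; have := ltn_ord q.
by rewrite qpE ltnS leqNgt zp.
Qed.

Lemma totient_le n : (totient n <= n)%N.
Proof.
rewrite totient_count_coprime -[leqRHS]card_ord -sum1_card big_mkord.
by apply: leq_sum => i _; apply: leq_b1.
Qed.

Section Analytic.
Variable R : realType.

Lemma ln_harmonic n : ln (n.+1%:R : R) <= \sum_(1 <= k < n.+1) k%:R^-1.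
Proof.
elim: n => [|n IHn]; first by rewrite ln1 big_geq.
rewrite big_nat_recr //=.
have n0 : 0 < n.+1%:R :> R by rewrite ltr0n.
have -> : (n.+2%:R : R) = n.+1%:R * (1 + n.+1%:R^-1) by rewrite mulrDr mulr1 divff ?gt_eqF // natr1.
have i0 : 0 < n.+1%:R^-1 :> R by rewrite invr_gt0.
rewrite lnM ?posrE ?addr_gt0 // lerD // le_ln1Dx //.
by apply: lt_trans i0; rewrite oppr_lt0.
Qed.

Lemma root_nat (k N : nat) : (0 < k)%N -> (0 < N)%N -> exists2 z, (0 < z)%N & (z ^ k <= N < z.+1 ^ k)%N.
Proof.
move=> k0 N0; have ex1 : exists z, (z ^ k <= N)%N by exists 1%N; rewrite exp1n.
have bd z : (z ^ k <= N)%N -> (z <= N)%N.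
  by apply: leq_trans; case: z => // z; rewrite -{1}[z.+1]expn1 leq_pexp2l.
case: (ex_maxnP ex1 bd) => z zN zmax; exists z.
  by apply: zmax; rewrite exp1n.
by rewrite zN ltnNge; apply/negP => /zmax; rewrite ltnn.
Qed.

Lemma brun_titchmarsh (N d : nat) : (1 < N)%N -> (0 < d)%N -> (d ^ 3 <= N ^ 2)%N ->
  #|primes_one_mod N d|%:R <= 105 * N%:R / ((totient d)%:R * ln N%:R) :> R.
Proof.
move=> N1 d0 d3.
have N0 : (0 < N)%N by apply: ltnW.
have [z z0 /andP[zN Nz]] := @root_nat 15 N isT N0.
have lam0 : 0 < ln N%:R :> R by rewrite ln_gt0 // ltr1n.
have phi0 : 0 < (totient d)%:R :> R by rewrite ltr0n totient_gt0.
have phid : (totient d)%:R <= d%:R :> R by rewrite ler_nat totient_le.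
have dR : 0 < d%:R :> R by rewrite ltr0n.
have lnz : ln N%:R <= 15 * ln z.+1%:R :> R.
  rewrite -[15]/(15%:R) mulr_natl -lnXn ?ltr0n // ler_ln ?posrE ?exprn_gt0 ?ltr0n //.
  by rewrite -natrX ler_nat ltnW.
have G0 := mass_gt0 R d z0.
have lnz0 : 0 < ln z.+1%:R :> R by rewrite ln_gt0 // ltr1n.
have Glow : ln z.+1%:R <= d%:R / (totient d)%:R * selberg_mass R d z.
  by apply: le_trans (ln_harmonic z) _; apply: mass_lower.
have lnzz : ln z.+1%:R <= z%:R :> R.
  have := @le_ln1Dx R z%:R; rewrite -natr1 addrC; apply.
  by rewrite (lt_le_trans _ (ler0n _ _)) // oppr_lt0.
have dz : (d * z ^ 5 <= N)%N.
  rewrite -(@leq_exp2r _ _ 3) // expnMn -expnM.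
  apply: leq_trans (leq_mul d3 zN) _; by rewrite -expnSr.
apply: le_trans (primes_one_mod_sieve R N d0 z0) _.
have Nd : (N %/ d).+1%:R <= 2 * N%:R / d%:R :> R.
  rewrite ler_pdivlMr // -!natrM ler_nat mulSn mul2n -addnn leq_add ?leq_trunc_div //.
  by apply: leq_trans dz; rewrite leq_pmulr // expn_gt0 z0.
have main : (N %/ d).+1%:R / selberg_mass R d z <= 30 * N%:R / ((totient d)%:R * ln N%:R).
  rewrite ler_pdivrMr //; apply: le_trans Nd _.
  have -> : 30 * N%:R / ((totient d)%:R * ln N%:R) * selberg_mass R d z =
     (2 * N%:R / d%:R) * ((d%:R / (totient d)%:R * selberg_mass R d z) * 15 / ln N%:R).
    by field; rewrite !gt_eqF.
  rewrite ler_peMr ?divr_ge0 ?mulr_ge0 // ler_pdivlMr // mul1r.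
  by apply: le_trans lnz _; rewrite mulrC ler_wpM2r.
have err : z%:R + ((z.+1 * z) ^ 2)%:R <= 75 * N%:R / ((totient d)%:R * ln N%:R) :> R.
  apply: (@le_trans _ _ (5 * z%:R ^+ 4)).
    rewrite -natrX -natrM -natrD ler_nat.
    have : (z <= z ^ 4)%N by rewrite -{1}[z]expn1 leq_pexp2l.
    have : ((z.+1 * z) ^ 2 <= (2 * z * z) ^ 2)%N by rewrite leq_exp2r // leq_mul // mul2n -addnn -addn1 leq_add2l.
    have -> : ((2 * z * z) ^ 2 = 4 * z ^ 4)%N by ring.
    by move=> h2 h1; rewrite mulSn leq_add.
  rewrite ler_pdivlMr ?mulr_gt0 //.
  apply: (@le_trans _ _ (5 * z%:R ^+ 4 * (d%:R * (15 * z%:R)))).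
    rewrite ler_wpM2l ?mulr_ge0 ?exprn_ge0 //; apply: ler_pM => //; first exact: ltW.
    by apply: le_trans lnz _; rewrite ler_wpM2l.
  have -> : 5 * z%:R ^+ 4 * (d%:R * (15 * z%:R)) = 75 * (d%:R * z%:R ^+ 5) :> R by ring.
  by rewrite ler_wpM2l // -natrX -natrM ler_nat.
have -> : 105 * N%:R / ((totient d)%:R * ln N%:R) = 30 * N%:R / ((totient d)%:R * ln N%:R)
  + 75 * N%:R / ((totient d)%:R * ln N%:R) :> R by ring.
by rewrite addrCA; apply: lerD.
Qed.

End Analytic.

(* FILE B6 *)
Section VonMangoldt.
Variable R : realType.

Definition mangoldt_upto (N r : nat) : R :=
  \sum_(0 <= q < N.+1 | prime q) \sum_(1 <= k < N.+1) (q ^ k == r)%N%:R * ln q%:R.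
Definition mangoldt (r : nat) : R := mangoldt_upto r r.

Lemma mangoldtE N r : (r <= N)%N -> mangoldt r = mangoldt_upto N r.
Proof.
move=> rN; rewrite /mangoldt /mangoldt_upto.
rewrite [RHS](@big_cat_nat _ _ _ r.+1) //= [X in _ = _ + X]big_nat_cond [X in _ = _ + X]big1 ?addr0.
  apply: eq_bigr => q qp; rewrite [RHS](@big_cat_nat _ _ _ r.+1) //= [X in _ = _ + X]big_nat_cond.
  rewrite [X in _ = _ + X]big1 ?addr0 // => k /andP[/andP[rk _] _].
  case: eqP => [e|]; last by rewrite mul0r.
  by have := ltn_expl k (prime_gt1 qp); rewrite e => h; have := ltn_trans h rk; rewrite ltnn.
move=> q /andP[/andP[rq _] qp]; rewrite big_nat_cond big1 // => k /andP[/andP[k1 _] _].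
case: eqP => [e|]; last by rewrite mul0r.
have : (q <= q ^ k)%N by rewrite -{1}[q]expn1 leq_pexp2l // prime_gt0.
by rewrite e => h; have := leq_ltn_trans h rq; rewrite ltnn.
Qed.

Lemma ln_nat_ge0 n : 0 <= ln (n%:R : R).
Proof. by case: n => [|n]; [rewrite ln0|rewrite ln_ge0 // ler1n]. Qed.

Lemma mangoldt_ge0 r : 0 <= mangoldt r.
Proof.
by apply: sumr_ge0 => q _; apply: sumr_ge0 => k _; rewrite mulr_ge0 ?ln_nat_ge0.
Qed.

Lemma mangoldt_prime q : prime q -> ln q%:R <= mangoldt q.
Proof.
move=> qp; rewrite /mangoldt /mangoldt_upto big_mkcond big_nat_recr //= qp.
rewrite ler_wpDl //.
  apply: sumr_ge0 => q' _; case: ifP => // _.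
  by apply: sumr_ge0 => k _; rewrite mulr_ge0 ?ln_nat_ge0.
rewrite big_ltn ?ltnS ?prime_gt0 // expn1 eqxx mul1r lerDl.
by apply: sumr_ge0 => k _; rewrite mulr_ge0 ?ln_nat_ge0.
Qed.

Lemma sum_mangoldt N (f : nat -> R) :
  \sum_(1 <= r < N.+1) mangoldt r * f r =
  \sum_(0 <= q < N.+1 | prime q) \sum_(1 <= k < N.+1) (q ^ k <= N)%N%:R * (ln q%:R * f (q ^ k)%N).
Proof.
transitivity (\sum_(1 <= r < N.+1) \sum_(0 <= q < N.+1 | prime q) \sum_(1 <= k < N.+1)
   (q ^ k == r)%N%:R * (ln q%:R * f r)).
  rewrite !big_nat; apply: eq_bigr => r /andP[_ rN]; rewrite (mangoldtE (N := N)) // mulr_suml.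
  by apply: eq_bigr => q _; rewrite mulr_suml; apply: eq_bigr => k _; rewrite mulrA.
rewrite exchange_big_nat /=; apply: eq_bigr => q qp.
rewrite exchange_big_nat /=; apply: eq_bigr => k _.
case: leqP => [le|gt]; last first.
  rewrite mul0r big_nat big1 // => r /andP[_ rN]; case: eqP => [e|]; last by rewrite mul0r.
  by rewrite e leqNgt rN in gt.
rewrite mul1r (bigD1_seq (q ^ k)%N) ?iota_uniq ?mem_index_iota ?ltnS ?le ?expn_gt0 ?prime_gt0 //=.
rewrite eqxx mul1r big1 ?addr0 // => r; rewrite eq_sym => /negbTE ->; exact: mul0r.
Qed.

Lemma ln_prod_nat (I : Type) (s : seq I) (P : pred I) (F : I -> nat) :
  (forall i, P i -> (0 < F i)%N) ->
  ln ((\prod_(i <- s | P i) F i)%N%:R : R) = \sum_(i <- s | P i) ln (F i)%:R.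
Proof.
move=> F0; elim: s => [|i s IHs]; first by rewrite !big_nil ln1.
rewrite !big_cons; case: ifP => // Pi; rewrite natrM lnM ?IHs // posrE ltr0n ?F0 //.
exact: prodn_cond_gt0.
Qed.

Lemma ln_mangoldt N n : (0 < n)%N -> (n <= N)%N ->
  ln n%:R = \sum_(1 <= r < N.+1) mangoldt r * (r %| n)%:R.
Proof.
move=> n0 nN; rewrite (sum_mangoldt N (fun r => (r %| n)%:R)).
have -> : ln n%:R = \sum_(0 <= q < N.+1 | prime q) (logn q n)%:R * ln q%:R :> R.
  rewrite -{1}(partnT n0) (widen_partn _ nN) ln_prod_nat => [|q _]; last first.
    have [qp|qp] := boolP (prime q); first by rewrite expn_gt0 prime_gt0.
    by rewrite /logn (negbTE qp).
  rewrite [LHS](bigID prime) /= [X in _ + X]big1 ?addr0.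
    by apply: eq_bigr => q qp; rewrite natrX lnXn ?ltr0n ?prime_gt0 // mulr_natl.
  by move=> q /negbTE qp; rewrite /logn qp ln1.
apply: eq_bigr => q qp.
have -> : logn q n = (\sum_(1 <= k < N.+1) (q ^ k %| n))%N.
  rewrite (logn_count_dvd _ qp) [RHS](@big_cat_nat _ _ _ n) //= ?leqW // [X in (_ + X)%N]big_nat_cond.
  rewrite [X in (_ + X)%N]big1 ?addn0 // => k /andP[/andP[nk _] _].
  apply/eqP; rewrite eqb0; apply/negP => /(dvdn_leq n0) le.
  have := leq_trans (ltn_expl k (prime_gt1 qp)) le; by rewrite ltnNge nk.
rewrite natr_sum mulr_suml; apply: eq_bigr => k _.
case: (boolP (q ^ k %| n)%N) => [dv|_]; last by rewrite mulr0 mulr0 mul0r.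
by rewrite (leq_trans (dvdn_leq n0 dv) nN) mulr1.
Qed.

Definition psi x : R := \sum_(1 <= r < x.+1) mangoldt r.

Lemma ln_fact N n : (n <= N)%N ->
  ln (n`!)%:R = \sum_(1 <= r < N.+1) mangoldt r * (n %/ r)%:R.
Proof.
elim: n => [|n IHn] nN.
  by rewrite ln1 big1 // => r _; rewrite div0n mulr0.
rewrite factS natrM lnM ?posrE ?ltr0n ?fact_gt0 // IHn 1?ltnW // (ln_mangoldt (ltn0Sn n) nN) -big_split /=.
rewrite !big_nat; apply: eq_bigr => r /andP[r0 _].
by rewrite divnS // natrD mulrDr.
Qed.

Lemma ln_le_id (n : nat) : ln n%:R <= n%:R :> R.
Proof.
case: n => [|n]; first by rewrite ln0.
by apply: ltW; apply: ln_sublinear; rewrite ltr0n.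
Qed.

Lemma psi_ge0 x : 0 <= psi x.
Proof. by apply: sumr_ge0 => r _; apply: mangoldt_ge0. Qed.

Lemma psi_le x y : (x <= y)%N -> psi x <= psi y.
Proof.
move=> xy; rewrite [leRHS](@big_cat_nat _ _ _ x.+1) //= lerDl; apply: sumr_ge0 => r _.
exact: mangoldt_ge0.
Qed.

Lemma ln_central n : ln ((n.*2)`!)%:R - 2 * ln (n`!)%:R =
   \sum_(1 <= r < n.*2.+1) mangoldt r * (n.*2 %/ r - 2 * (n %/ r))%N%:R.
Proof.
rewrite (ln_fact (leqnn _)) (@ln_fact n.*2 n) ?mulr_sumr -?sumrB.
  rewrite !big_nat; apply: eq_bigr => r /andP[r0 _]; rewrite natrB ?natrM; first by ring.
  by rewrite leq_divRL // -mulnA -mul2n leq_mul2l leq_trunc_div.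
by rewrite -addnn leq_addr.
Qed.

Lemma central_upper n : ((n.*2)`! <= 4 ^ n * (n`!) ^ 2)%N.
Proof.
elim: n => // n IHn; rewrite doubleS !factS expnS.
apply: (@leq_trans (n.*2.+2 * (n.*2.+1 * (4 ^ n * (n`!) ^ 2)))).
  by rewrite !leq_mul2l IHn !orbT.
rewrite (_ : 4 * 4 ^ n * (n.+1 * n`!) ^ 2 = (4 * (n.+1 * n.+1)) * (4 ^ n * n`! ^ 2))%N; last by ring.
rewrite [leqLHS]mulnA leq_mul2r; apply/orP; right; rewrite -mul2n; nia.
Qed.

Lemma central_lower n : (2 ^ n * (n`!) ^ 2 <= (n.*2)`!)%N.
Proof.
elim: n => // n IHn; rewrite doubleS !factS expnS.
apply: (@leq_trans (n.*2.+2 * (n.*2.+1 * (2 ^ n * (n`!) ^ 2)))); last first.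
  by rewrite !leq_mul2l IHn !orbT.
rewrite (_ : 2 * 2 ^ n * (n.+1 * n`!) ^ 2 = (2 * (n.+1 * n.+1)) * (2 ^ n * n`! ^ 2))%N; last by ring.
rewrite [leqRHS]mulnA leq_mul2r; apply/orP; right; rewrite -mul2n; nia.
Qed.

Lemma ln_pow_fact (a n : nat) : (0 < a)%N ->
  ln (a ^ n * (n`!) ^ 2)%N%:R = n%:R * ln a%:R + 2 * ln (n`!)%:R :> R.
Proof.
move=> a0; rewrite natrM lnM ?posrE ?ltr0n ?expn_gt0 ?a0 ?fact_gt0 // !natrX !lnXn ?ltr0n ?fact_gt0 //.
by rewrite !mulr_natl.
Qed.

Lemma ln2_le1 : ln 2%:R <= 1 :> R.
Proof.
have := @le_ln1Dx R 1; rewrite (_ : 1 + 1 = 2%:R); last by rewrite -natr1.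
by apply; apply: lt_trans (@ltr01 R); rewrite oppr_lt0.
Qed.

Lemma psi_double n : psi n.*2 - psi n <= 2 * n%:R.
Proof.
have h : ln ((n.*2)`!)%:R - 2 * ln (n`!)%:R <= 2 * n%:R :> R.
  have up : ln ((n.*2)`!)%:R <= n%:R * ln 4%:R + 2 * ln (n`!)%:R :> R.
    rewrite -ln_pow_fact // ler_ln ?posrE ?ltr0n ?muln_gt0 ?expn_gt0 ?fact_gt0 //.
    by rewrite ler_nat central_upper.
  have ln4 : ln 4%:R <= 2 :> R.
    rewrite (natrX _ 2 2 : 4%:R = _) lnXn ?ltr0n // mulr2n; have := ln2_le1; lra.
  have n0 : 0 <= n%:R :> R by [].
  have : n%:R * ln 4%:R <= n%:R * 2 :> R by rewrite ler_wpM2l.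
  lra.
apply: le_trans h; rewrite ln_central /psi.
have le2 : (n.+1 <= n.*2.+1)%N by rewrite ltnS -addnn leq_addr.
rewrite (@big_cat_nat _ _ _ n.+1 1 n.*2.+1) //= addrAC subrr add0r.
rewrite [leRHS](@big_cat_nat _ _ _ n.+1) //= ler_wpDl //.
  by apply: sumr_ge0 => r _; rewrite mulr_ge0 ?mangoldt_ge0.
rewrite !big_nat; apply: ler_sum => r /andP[nr rn].
have r0 : (0 < r)%N by apply: leq_ltn_trans nr.
rewrite (divn_small nr) muln0 subn0 -[leLHS]mulr1 ler_wpM2l ?mangoldt_ge0 //.
by rewrite ler1n divn_gt0.
Qed.

Lemma psi_le4 x : psi x <= 4 * x%:R.
Proof.
elim/ltn_ind: x => -[|[|x]] IH.
- by rewrite /psi big_geq // mulr0.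
- rewrite /psi big_nat1 /mangoldt /mangoldt_upto big_nat_cond big1 ?mulr1 //.
  by move=> q /andP[/andP[_ q2] /prime_gt1]; rewrite ltnNge -ltnS q2.
set n := uphalf x.+2.
have xn : (x.+2 <= n.*2)%N by rewrite /n -[X in (X <= _)%N](odd_double_half x.+2) uphalf_half doubleD leq_add2r; case: (odd _).
have n2 : (n.*2 <= x.+3)%N by rewrite /n uphalf_half doubleD -[X in (_ <= X)%N]addn1 -[X in (_ <= X + 1)%N](odd_double_half x.+2); case: (odd _) => /=; lia.
have nx : (n < x.+2)%N by move: n2; rewrite -mul2n; clearbody n; clear; lia.
apply: le_trans (psi_le xn) _.
have := psi_double n; have := IH n nx.
have : 6 * n%:R <= 4 * x.+2%:R :> R.
  by rewrite -!natrM ler_nat; move: n2; rewrite -mul2n; clearbody n; clear; lia.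
lra.
Qed.

Lemma mertens_mangoldt x : (0 < x)%N ->
  \sum_(1 <= r < x.+1) mangoldt r / r%:R <= ln x%:R + 4.
Proof.
move=> x0; have xR : 0 < x%:R :> R by rewrite ltr0n.
rewrite -(ler_pM2l xR) mulr_sumr.
apply: (@le_trans _ _ (\sum_(1 <= r < x.+1) (mangoldt r * (x %/ r)%:R + mangoldt r))).
  rewrite !big_nat; apply: ler_sum => r /andP[r0 _].
  rewrite -[X in _ + X]mulr1 -mulrDr natr1 mulrCA ler_wpM2l ?mangoldt_ge0 //.
  by rewrite ler_pdivrMr ?ltr0n // -natrM ler_nat ltnW // ltn_ceil.
rewrite big_split /= -(ln_fact (leqnn x)) mulrDr.
apply: lerD; last by rewrite mulrC; apply: psi_le4.
have : (x`! <= x ^ x)%N.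
  clear; have H n : (n <= x -> n`! <= x ^ n)%N.
    elim: n => // n IHn nx; rewrite factS expnS leq_mul // IHn // ltnW //.
  exact: H.
rewrite -(ler_nat R) natrX => h.
rewrite mulr_natl -lnXn // ler_ln // posrE ?exprn_gt0 // ltr0n fact_gt0 //.
Qed.

Lemma psi_lower n : n%:R * ln 2%:R <= psi n.*2.
Proof.
have : n%:R * ln 2%:R <= ln ((n.*2)`!)%:R - 2 * ln (n`!)%:R :> R.
  rewrite lerBrDr -ln_pow_fact // ler_ln ?posrE ?ltr0n ?muln_gt0 ?expn_gt0 ?fact_gt0 //.
  by rewrite ler_nat central_lower.
move/le_trans; apply; rewrite ln_central /psi !big_nat; apply: ler_sum => r /andP[r0 _].
rewrite -[leRHS]mulr1 ler_wpM2l ?mangoldt_ge0 // lern1 leq_subLR -ltnS ltn_divLR //.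
have := ltn_ceil n r0; rewrite -mul2n; nia.
Qed.

Lemma psi_primes x : psi x <= (\sum_(0 <= q < x.+1 | prime q) 1)%N%:R * ln x%:R.
Proof.
have -> : psi x = \sum_(1 <= r < x.+1) mangoldt r * 1 by apply: eq_bigr => r _; rewrite mulr1.
rewrite (sum_mangoldt x (fun=> 1)) natr_sum mulr_suml [leLHS]big_nat_cond [leRHS]big_nat_cond; apply: ler_sum => q /andP[/andP[_ qx] qp].
rewrite mul1r; have x0 : (0 < x)%N by apply: leq_trans (prime_gt0 qp) _; rewrite -ltnS.
apply: (@le_trans _ _ ((trunc_log q x)%:R * ln q%:R)); last first.
  rewrite mulr_natl -lnXn ?ltr0n ?(prime_gt0 qp) // ler_ln ?posrE ?exprn_gt0 ?ltr0n ?(prime_gt0 qp) //.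
  by rewrite -natrX ler_nat trunc_logP // prime_gt1.
under eq_bigr do rewrite mulr1.
rewrite -mulr_suml ler_wpM2r ?ln_nat_ge0 // -natr_sum ler_nat.
have tx : (trunc_log q x < x.+1)%N.
  rewrite ltnS; have := trunc_logP (prime_gt1 qp) x0; apply: leq_trans.
  by apply: ltnW; apply: ltn_expl; apply: prime_gt1.
rewrite (@big_cat_nat _ _ _ (trunc_log q x).+1) //= [X in (_ + X)%N]big_nat_cond.
rewrite [X in (_ + X)%N]big1 ?addn0 => [|k /andP[/andP[tk _] _]].
  apply: (@leq_trans (\sum_(1 <= k < (trunc_log q x).+1) 1)%N).
    by apply: leq_sum => k _; apply: leq_b1.
  by rewrite sum_nat_const_nat subSS subn0 muln1.
by apply/eqP; rewrite eqb0; apply/negP => /(trunc_log_max (prime_gt1 qp)); rewrite leqNgt tk.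
Qed.

Lemma prime_count_lower n : n%:R * ln 2%:R <=
  (\sum_(0 <= q < n.*2.+1 | prime q) 1)%N%:R * ln n.*2%:R :> R.
Proof. exact: le_trans (psi_lower n) (psi_primes _). Qed.

Lemma mertens_log x : (0 < x)%N ->
  \sum_(1 <= q < x.+1 | prime q) ln q%:R / q%:R <= ln x%:R + 4 :> R.
Proof.
move=> x0; apply: le_trans (mertens_mangoldt x0).
rewrite big_mkcond; apply: ler_sum => q _; case: ifP => [/mangoldt_prime h|_].
  by rewrite ler_wpM2r ?invr_ge0.
by rewrite divr_ge0 ?mangoldt_ge0.
Qed.

Definition mertens_const : R := (ln 2%:R + 4) / ln 2%:R - ln (ln 2%:R).

Lemma mertens_inv x : (1 < x)%N ->
  \sum_(1 <= q < x.+1 | prime q) (q%:R^-1 : R) <= ln (ln x%:R) + mertens_const.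
Proof.
pose a n : R := if prime n then ln n%:R / n%:R else 0.
pose A n := \sum_(1 <= q < n.+1) a q.
have aE n : a n / ln n%:R = if prime n then n%:R^-1 else 0.
  rewrite /a; case: ifP => [np|_]; last by rewrite mul0r.
  have l0 : 0 < ln n%:R :> R by rewrite ln_gt0 // ltr1n prime_gt1.
  by rewrite mulrAC divff ?mul1r // gt_eqF.
have A_le n : (0 < n)%N -> A n <= ln n%:R + 4.
  by move=> n0; apply: le_trans (mertens_log n0); rewrite /A /a -big_mkcond.
have key n : \sum_(1 <= q < n.+3) a q / ln q%:R + (ln n.+2%:R + 4 - A n.+2) / ln n.+2%:R
    <= ln (ln n.+2%:R) + mertens_const.
  elim: n => [|n IHn].
    have a2 : \sum_(1 <= q < 3) a q / ln q%:R = A 2%N / ln 2%:R.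
      by rewrite /A /a unlock /= !(mul0r, add0r, addr0).
    by rewrite a2 /mertens_const le_eqVlt; apply/orP; left; apply/eqP; ring.
  rewrite big_nat_recr //=.
  have -> : A n.+3 = A n.+2 + a n.+3 by rewrite /A big_nat_recr.
  set l := ln n.+2%:R in IHn *; set l' := ln n.+3%:R.
  set B := \sum_(1 <= q < n.+3) _ in IHn *.
  have l0 : 0 < l by rewrite ln_gt0 // ltr1n.
  have ll : l <= l' by rewrite /l /l' ler_ln ?posrE ?ltr0n // ler_nat.
  have l'0 : 0 < l' := lt_le_trans l0 ll.
  have s0 : 0 <= l + 4 - A n.+2 by rewrite subr_ge0; apply: A_le.
  have -> : B + a n.+3 / l' + (l' + 4 - (A n.+2 + a n.+3)) / l' =
     B + (l + 4 - A n.+2) / l' + (1 - l / l') by field; rewrite gt_eqF.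
  have step1 : (l + 4 - A n.+2) / l' <= (l + 4 - A n.+2) / l.
    by rewrite ler_wpM2l // lef_pV2 ?posrE.
  have step2 : 1 - l / l' <= ln l' - ln l.
    have := @le_ln1Dx R (l / l' - 1).
    rewrite (addrC 1) subrK ln_div ?posrE //.
    have q0 : 0 < l / l' by rewrite divr_gt0.
    move=> h; have : ln l - ln l' <= l / l' - 1 by apply: h; lra.
    lra.
  lra.
case: x => [|[|x]] // _.
have := key x; rewrite [X in X <= _ -> _]addrC => h.
have s0 : 0 <= (ln x.+2%:R + 4 - A x.+2) / ln x.+2%:R.
  by rewrite divr_ge0 ?ln_nat_ge0 // subr_ge0; apply: A_le.
rewrite big_mkcond /=; under eq_bigr do rewrite -aE.
by apply: le_trans h; rewrite lerDr.
Qed.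

End VonMangoldt.

(* FILE B7 *)
Definition omega n := size (primes n).

Section OmegaSums.
Variable R : realType.
Implicit Types zeta : R.

Definition hfun zeta n : R := zeta ^+ omega n / (totient n)%:R.

Lemma prod_primes_ord (z : nat) (n : 'I_z.+1) (T : comPzRingType) (F : nat -> T) : (0 < n)%N ->
  \prod_(q <- primes n) F q = \prod_(q in [set q : 'I_z.+1 | prime q && (q %| n)%N]) F q.
Proof.
move=> n0; set Pn := [set _ | _].
rewrite -(big_image _ _ val (mem Pn) F) /=.
apply: perm_big; apply: uniq_perm; rewrite ?primes_uniq //.
  by rewrite map_inj_uniq ?enum_uniq //; apply: val_inj.
move=> q; rewrite mem_primes n0 /=; apply/andP/mapP => [[qp qn]|[q']].
  have qz : (q < z.+1)%N by apply: leq_ltn_trans (ltn_ord n); apply: dvdn_leq.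
  by exists (Ordinal qz); rewrite ?mem_enum ?inE /= ?qp.
by rewrite mem_enum inE => /andP[? ?] ->; split.
Qed.

Lemma sum_inv_sq x : \sum_(1 <= n < x.+1) (n%:R ^- 2 : R) <= 2.
Proof.
suff H : \sum_(1 <= n < x.+2) (n%:R ^- 2 : R) <= 2 - x.+1%:R^-1.
  apply: le_trans (_ : \sum_(1 <= n < x.+2) (n%:R ^- 2 : R) <= _); last first.
    by apply: le_trans H _; rewrite gerBl invr_ge0.
  by rewrite [leRHS]big_nat_recr //= lerDl invr_ge0 exprn_ge0.
elim: x => [|x IHx]; first by rewrite big_nat1 expr1n invr1; lra.
rewrite big_nat_recr //=; apply: le_trans (lerD IHx (lexx _)) _.
have a0 : 0 < x.+1%:R :> R by rewrite ltr0n.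
rewrite -[x.+2%:R]natr1; move: (x.+1%:R : R) a0 => a a0.
have a1 : 0 < a + 1 by rewrite addr_gt0.
rewrite -subr_ge0.
have -> : 2 - (a + 1)^-1 - (2 - a^-1 + (a + 1) ^- 2) = (a * (a + 1) ^+ 2)^-1.
  by field; rewrite !gt_eqF.
by rewrite invr_ge0 mulr_ge0 ?exprn_ge0 // ltW.
Qed.

Lemma prodr_size (s : seq nat) (a : R) : \prod_(q <- s) a = a ^+ size s.
Proof. by rewrite big_const_seq count_predT iter_mulr_1. Qed.

Definition euler_const : R := mertens_const R + 12.

Lemma mertens_const_ge0 : 0 <= mertens_const R.
Proof.
have l2 : 0 < ln 2%:R :> R by rewrite ln_gt0 // ltr1n.
have : ln (ln 2%:R) <= 0 :> R by rewrite ln_le0 // ln2_le1.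
have : 0 <= (ln 2%:R + 4) / ln 2%:R :> R by rewrite divr_ge0 ?addr_ge0 ?(ltW l2).
rewrite /mertens_const; lra.
Qed.

Lemma euler_sum zeta x : 0 <= zeta <= 1 -> (1 < x)%N ->
  \sum_(1 <= n < x.+1) hfun zeta n <= expR (zeta * ln (ln x%:R) + euler_const).
Proof.
move=> /andP[z0 z1] x1.
pose Q := [set q : 'I_x.+1 | prime q].
pose A := [set n : 'I_x.+1 | (0 < n)%N].
pose w (q : 'I_x.+1) j : R := if j is j'.+1 then zeta / ((q : nat).-1 * q ^ j')%N%:R else 1.
have Qp q : q \in Q -> prime q by rewrite inE.
have w0 q j : q \in Q -> 0 <= w q j by case: j => [|j] _ //=; rewrite divr_ge0.
have A0 (n : 'I_x.+1) : n \in A -> (0 < n)%N by rewrite inE.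
have AQ (n q : 'I_x.+1) : n \in A -> prime q -> (q %| n)%N -> q \in Q by rewrite !inE.
have -> : \sum_(1 <= n < x.+1) hfun zeta n = \sum_(n in A) \prod_(q in Q) w q (logn q n).
  rewrite big_geq_mkord; apply: eq_big => [n|n n0]; first by rewrite inE.
  have n0' : (0 < n)%N by case/andP: n0.
  rewrite /hfun totientE // natr_prod -prodfV /omega -prodr_size -big_split /=.
  rewrite (prod_primes_ord (fun q => zeta / (q.-1 * q ^ (logn q n).-1)%N%:R) n0').
  rewrite [RHS](bigID (fun q : 'I__ => q %| n)%N) /= [X in _ = _ * X]big1 ?mulr1.
    apply: eq_big => [q|q]; rewrite !inE // => /andP[qp qn].
    have : (0 < logn q n)%N by rewrite logn_gt0 mem_primes qp n0'.
    by rewrite /w; case: (logn q n).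
  by move=> q /andP[_ /negbTE qn]; rewrite lognE qn !andbF.
apply: le_trans (sum_exponents Qp w0 A0 AQ) _.
apply: (@le_trans _ _ (\prod_(q in Q) expR (zeta / q%:R + 6 * q%:R ^- 2))).
  apply: ler_prod => q qQ; rewrite sumr_ge0 => [/=|j _]; last exact: w0.
  have qp := Qp q qQ; have q1 := prime_gt1 qp.
  have qR : 2 <= q%:R :> R by rewrite ler_nat.
  have qm : (q.-1)%:R = q%:R - 1 :> R by rewrite -{2}(prednK (prime_gt0 qp)) -natr1 addrK.
  have x0 : (0 < x)%N by apply: ltnW.
  have g := geometric_le R x.-1 q1; rewrite (prednK x0) in g.
  rewrite big_ord_recl /=.
  rewrite (eq_bigr (fun j : 'I_x => zeta / (q.-1)%:R * q%:R ^- j)); last first.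
    by move=> j _; rewrite /= natrM natrX invfM mulrA.
  rewrite -mulr_sumr.
  have qm0 : 0 < (q.-1)%:R :> R by rewrite qm; lra.
  apply: (@le_trans _ _ (1 + zeta / (q.-1)%:R * (q%:R / (q.-1)%:R))).
    by rewrite lerD2l ler_wpM2l // divr_ge0.
  apply: le_trans (expR_ge1Dx _); rewrite lerD2l qm.
  move: (q%:R : R) qR => a a2; have a0 : 0 < a by lra. have am : 0 < a - 1 by lra.
  apply: (@le_trans _ _ (zeta * (a^-1 + 6 * a ^- 2))).
    rewrite -mulrA ler_wpM2l // -subr_ge0.
    have -> : a^-1 + 6 * a ^- 2 - (a - 1)^-1 * (a / (a - 1)) = (4 * a - 3) * (a - 2) / (a ^+ 2 * (a - 1) ^+ 2).
      by field; rewrite !gt_eqF.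
    by rewrite divr_ge0 ?mulr_ge0 ?exprn_ge0 //; lra.
  rewrite mulrDr lerD2l -[leRHS]mul1r ler_wpM2r // mulr_ge0 // invr_ge0 exprn_ge0 //; lra.
rewrite -expR_sum ler_expR big_split /= /euler_const addrA.
have toord (F : nat -> R) : \sum_(q in Q) F q = \sum_(1 <= q < x.+1 | prime q) F q.
  rewrite big_geq_mkord; apply: eq_bigl => q; rewrite inE.
  by case: (boolP (prime q)) => //= /prime_gt0 ->.
apply: lerD.
  rewrite -mulr_sumr (toord (fun q => q%:R^-1)).
  apply: le_trans (ler_wpM2l z0 (mertens_inv R x1)) _.
  by rewrite mulrDr lerD2l ler_piMl // mertens_const_ge0.
rewrite -mulr_sumr (toord (fun q => q%:R ^- 2)) (_ : 12 = 6 * 2); last by ring.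
rewrite ler_wpM2l // (le_trans _ (sum_inv_sq x)) // big_mkcond ler_sum // => q _.
by case: ifP => // _; rewrite invr_ge0 exprn_ge0.
Qed.

End OmegaSums.

(* FILE B8 *)
Lemma totient_pfactor_ge (q k m : nat) : prime q -> (0 < k)%N -> (0 < m)%N ->
  (q ^ k * totient m <= 2 * totient (q ^ k * m))%N.
Proof.
move=> qp k0 m0; have [m' co ->] := pfactor_coprime qp m0.
have q2 : (q <= 2 * q.-1)%N by have := prime_gt1 qp; lia.
set a := logn q m.
have -> : (q ^ k * (m' * q ^ a) = m' * q ^ (a + k))%N by rewrite expnD; ring.
have co2 b : coprime m' (q ^ b) by rewrite coprime_sym coprimeXl.
rewrite !totient_coprime // mulnCA [leqRHS]mulnCA leq_mul2l; apply/orP; right.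
rewrite [totient (q ^ (a + k))]totient_pfactor ?addn_gt0 ?k0 ?orbT //.
have [->|a0] := posnP a.
  by rewrite expn0 (_ : totient 1 = 1%N) // muln1 add0n mulnA -{1}(prednK k0) expnS leq_mul2r q2 orbT.
rewrite totient_pfactor // mulnCA -expnD (_ : k + a.-1 = (a + k).-1)%N ?leq_pmull //.
by rewrite addnC -[X in _ = (X + _).-1](prednK a0).
Qed.

Lemma omega_pfactor (q k m : nat) : (0 < m)%N -> prime q -> (omega m <= omega (q ^ k * m))%N.
Proof.
move=> m0 qp; apply: uniq_leq_size; first exact: primes_uniq.
by move=> r; rewrite !mem_primes m0 muln_gt0 expn_gt0 (prime_gt0 qp) m0 => /andP[-> rm]; rewrite dvdn_mull.
Qed.

Section Blocks.
Variable R : realType.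
Implicit Types zeta : R.

Lemma hfun_ge0 zeta n : 0 <= zeta -> 0 <= hfun zeta n.
Proof. by move=> z0; rewrite /hfun divr_ge0 ?exprn_ge0. Qed.

Lemma hfun_pfactor zeta (q k m : nat) : 0 <= zeta <= 1 -> prime q -> (0 < k)%N -> (0 < m)%N ->
  hfun zeta (q ^ k * m) <= 2 / (q ^ k)%:R * hfun zeta m.
Proof.
move=> /andP[z0 z1] qp k0 m0; rewrite /hfun mulrCA.
have qk0 : (0 < q ^ k)%N by rewrite expn_gt0 prime_gt0.
apply: ler_pM; rewrite ?exprn_ge0 ?invr_ge0 //.
  by rewrite ler_wiXn2l // omega_pfactor.
have h : (q ^ k)%:R * (totient m)%:R <= 2 * (totient (q ^ k * m))%:R :> R.
  by rewrite -!natrM ler_nat totient_pfactor_ge.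
have A0 : 0 < (totient (q ^ k * m))%:R :> R by rewrite ltr0n totient_gt0 muln_gt0 qk0.
have B0 : 0 < (q ^ k)%:R :> R by rewrite ltr0n.
have C0 : 0 < (totient m)%:R :> R by rewrite ltr0n totient_gt0.
move: (totient (q ^ k * m))%:R (q ^ k)%:R (totient m)%:R h A0 B0 C0 => A B C h A0 B0 C0.
rewrite -subr_ge0; have -> : 2 / B * C^-1 - A^-1 = (2 * A - B * C) / (A * B * C).
  by field; rewrite !gt_eqF.
by rewrite divr_ge0 ?subr_ge0 // !mulr_ge0 // ltW.
Qed.

Lemma sum_multiples (Y r : nat) (F : nat -> R) : (0 < r)%N ->
  \sum_(1 <= d < Y.+1) (r %| d)%:R * F d =
  \sum_(1 <= m < Y.+1) (r * m <= Y)%N%:R * F (r * m)%N.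
Proof.
move=> r0.
transitivity (\sum_(1 <= d < Y.+1) \sum_(1 <= m < Y.+1) (r * m == d)%N%:R * F d).
  rewrite !big_nat; apply: eq_bigr => d /andP[d1 dY].
  rewrite -mulr_suml; congr (_ * _); case: (boolP (r %| d)%N) => [/dvdnP[m e]|nd].
    have m0 : (0 < m)%N by move: d1; rewrite e muln_gt0 => /andP[].
    have mY : (m < Y.+1)%N by apply: leq_ltn_trans dY; rewrite e leq_pmulr.
    rewrite (bigD1_seq m) ?iota_uniq ?mem_index_iota ?m0 //= e mulnC eqxx big1 ?addr0 // => m' ne.
    case: eqP => // h; case/eqP: ne; apply/eqP; rewrite -(eqn_pmul2l r0); apply/eqP; lia.
  rewrite big1 // => m _; case: eqP => // e; by move: nd; rewrite -e dvdn_mulr.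
rewrite exchange_big /= !big_nat; apply: eq_bigr => m /andP[m1 mY].
case: leqP => [le|gt]; last first.
  rewrite mul0r big_nat big1 // => d /andP[_ dY]; case: eqP => [e|]; last by rewrite mul0r.
  by rewrite e leqNgt dY in gt.
rewrite mul1r (bigD1_seq (r * m)%N) ?iota_uniq ?mem_index_iota ?ltnS ?le ?muln_gt0 ?r0 ?m1 //=.
by rewrite eqxx mul1r big1 ?addr0 // => d; rewrite eq_sym => /negbTE ->; rewrite mul0r.
Qed.

Lemma block_log zeta y : 0 <= zeta <= 1 -> (0 < y)%N ->
  \sum_(y.+1 <= d < y.*2.+1) hfun zeta d * ln d%:R <= 16 * \sum_(1 <= m < y.*2.+1) hfun zeta m.
Proof.
move=> z01 y0; have /andP[z0 z1] := z01.
pose Y := y.*2.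
have yY : (y.+1 <= Y.+1)%N by rewrite ltnS /Y -addnn leq_addr.
pose g d : R := (y < d)%N%:R * hfun zeta d.
have g0 d : 0 <= g d by rewrite mulr_ge0 ?hfun_ge0.
have -> : \sum_(y.+1 <= d < Y.+1) hfun zeta d * ln d%:R =
   \sum_(1 <= r < Y.+1) mangoldt R r * \sum_(1 <= d < Y.+1) (r %| d)%:R * g d.
  under [RHS]eq_bigr do rewrite mulr_sumr.
  rewrite exchange_big /= [RHS](@big_cat_nat _ _ _ y.+1) //= [X in _ = X + _]big_nat [X in _ = X + _]big1 ?add0r.
    rewrite !big_nat; apply: eq_bigr => d /andP[yd dY].
    have d0 : (0 < d)%N by apply: leq_trans yd.
    rewrite (ln_mangoldt R d0 (dY : (d <= Y)%N)) mulr_sumr; apply: eq_bigr => r _.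
    by rewrite /g yd mul1r; ring.
  move=> d /andP[_ dy]; rewrite big1 // => r _.
  by rewrite /g ltnNge -ltnS dy /= mul0r !mulr0.
pose f' (r : nat) : R := \sum_(1 <= m < Y.+1) ((r * m <= Y)%N && (y < r * m)%N)%:R * (2 / r%:R * hfun zeta m).
apply: (@le_trans _ _ (\sum_(1 <= r < Y.+1) mangoldt R r * f' r)).
  rewrite (sum_mangoldt Y (fun r => \sum_(1 <= d < Y.+1) (r %| d)%:R * g d)) (sum_mangoldt Y f').
  apply: ler_sum => q qp; rewrite [leLHS]big_nat_cond [leRHS]big_nat_cond; apply: ler_sum => k /andP[/andP[k1 _] _].
  rewrite ler_wpM2l // ler_wpM2l ?ln_nat_ge0 //.
  rewrite sum_multiples ?expn_gt0 ?prime_gt0 // /f' [leLHS]big_nat_cond [leRHS]big_nat_cond; apply: ler_sum => m /andP[/andP[m1 _] _].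
  rewrite /g mulrA -natrM mulnb ler_wpM2l //; exact: hfun_pfactor.
rewrite /f'; under eq_bigr do rewrite mulr_sumr.
rewrite exchange_big /= mulr_sumr big_nat [leRHS]big_nat; apply: ler_sum => m /andP[m1 mY].
have mR : 0 < m%:R :> R by rewrite ltr0n.
have yR : 0 < y%:R :> R by rewrite ltr0n.
apply: (@le_trans _ _ (\sum_(1 <= r < Y.+1 | (r * m <= Y)%N) mangoldt R r * (2 * m%:R / y%:R * hfun zeta m))).
  rewrite [leRHS]big_mkcond !big_nat; apply: ler_sum => r /andP[r1 _].
  case: (leqP (r * m) Y) => [le|_]; last by rewrite mul0r mulr0.
  rewrite ler_wpM2l ?mangoldt_ge0 //=.
  case: (leqP (r * m) y) => [_|gt]; first by rewrite mul0r (mulr_ge0 (divr_ge0 _ _)) ?hfun_ge0 ?mulr_ge0 ?ler0n.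
  rewrite mul1r ler_wpM2r ?hfun_ge0 // -mulrA ler_wpM2l // ler_pdivlMr // ler_pdivrMl ?ltr0n //.
  by rewrite -natrM ler_nat ltnW.
rewrite -mulr_suml.
have -> : 16 * hfun zeta m = (8 * y%:R / m%:R) * (2 * m%:R / y%:R * hfun zeta m).
  by field; rewrite !gt_eqF.
rewrite ler_wpM2r ?(mulr_ge0 (divr_ge0 _ _)) ?hfun_ge0 ?mulr_ge0 ?ler0n //.
apply: (@le_trans _ _ (psi R (Y %/ m))).
  rewrite /psi (eq_bigl (fun r => r <= Y %/ m)%N); last by move=> r; rewrite leq_divRL.
  have le : ((Y %/ m).+1 <= Y.+1)%N by rewrite ltnS leq_div.
  rewrite (@big_cat_nat _ _ _ (Y %/ m).+1) //= [X in _ + X]big_nat_cond [X in _ + X]big1 ?addr0.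
    rewrite big_mkcond; apply: ler_sum => r _; case: ifP => // _; exact: mangoldt_ge0.
  by move=> r /andP[/andP[lt _]]; rewrite leqNgt lt.
apply: le_trans (psi_le4 _ _) _; rewrite ler_pdivlMr //.
have -> : 8 * y%:R = 4 * Y%:R :> R by rewrite /Y -muln2 natrM; ring.
rewrite -mulrA -[X in 4 * X <= _]natrM.
by rewrite ler_wpM2l // ler_nat leq_trunc_div.
Qed.

Lemma block_sum zeta y : 0 <= zeta <= 1 -> (1 < y)%N ->
  \sum_(y.+1 <= d < y.*2.+1) hfun zeta d <=
  16 / ln y%:R * expR (zeta * ln (ln y.*2%:R) + euler_const R).
Proof.
move=> z01 y1; have y0 : (0 < y)%N by apply: ltnW.
have /andP[z0 _] := z01.
have l0 : 0 < ln y%:R :> R by rewrite ln_gt0 // ltr1n.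
rewrite mulrAC ler_pdivlMr //.
apply: (@le_trans _ _ (\sum_(y.+1 <= d < y.*2.+1) hfun zeta d * ln d%:R)).
  rewrite mulr_suml big_nat [leRHS]big_nat; apply: ler_sum => d /andP[yd _].
  have d0 : (0 < d)%N by apply: leq_trans yd.
  by rewrite ler_wpM2l ?hfun_ge0 // ler_ln ?posrE ?ltr0n // ler_nat ltnW.
apply: le_trans (block_log z01 y0) _; rewrite ler_wpM2l // euler_sum //.
by apply: leq_trans y1 _; rewrite -addnn leq_addr.
Qed.

End Blocks.

(* FILE B9 *)
Lemma all_primes z (S : {set 'I_z.+1}) : (forall q, q \in S -> prime q) -> S \subset sieve_primes 1 z.
Proof.
move=> Sp; apply/subsetP => q qS; rewrite inE Sp //=.
by rewrite dvdn1; apply/negP => /eqP q1; have := Sp q qS; rewrite q1.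
Qed.

Section SmallOrder.
Variables (g : int) (N T s : nat).
Hypothesis hg : 2 <= `|g|.

Definition small_order_primes := [set p : 'I_N.+1 | [&& prime p, (s < p)%N &
  [exists t : 'I_T.+1, (0 < t)%N && (p %| `|g ^+ t - 1|)%N]]].

Lemma absz_pow_sub1 t : (0 < t)%N -> (0 < `|g ^+ t - 1| <= (2 * `|g|) ^ t)%N.
Proof.
move=> t0; have g2 : (2 <= `|g|)%N by rewrite -lez_nat abszE.
have gt : (2 <= `|g| ^ t)%N by apply: leq_trans g2 _; rewrite -{1}[`|g|%N]expn1 leq_pexp2l // ltnW.
apply/andP; split.
  rewrite absz_gt0 subr_eq0; apply: contraTneq gt => e.
  by rewrite -abszX e.
have : (`|g ^+ t - 1| <= `|g| ^ t + 1)%N.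
  by rewrite -lez_nat PoszD !abszE -abszX abszE; apply: ler_normB.
move/leq_trans; apply; rewrite expnMn.
have : (2 <= 2 ^ t)%N by rewrite -{1}[2%N]expn1 leq_pexp2l.
nia.
Qed.

Lemma small_order_bound : (s ^ #|small_order_primes| <= (2 * `|g|) ^ (T ^ 2))%N.
Proof.
set S := small_order_primes.
pose P := (\prod_(1 <= t < T.+1) `|g ^+ t - 1|)%N.
have P0 : (0 < P)%N.
  by rewrite /P big_nat prodn_cond_gt0 // => t /andP[t0 _]; case/andP: (absz_pow_sub1 t0).
have Sp q : q \in S -> prime q by rewrite inE => /andP[].
have dvd : (pr S %| P)%N.
  rewrite (@dvdn_pr 1 N) ?all_primes //; apply/forall_inP => p; rewrite inE => /and3P[_ _ /existsP[t /andP[t0 pt]]].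
  by apply: dvdn_trans pt _; rewrite /P (bigD1_seq (t : nat)) ?iota_uniq ?mem_index_iota ?t0 ?ltn_ord //= dvdn_mulr.
apply: (@leq_trans (pr S)).
  rewrite -prod_nat_const; apply: leq_prod => p; rewrite inE => /and3P[_ sp _]; exact: ltnW.
apply: leq_trans (dvdn_leq P0 dvd) _.
apply: (@leq_trans (\prod_(1 <= t < T.+1) (2 * `|g|) ^ t)%N).
  rewrite /P !big_nat; apply: leq_prod => t /andP[t0 _]; by case/andP: (absz_pow_sub1 t0).
rewrite -expn_sum leq_pexp2l ?muln_gt0 //=.
  by have : (2 <= `|g|)%N by [rewrite -lez_nat abszE]; lia.
apply: (@leq_trans (\sum_(1 <= t < T.+1) T)%N); last by rewrite sum_nat_const_nat subSS subn0 mulnn.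
by rewrite big_nat [leqRHS]big_nat; apply: leq_sum => t /andP[_ tT].
Qed.

Lemma small_order_count (R : realType) : (0 < s)%N ->
  #|small_order_primes|%:R * ln s%:R <= (T ^ 2)%:R * ln (2 * `|g|)%N%:R :> R.
Proof.
move=> s0; have g2 : (0 < 2 * `|g|)%N by have : (2 <= `|g|)%N by [rewrite -lez_nat abszE]; lia.
rewrite !mulr_natl -!lnXn ?ltr0n // ler_ln ?posrE ?exprn_gt0 ?ltr0n //.
by rewrite -!natrX ler_nat small_order_bound.
Qed.
End SmallOrder.

Section GcdCount.
Variables (R : realType) (N a : nat).

Definition square_primes := [set p : 'I_N.+1 | (1 < p)%N && [exists G : 'I_N.+1, (a <= G)%N && (G ^ 2 %| p.-1)%N]].

Lemma sum_inv_sq_tail M : (1 < a)%N -> \sum_(a <= n < M) (n%:R ^- 2 : R) <= 2 / a%:R.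
Proof.
move=> a1.
have aR : 2 <= a%:R :> R by rewrite ler_nat.
have [Ma|aM] := leqP M a; first by rewrite big_geq // divr_ge0.
suff H : \sum_(a <= n < M) (n%:R ^- 2 : R) <= (a%:R - 1)^-1 - (M%:R - 1)^-1.
  apply: le_trans H _; apply: (@le_trans _ _ ((a%:R - 1)^-1)).
    by rewrite gerBl invr_ge0 subr_ge0 ler1n (leq_trans _ aM).
  rewrite -subr_ge0; have -> : 2 / a%:R - (a%:R - 1)^-1 = (a%:R - 2) / (a%:R * (a%:R - 1)) :> R.
    by field; apply/andP; split; apply: lt0r_neq0; lra.
  by rewrite divr_ge0 ?mulr_ge0 //; lra.
elim: M aM => // M IHM; rewrite ltnS leq_eqVlt => /orP[/eqP<-|aM].
  rewrite big_nat1 -natr1 addrK -subr_ge0.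
  have -> : (a%:R - 1)^-1 - a%:R^-1 - a%:R ^- 2 = (a%:R ^+ 2 * (a%:R - 1))^-1 :> R.
    by field; apply/andP; split; apply: lt0r_neq0; lra.
  by rewrite invr_ge0 mulr_ge0 ?exprn_ge0 //; lra.
rewrite big_nat_recr 1?ltnW //=; apply: le_trans (lerD (IHM aM) (lexx _)) _.
have MR : 2 <= M%:R :> R by rewrite ler_nat ltnW // (leq_ltn_trans a1 aM).
rewrite -natr1 addrK; move: (M%:R : R) MR => m m2; rewrite -subr_ge0.
have -> : (a%:R - 1)^-1 - m^-1 - ((a%:R - 1)^-1 - (m - 1)^-1 + m ^- 2) = (m ^+ 2 * (m - 1))^-1.
  by field; rewrite !lt0r_neq0 //; lra.
by rewrite invr_ge0 mulr_ge0 ?exprn_ge0 //; lra.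
Qed.

Lemma gcd_count : (1 < a)%N -> #|square_primes|%:R <= 2 * N%:R / a%:R :> R.
Proof.
move=> a1.
apply: (@le_trans _ _ (\sum_(a <= G < N.+1) (N %/ G ^ 2)%N%:R)).
  rewrite -natr_sum ler_nat.
  apply: (@leq_trans (\sum_(a <= G < N.+1) \sum_(1 <= n < N.+1) (G ^ 2 %| n))%N); last first.
    by apply: leq_sum => G _; rewrite divn_count_dvd.
  rewrite exchange_big /=.
  pose F n := (\sum_(a <= G < N.+1) (G ^ 2 %| n))%N.
  have inj : {in square_primes &, injective (fun p : 'I_N.+1 => inord (p : nat).-1 : 'I_N.+1)}.
    move=> p q; rewrite !inE => /andP[p1 _] /andP[q1 _] /(congr1 val) /=.
    rewrite !inordK; try by apply: leq_ltn_trans (leq_pred _) (ltn_ord _).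
    by move=> e; apply/val_inj; rewrite /= -(ltn_predK p1) -(ltn_predK q1) e.
  rewrite -(card_in_imset inj) -sum1_card big_geq_mkord [leqRHS](bigID (mem (imset (fun p : 'I_N.+1 => inord (p : nat).-1) (mem square_primes)))) /=.
  apply: leq_trans (leq_addr _ _).
  rewrite [leqRHS](eq_bigl (mem (imset (fun p : 'I_N.+1 => inord (p : nat).-1 : 'I_N.+1) (mem square_primes)))); last first.
    move=> n /=; case: imsetP => [[p]|_]; rewrite ?andbF // inE => /andP[p1 _] ->.
    rewrite inordK; last by apply: leq_ltn_trans (leq_pred _) (ltn_ord _).
    by rewrite andbT -ltnS (ltn_predK p1).
  apply: leq_sum => _ /imsetP[p pS ->]; move: pS; rewrite inE => /andP[p1 /existsP[G /andP[aG Gp]]].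
  rewrite inordK; last by apply: leq_ltn_trans (leq_pred _) (ltn_ord _).
  by rewrite (bigD1_seq (G : nat)) ?iota_uniq ?mem_index_iota ?aG ?ltn_ord //= Gp.
apply: (@le_trans _ _ (\sum_(a <= G < N.+1) N%:R * G%:R ^- 2)).
  rewrite !big_nat; apply: ler_sum => G /andP[aG _].
  have G0 : (0 < G)%N by apply: leq_trans aG; apply: ltnW.
  by rewrite ler_pdivlMr ?exprn_gt0 ?ltr0n // -natrX -natrM ler_nat leq_trunc_div.
rewrite -mulr_sumr -[leRHS]mulrA mulrCA ler_wpM2l // mulr_natl.
by have := sum_inv_sq_tail N.+1 a1; rewrite mulr_natl.
Qed.
End GcdCount.

(* FILE B10 *)
Lemma omega_divisors N (n : 'I_N.+1) : (0 < n)%N ->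
  (2 ^ omega n <= \sum_(1 <= d < N.+1) (d %| n))%N.
Proof.
move=> n0; pose P := [set q : 'I_N.+1 | prime q && (q %| n)%N].
have Pp q : q \in P -> prime q by rewrite inE => /andP[].
have -> : (2 ^ omega n = #|powerset P|)%N.
  rewrite card_powerset; congr (2 ^ _)%N.
  have := @prod_primes_ord N n int (fun=> 2) n0; rewrite -/P prodr_const => e.
  have {}e : (2%:R ^+ omega n : int) = 2%:R ^+ #|P|.
    by rewrite -e big_const_seq count_predT iter_mulr_1.
  by move/eqP: e; rewrite -!natrX eqr_nat eqn_exp2l // => /eqP.
have sub (A : {set 'I_N.+1}) : A \in powerset P -> A \subset sieve_primes 1 N.
  by rewrite powersetE => /subsetP AP; apply: all_primes => q /AP/Pp.
have dvA (A : {set 'I_N.+1}) : A \in powerset P -> (pr A %| n)%N.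
  move=> AP; rewrite (@dvdn_pr 1) ?sub //; apply/forall_inP => q qA.
  by move: AP; rewrite powersetE => /subsetP/(_ q qA); rewrite inE => /andP[].
have ltA (A : {set 'I_N.+1}) : A \in powerset P -> (pr A < N.+1)%N.
  by move=> AP; apply: leq_ltn_trans (ltn_ord n); apply: dvdn_leq => //; apply: dvA.
have inj : {in powerset P &, injective (fun A => inord (pr A) : 'I_N.+1)}.
  move=> A B AP BP /(congr1 val); rewrite /= !inordK ?ltA // => e.
  have half (C D : {set 'I_N.+1}) : C \in powerset P -> D \in powerset P -> pr C = pr D -> C \subset D.
    move=> CP DP eCD; apply/subsetP => q qC.
    have qp : prime q by move: CP; rewrite powersetE => /subsetP/(_ q qC)/Pp.
    have : (q %| pr D)%N by rewrite -eCD /pr (big_setD1 q) //= dvdn_mulr.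
    by move=> /(prime_dvd_pr (sub _ DP) qp)[q' q'D /val_inj ->].
  by apply/eqP; rewrite eqEsubset !half.
rewrite -(card_in_imset inj) -sum1_card big_geq_mkord.
rewrite [leqRHS](bigID (mem (imset (fun A => inord (pr A) : 'I_N.+1) (mem (powerset P))))) /=.
apply: leq_trans (leq_addr _ _).
rewrite [leqRHS](eq_bigl (mem (imset (fun A => inord (pr A) : 'I_N.+1) (mem (powerset P))))); last first.
  move=> d /=; case: imsetP => [[A AP ->]|_]; rewrite ?andbF // andbT inordK ?ltA //.
  by rewrite (pr_gt0 (sub _ AP)).
by apply: leq_sum => _ /imsetP[A AP ->]; rewrite inordK ?ltA // dvA.
Qed.

Section OmegaCount.
Variables (R : realType) (N : nat).
Hypothesis N4 : (4 <= N)%N.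

Definition primes_upto := [set p : 'I_N.+1 | prime p].

Lemma divisors_half (n : nat) s : (0 < n)%N -> (n <= N)%N -> (N < s.+1 ^ 2)%N ->
  (\sum_(1 <= d < N.+1) (d %| n) <= 2 * \sum_(1 <= d < s.+1) (d %| n))%N.
Proof.
move=> n0 nN Ns.
have [Ns'|sN] := ltnP N s.
  rewrite [X in (_ <= 2 * X)%N](@big_cat_nat _ _ _ N.+1) //=; last by rewrite ltnS ltnW.
  by rewrite mulnDr mul2n -addnn -!addnA leq_addr.
rewrite (@big_cat_nat _ _ _ s.+1) //= mul2n -addnn leq_add2l.
pose A := [set d : 'I_N.+1 | (s < d)%N && (d %| n)%N].
pose B := [set d : 'I_s.+1 | (0 < d)%N && (d %| n)%N].
have -> : (\sum_(s.+1 <= d < N.+1) (d %| n) = #|A|)%N.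
  rewrite big_geq_mkord -sum1_card big_mkcond [RHS]big_mkcond; apply: eq_bigr => d _.
  by rewrite inE; case: (_ < _)%N; case: (_ %| _)%N.
have -> : (\sum_(1 <= d < s.+1) (d %| n) = #|B|)%N.
  rewrite big_geq_mkord -sum1_card big_mkcond [RHS]big_mkcond; apply: eq_bigr => d _.
  by rewrite inE; case: (_ < _)%N; case: (_ %| _)%N.
have small (d : 'I_N.+1) : d \in A -> (n %/ d < s.+1)%N.
  rewrite inE => /andP[sd dn]; have d0 : (0 < d)%N by apply: leq_ltn_trans sd.
  rewrite ltn_divLR //; apply: leq_ltn_trans nN (leq_trans Ns _).
  by rewrite -mulnn leq_mul2l sd orbT.
have inj : {in A &, injective (fun d : 'I_N.+1 => inord (n %/ d) : 'I_s.+1)}.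
  move=> d e dA eA /(congr1 val); rewrite /= !inordK ?small // => h; apply/val_inj => /=.
  move: dA eA; rewrite !inE => /andP[_ dn] /andP[_ en].
  have h1 := divnK dn; have h2 := divnK en; rewrite h in h1.
  have q0 : (0 < n %/ e)%N by rewrite divn_gt0 ?(dvdn_gt0 n0 en) // dvdn_leq.
  by apply/eqP; rewrite -(eqn_pmul2l q0) h1 h2.
rewrite -(card_in_imset inj); apply/subset_leq_card/subsetP => _ /imsetP[d dA ->].
rewrite inE inordK ?small //; move: dA; rewrite inE => /andP[sd dn].
have d0 : (0 < d)%N by apply: leq_ltn_trans sd.
by rewrite divn_gt0 // dvdn_leq //=; apply/dvdnP; exists d; rewrite mulnC divnK.
Qed.

Lemma inv_totient_sum s : (1 < s)%N ->
  \sum_(1 <= d < s.+1) ((totient d)%:R^-1 : R) <= expR (euler_const R) * ln s%:R.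
Proof.
move=> s1; have := @euler_sum R 1 s _ s1; rewrite ler01 lexx => /(_ isT).
have l0 : 0 < ln s%:R :> R by rewrite ln_gt0 // ltr1n.
rewrite mul1r expRD lnK ?posrE // mulrC; apply: le_trans.
by apply: ler_sum => d _; rewrite /hfun expr1n mul1r.
Qed.

Lemma omega_sum :
  \sum_(p in primes_upto) (2 ^ omega p.-1)%N%:R <= 210 * expR (euler_const R) * N%:R :> R.
Proof.
have N0 : (0 < N)%N by apply: leq_trans N4.
have [s s0 /andP[sN Ns]] := @root_nat 2 N isT N0.
have s1 : (1 < s)%N.
  rewrite ltnNge; apply/negP => s1; have := leq_ltn_trans N4 Ns.
  by have : (s.+1 ^ 2 <= 2 ^ 2)%N by [rewrite leq_exp2r]; lia.
have lam0 : 0 < ln N%:R :> R by rewrite ln_gt0 // ltr1n ltnW // (leq_trans _ N4).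
have sN' : (s <= N)%N by apply: leq_trans sN; rewrite -mulnn leq_pmulr.
apply: (@le_trans _ _ (\sum_(p in primes_upto) 2 * \sum_(1 <= d < s.+1) (d %| p.-1)%N%:R)).
  apply: ler_sum => p; rewrite inE => pp; rewrite -natr_sum -natrM ler_nat.
  have p0 : (0 < (p : nat).-1)%N by rewrite -ltnS prednK ?prime_gt1 ?prime_gt0.
  have pN : ((p : nat).-1 < N.+1)%N by apply: leq_ltn_trans (leq_pred _) (ltn_ord _).
  apply: leq_trans (divisors_half p0 pN Ns).
  exact: (@omega_divisors N (Ordinal pN)).
rewrite -mulr_sumr exchange_big /=.
apply: (@le_trans _ _ (2 * \sum_(1 <= d < s.+1) (105 * N%:R / ln N%:R * (totient d)%:R^-1))).
  rewrite ler_wpM2l // !big_nat; apply: ler_sum => d /andP[d0 ds].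
  have d3 : (d ^ 3 <= N ^ 2)%N.
    apply: (@leq_trans (s ^ 3)); first by rewrite leq_exp2r.
    apply: (@leq_trans (s ^ 4)); first by rewrite leq_pexp2l.
    by rewrite -[4%N]/(2 * 2)%N expnM leq_exp2r.
  have := @brun_titchmarsh R N d (ltn_trans (ltnSn 1) (leq_trans (ltnSn 2) (ltnW N4))) d0 d3.
  rewrite [(totient d)%:R * _]mulrC invfM mulrA; apply: le_trans.
  rewrite -natr_sum ler_nat -sum1_card big_mkcond [leqRHS]big_mkcond; apply: leq_sum => p _.
  by rewrite !inE; case: (prime p) => //=; case: (d %| _)%N.
rewrite -mulr_sumr.
have h := inv_totient_sum s1.
have lnsN : ln s%:R <= ln N%:R :> R by rewrite ler_ln ?posrE ?ltr0n // ler_nat.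
have {}h : \sum_(1 <= d < s.+1) (totient d)%:R^-1 <= expR (euler_const R) * ln N%:R.
  by apply: le_trans h _; rewrite ler_wpM2l ?expR_ge0.
apply: (@le_trans _ _ (2 * (105 * N%:R / ln N%:R * (expR (euler_const R) * ln N%:R)))).
  by rewrite ler_wpM2l // ler_wpM2l // divr_ge0 ?mulr_ge0 // ltW.
rewrite le_eqVlt; apply/orP; left; apply/eqP; field; exact: lt0r_neq0.
Qed.

Lemma omega_count (V : R) : 0 < V ->
  #|[set p in primes_upto | V <= (2 ^ omega p.-1)%N%:R]|%:R <= 210 * expR (euler_const R) * N%:R / V.
Proof.
move=> V0; rewrite ler_pdivlMr //; apply: le_trans omega_sum.
rewrite mulr_natl -sumr_const.
apply: (@le_trans _ _ (\sum_(p in [set p in primes_upto | V <= (2 ^ omega p.-1)%N%:R]) (2 ^ omega p.-1)%N%:R)).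
  by apply: ler_sum => p; rewrite inE => /andP[].
rewrite [leRHS](bigID (fun p : 'I_N.+1 => V <= (2 ^ omega p.-1)%N%:R)) /= ler_wpDr ?sumr_ge0 //.
by rewrite le_eqVlt; apply/orP; left; apply/eqP; apply: eq_bigl => p; rewrite !inE.
Qed.

End OmegaCount.

Section WindowCount.
Variables (R : realType) (N y J : nat) (zeta B : R).
Hypotheses (N1 : (1 < N)%N) (y1 : (1 < y)%N) (z01 : 0 < zeta <= 1) (B0 : 0 <= B).
Hypothesis yJ : ((y * 2 ^ J) ^ 3 <= N ^ 2)%N.

Definition window_primes := [set p : 'I_N.+1 | prime p &&
  [exists d : 'I_N.+1, [&& (y < d <= y * 2 ^ J)%N, (d %| p.-1)%N & 1 <= B * zeta ^+ omega d]]].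

Lemma sum_dyadic (f : nat -> R) K : \sum_(y.+1 <= d < (y * 2 ^ K).+1) f d =
  \sum_(j < K) \sum_((y * 2 ^ j).+1 <= d < (y * 2 ^ j).*2.+1) f d.
Proof.
elim: K => [|K IHK]; first by rewrite expn0 muln1 big_geq // big_ord0.
rewrite big_ord_recr -IHK /= (@big_cat_nat _ _ _ (y * 2 ^ K).+1) /=.
- by rewrite expnS mulnCA mul2n.
- by rewrite ltnS leq_pmulr // expn_gt0.
- by rewrite ltnS leq_mul2l leq_pexp2l ?orbT.
Qed.

Lemma hfun_window :
  \sum_(y.+1 <= d < (y * 2 ^ J).+1) hfun zeta d <=
  J%:R * (16 / ln y%:R * expR (zeta * ln (ln N%:R) + euler_const R)).
Proof.
have /andP[z0 z1] := z01.
rewrite sum_dyadic mulr_natl -[J in leRHS]card_ord -sumr_const; apply: ler_sum => j _.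
have yj1 : (1 < y * 2 ^ j)%N by apply: leq_trans y1 _; rewrite leq_pmulr // expn_gt0.
apply: le_trans (block_sum _ yj1) _; first by rewrite (ltW z0).
have ly0 : 0 < ln y%:R :> R by rewrite ln_gt0 // ltr1n.
have lyj : ln y%:R <= ln (y * 2 ^ j)%N%:R :> R.
  by rewrite ler_ln ?posrE ?ltr0n ?ler_nat ?leq_pmulr ?expn_gt0 // ltnW // ltnW.
have y0 : (0 < y)%N by apply: ltnW.
apply: ler_pM; rewrite ?expR_ge0 ?divr_ge0 //; first by apply: le_trans lyj; apply: ltW.
  by rewrite ler_wpM2l // lef_pV2 ?posrE //; apply: lt_le_trans lyj.
rewrite ler_expR lerD2r ler_wpM2l ?(ltW z0) //.
have tN : ((y * 2 ^ j).*2 <= N)%N.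
  have le : ((y * 2 ^ j).*2 <= y * 2 ^ J)%N.
    by rewrite -mul2n mulnCA -expnS leq_mul2l leq_pexp2l ?orbT.
  apply: leq_trans le _; rewrite -(@leq_exp2r _ _ 3) //; apply: leq_trans yJ _.
  by rewrite leq_pexp2l // ltnW.
have t1 : (1 < (y * 2 ^ j).*2)%N by apply: leq_trans yj1 _; rewrite -addnn leq_addr.
rewrite ler_ln ?posrE ?ln_gt0 ?ltr1n // ler_ln ?posrE ?ltr0n ?ler_nat //; exact: ltnW.
Qed.

Lemma window_count :
  #|window_primes|%:R <= 105 * N%:R / ln N%:R * (B *
   (J%:R * (16 / ln y%:R * expR (zeta * ln (ln N%:R) + euler_const R)))).
Proof.
have lam0 : 0 < ln N%:R :> R by rewrite ln_gt0 // ltr1n.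
have /andP[z0 z1] := z01.
apply: (@le_trans _ _ (105 * N%:R / ln N%:R * (B * \sum_(y.+1 <= d < (y * 2 ^ J).+1) hfun zeta d))); last first.
  by rewrite ler_wpM2l ?divr_ge0 ?mulr_ge0 ?(ltW lam0) // ler_wpM2l // hfun_window.
rewrite !mulr_sumr.
pose good d := 1 <= B * zeta ^+ omega d.
apply: (@le_trans _ _ (\sum_(y.+1 <= d < (y * 2 ^ J).+1 | good d) #|primes_one_mod N d|%:R)); last first.
  rewrite big_mkcond !big_nat; apply: ler_sum => d /andP[yd dJ].
  have d0 : (0 < d)%N by apply: leq_ltn_trans yd.
  have hf0 : 0 <= 105 * N%:R / ln N%:R * (B * hfun zeta d).
    apply: mulr_ge0; first by rewrite divr_ge0 ?mulr_ge0 ?(ltW lam0).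
    by apply: mulr_ge0 => //; apply: hfun_ge0; exact: ltW.
  case: ifP => // gd.
  have d3 : (d ^ 3 <= N ^ 2)%N by apply: leq_trans yJ; rewrite leq_exp2r.
  apply: le_trans (@brun_titchmarsh R N d N1 d0 d3) _.
  have phi0 : 0 < (totient d)%:R :> R by rewrite ltr0n totient_gt0.
  have -> : 105 * N%:R / ((totient d)%:R * ln N%:R) = 105 * N%:R / ln N%:R * (1 / (totient d)%:R) :> R.
    by field; rewrite !lt0r_neq0.
  rewrite ler_wpM2l ?divr_ge0 ?mulr_ge0 ?(ltW lam0) // /hfun mulrA ler_wpM2r ?invr_ge0 //.
rewrite -natr_sum ler_nat.
apply: (@leq_trans (\sum_(p in window_primes) \sum_(y.+1 <= d < (y * 2 ^ J).+1 | good d) (d %| (p : nat).-1))%N).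
  rewrite -sum1_card; apply: leq_sum => p; rewrite inE => /andP[_ /existsP[d /and3P[/andP[yd dJ] dp gd]]].
  rewrite big_mkcond (bigD1_seq (d : nat)) ?iota_uniq ?mem_index_iota ?yd //= /good gd dp //.
rewrite exchange_big /= ; apply: leq_sum => d _.
rewrite -sum1_card big_mkcond [leqRHS]big_mkcond; apply: leq_sum => p _.
by rewrite !inE; case: (prime p) => //=; case: (d %| _)%N; rewrite ?if_same //; case: ifP.
Qed.

End WindowCount.

(* FILE B11 *)
Lemma omega_split d e : (0 < d)%N -> (0 < e)%N ->
  (omega d + omega e <= omega (d * e) + omega (gcdn d e))%N.
Proof.
move=> d0 e0; rewrite /omega -(count_predC (mem (primes d)) (primes e)).
rewrite [X in (_ + X)%N]addnC addnA; apply: leq_add.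
  rewrite -size_filter -size_cat; apply: uniq_leq_size.
    rewrite cat_uniq primes_uniq filter_uniq ?primes_uniq // andbT.
    by apply/hasPn => q; rewrite mem_filter => /andP[].
  move=> q; rewrite mem_cat mem_filter primesM //.
  by move=> /orP[->//|/andP[_ ->]]; rewrite orbT.
rewrite -size_filter; apply: uniq_leq_size; first by rewrite filter_uniq ?primes_uniq.
move=> q; rewrite mem_filter /= !mem_primes gcdn_gt0 d0 /= dvdn_gcd.
by move=> /andP[/andP[-> ->] /and3P[_ _ ->]].
Qed.

Lemma omega_pow k n : (0 < n)%N -> ((2 ^ k) ^ omega n <= (2 ^ k) ^ (2 ^ k) * n)%N.
Proof.
move=> n0; pose W := (2 ^ k)%N.
rewrite -/W /omega -(count_predC (fun q => q < W)%N (primes n)) expnD; apply: leq_mul.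
  rewrite leq_pexp2l ?expn_gt0 // -size_filter -[leqRHS](size_iota 0).
  apply: uniq_leq_size; first by rewrite filter_uniq ?primes_uniq.
  by move=> q; rewrite mem_filter mem_iota add0n => /andP[].
rewrite {2}[n]prod_prime_decomp // prime_decompE big_map /= -size_filter.
apply: (@leq_trans (\prod_(q <- [seq q <- primes n | ~~ (q < W)%N]) q)%N).
  have H (s : seq nat) : all (fun q => W <= q)%N s -> (W ^ size s <= \prod_(q <- s) q)%N.
    elim: s => [|q s IHs] /=; first by rewrite big_nil.
    by move=> /andP[Wq /IHs h]; rewrite big_cons expnS leq_mul.
  by apply: H; apply/allP => q; rewrite mem_filter /= -leqNgt => /andP[].
rewrite big_filter [leqRHS](bigID (fun q => q < W)%N) /= mulnC.
rewrite -[leqLHS]muln1; apply: leq_mul.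
  rewrite big_seq_cond [leqRHS]big_seq_cond; apply: leq_prod => q /andP[qn _].
  have qp : prime q by move: qn; rewrite mem_primes => /andP[].
  by rewrite -{1}[q]expn1 leq_pexp2l ?(prime_gt0 qp) // logn_gt0.
rewrite big_seq_cond prodn_cond_gt0 // => q /andP[qn _].
Qed.

Section Classification.
Variable R : realType.

Lemma omega_ln k n : (0 < k)%N -> (0 < n)%N ->
  (omega n)%:R * ln 2%:R <= (2 ^ k)%N%:R * ln 2%:R + ln n%:R / k%:R :> R.
Proof.
move=> k0 n0; have := omega_pow k n0.
have [W WE] : exists W, (2 ^ k)%N = W by exists (2 ^ k)%N.
rewrite !WE; move: (omega n) => w.
have W0 : (0 < W)%N by rewrite -WE expn_gt0.
rewrite -(ler_nat R) => h.
have : ln (W ^ w)%N%:R <= ln (W ^ W * n)%N%:R :> R.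
  by rewrite ler_ln ?posrE ?ltr0n ?muln_gt0 ?expn_gt0 ?W0.
rewrite (natrM _ (W ^ W) n) !natrX lnM ?posrE ?exprn_gt0 ?ltr0n // !lnXn ?ltr0n // -!(mulr_natl (ln _)).
have -> : ln W%:R = k%:R * ln 2%:R :> R by rewrite -WE natrX lnXn ?ltr0n // mulr_natl.
move=> {}h; have kR : 0 < k%:R :> R by rewrite ltr0n.
rewrite -(ler_pM2l kR) mulrDr [k%:R * (_ / _)]mulrC divfK ?gt_eqF //.
by rewrite ![k%:R * (_ * ln 2%:R)]mulrCA.
Qed.

Lemma omega_ln10 : exists c0 : R, forall n, (0 < n)%N -> (omega n)%:R * ln 2%:R <= c0 + ln n%:R / 10.
Proof. by exists ((2 ^ 10)%N%:R * ln 2%:R) => n n0; exact: (@omega_ln 10 n isT n0). Qed.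

Lemma ln2_ge_half : 2^-1 <= ln 2%:R :> R.
Proof.
have := @le_ln1Dx R (- 2^-1); rewrite (_ : 1 + - 2^-1 = 2%:R^-1); last by lra.
rewrite lnV ?posrE ?ltr0n // => h; have : - ln 2%:R <= - 2^-1 :> R by apply: h; lra.
lra.
Qed.

Lemma four_thirds_pow w : ((3 / 4) ^+ w : R) * expR (5 / 12 * (w%:R * ln 2%:R)) >= 1.
Proof.
have e2 : expR (5 / 12 * (w%:R * ln 2%:R)) = expR (5 / 12 * ln 2%:R) ^+ w :> R.
  by rewrite -expRM_natl; congr expR; ring.
rewrite e2 -exprMn exprn_ege1 //.
have e12 : expR (5 / 12 * ln 2%:R) ^+ 12 = 32 :> R.
  rewrite -expRM_natl (_ : 12%:R * (5 / 12 * ln 2%:R) = ln (2%:R ^+ 5)); last first.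
    by rewrite lnXn ?ltr0n // -mulr_natl; field.
  by rewrite lnK ?posrE ?exprn_gt0 // -natrX.
have pos : 0 <= 3 / 4 * expR (5 / 12 * ln 2%:R) :> R by rewrite mulr_ge0 ?expR_ge0 ?divr_ge0.
rewrite -(@ler_pXn2r _ 12) ?nnegrE //.
by rewrite expr1n exprMn e12; lra.
Qed.

End Classification.

(* FILE B12 *)
Lemma half_bound (R : realType) (Q z : R) : 96 * 2 <= Q -> Q < z + 1 -> Q / 2 <= z /\ 2 < z.
Proof. by move=> *; split; lra. Qed.

Lemma omega_arith (R : realType) (l2 ell c on og lg S : R) : S * l2 <= (on + og) * l2 ->
  on * l2 <= 21 / 20 * ell -> og * l2 <= c + lg / 10 -> lg <= 21 / 20 * ell ->
  S * l2 <= 231 / 200 * ell + c.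
Proof. by move: (S * l2) => s; rewrite mulrDl; move: (on * l2) (og * l2) => u v; lra. Qed.

Lemma twice_min (R : realType) (l2 u v S : R) : (u + v) * l2 <= S -> u * l2 <= v * l2 -> 2 * (u * l2) <= S.
Proof. by rewrite mulrDl; move: (u * l2) (v * l2) => {}u {}v; lra. Qed.

Lemma scale_arith (R : realType) (u S : R) : 2 * u <= S -> 5 / 12 * u <= 5 / 24 * S.
Proof. lra. Qed.

Section Range.
Variable R : realType.
Variables (N : nat) (dl : R).
Hypothesis N1 : (1 < N)%N.
Let lam : R := ln N%:R.
Let ell : R := ln lam.
Hypotheses (ell1 : 1 <= ell) (big : 33 * ell + 15 <= lam / 2) (dlam : 1 <= dl * lam).
Let E : R := expR (lam / 2).
Let M0 := Num.truncn (N%:R / lam ^+ 2).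
Let V : R := expR (21 / 20 * ell).
Let a := (Num.truncn V).+1.
Let y := Num.truncn (E / (2 * lam ^+ 5)).
Let J := (Num.truncn (16 * ell)).+4.+1.

Lemma N_gt0R : 0 < N%:R :> R. Proof. by rewrite ltr0n ltnW. Qed.

Lemma NE : N%:R = E ^+ 2.
Proof. by rewrite /E -expRM_natl (_ : 2%:R * (lam / 2) = lam) ?lnK ?posrE ?N_gt0R //; field. Qed.

Lemma lam_gt0 : 0 < lam.
Proof. move: ell1 big; lra. Qed.

Lemma lamE : lam = expR ell. Proof. by rewrite lnK ?posrE ?lam_gt0. Qed.

Lemma lam_ge96 : 96 <= lam. Proof. move: ell1 big; lra. Qed.

Lemma E_gt0 : 0 < E. Proof. exact: expR_gt0. Qed.

(* polynomial factors of lam are dominated by E *)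
Lemma E_dominates (k : nat) (c : R) : k%:R * ell + c <= lam / 2 -> lam ^+ k * expR c <= E.
Proof. by move=> h; rewrite lamE -expRM_natl -expRD ler_expR. Qed.

Lemma four_le : 4 <= expR 15 :> R.
Proof. by have := @expR_ge1Dx R 15; lra. Qed.

Lemma dominates k : (k <= 33)%N -> 4 * lam ^+ k <= E.
Proof.
move=> k33; apply: (@le_trans _ _ (lam ^+ k * expR 15)).
  by rewrite mulrC ler_wpM2l ?exprn_ge0 ?four_le // ltW // lam_gt0.
apply: E_dominates; apply: le_trans big; rewrite lerD2r ler_wpM2r //; first by move: ell1; lra.
by rewrite ler_nat.
Qed.

Lemma lam_ge1 : 1 <= lam. Proof. by have := lam_ge96; lra. Qed.

Lemma M0_bounds : E <= M0%:R /\ N%:R / (2 * lam ^+ 2) <= M0%:R.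
Proof.
have l0 := lam_gt0; have E0 := E_gt0.
have l2 : 0 < lam ^+ 2 by rewrite exprn_gt0.
have h := dominates (isT : (2 <= 33)%N).
have q : 2 * E <= N%:R / lam ^+ 2.
  rewrite ler_pdivlMr // NE expr2 mulrAC ler_pM2r //; lra.
have E4 : 4 <= E by have := dominates (isT : (0 <= 33)%N); rewrite expr0 mulr1.
have /andP[_ tr] : M0%:R <= N%:R / lam ^+ 2 < M0.+1%:R.
  by rewrite truncn_itv // divr_ge0 // ltW.
rewrite -natr1 in tr.
have -> : N%:R / (2 * lam ^+ 2) = N%:R / lam ^+ 2 / 2 by field; rewrite gt_eqF.
by split; lra.
Qed.

Lemma y_bounds : [/\ (1 < y)%N, y%:R <= E / (2 * lam ^+ 5), E / (4 * lam ^+ 5) <= y%:R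
  & lam / 4 <= ln y%:R].
Proof.
have l0 := lam_gt0; have E0 := E_gt0.
have l5 : 0 < lam ^+ 5 by rewrite exprn_gt0.
have h := dominates (isT : (6 <= 33)%N).
have q : 96 * 2 <= E / (2 * lam ^+ 5).
  rewrite ler_pdivlMr ?mulr_gt0 //; apply: le_trans h; rewrite [lam ^+ 6]exprS.
  have : 96 * lam ^+ 5 <= lam * lam ^+ 5 by rewrite ler_wpM2r ?lam_ge96 // ltW.
  lra.
have /andP[t1 t2] : y%:R <= E / (2 * lam ^+ 5) < y.+1%:R by rewrite truncn_itv // divr_ge0 ?mulr_ge0 // ltW.
rewrite -[y.+1%:R]natr1 in t2.
have e4 : E / (4 * lam ^+ 5) = E / (2 * lam ^+ 5) / 2 by field; rewrite gt_eqF.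
have [low y2] : E / (4 * lam ^+ 5) <= y%:R /\ 2 < y%:R :> R.
  by rewrite e4; exact: half_bound q t2.
split => //; first by rewrite -(ltr_nat R); lra.
apply: (@le_trans _ _ (ln (expR (lam / 4)))); first by rewrite expRK.
rewrite ler_ln ?posrE ?expR_gt0 //; last by lra.
apply: le_trans low; rewrite ler_pdivlMr ?mulr_gt0 // mulrC.
have e8 : 4 <= expR 3 :> R by have := @expR_ge1Dx R 3; lra.
apply: (@le_trans _ _ (expR 3 * lam ^+ 5 * expR (lam / 4))).
  by rewrite ler_wpM2r ?expR_ge0 // lamE ler_wpM2r ?exprn_ge0 ?expR_ge0.
rewrite {1}lamE -expRM_natl -!expRD ler_expR; move: big ell1; lra.
Qed.

Lemma J_bounds : [/\ 4 * lam ^+ 8 <= 2 ^+ J, 2 ^+ J <= lam ^+ 16 * expR 5 & J%:R <= 16 * ell + 5].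
Proof.
have /andP[t1 t2] : (Num.truncn (16 * ell))%:R <= 16 * ell < (Num.truncn (16 * ell)).+1%:R.
  by rewrite truncn_itv //; move: ell1; lra.
have JE : J%:R = (Num.truncn (16 * ell))%:R + 5 :> R by rewrite /J -natrD addnS addn4.
rewrite -[(Num.truncn (16 * ell)).+1%:R]natr1 in t2.
clearbody J; move: (Num.truncn _) JE t1 t2 => k JE t1 t2.
have p2 : (2 : R) ^+ J = expR (J%:R * ln 2%:R) by rewrite expRM_natl lnK // posrE.
have h2 := ln2_ge_half R; have l21 := ln2_le1 R.
have J0 : 0 <= J%:R :> R by [].
have up : J%:R * ln 2%:R <= J%:R :> R by rewrite ler_piMr.
have lo : J%:R * 2^-1 <= J%:R * ln 2%:R :> R by rewrite ler_wpM2l.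
have f : 4 = expR (2 * ln 2%:R) :> R by rewrite expRM_natl lnK ?posrE // -natrX.
rewrite f !p2 lamE -!expRM_natl -!expRD !ler_expR.
clear f p2.
split; lra.
Qed.

Lemma yJ_bounds : E * lam ^+ 3 <= (y * 2 ^ J)%N%:R /\ ((y * 2 ^ J) ^ 3 <= N ^ 2)%N.
Proof.
have l0 := lam_gt0; have E0 := E_gt0.
have [_ yu yl _] := y_bounds; have [Jl Ju _] := J_bounds.
clearbody y J.
rewrite natrM natrX; split.
  apply: (@le_trans _ _ (E / (4 * lam ^+ 5) * (4 * lam ^+ 8))).
    by rewrite le_eqVlt; apply/orP; left; apply/eqP; field; rewrite gt_eqF.
  by apply: ler_pM => //; rewrite ?divr_ge0 ?mulr_ge0 ?exprn_ge0 // ltW.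
rewrite -(ler_nat R) !natrX natrM natrX NE.
have u : y%:R * 2 ^+ J <= E * (lam ^+ 11 * expR 5).
  apply: (@le_trans _ _ (E / (2 * lam ^+ 5) * (lam ^+ 16 * expR 5))); first by apply: ler_pM; rewrite ?exprn_ge0 ?ler0n.
  have -> : E / (2 * lam ^+ 5) * (lam ^+ 16 * expR 5) = E * (lam ^+ 11 * expR 5) / 2 by field; rewrite gt_eqF.
  rewrite ler_pdivrMr // ler_peMr ?ler1n //.
  by rewrite !mulr_ge0 ?exprn_ge0 ?expR_ge0 // ltW.
apply: (@le_trans _ _ ((E * (lam ^+ 11 * expR 5)) ^+ 3)).
  by rewrite lerXn2r ?nnegrE ?mulr_ge0 ?exprn_ge0 ?expR_ge0 // ltW.
rewrite exprMn (_ : (E ^+ 2) ^+ 2 = E ^+ 3 * E); last by ring.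
rewrite ler_wpM2l ?exprn_ge0 ?(ltW E0) // exprMn -exprM -expRM_natl.
rewrite (_ : 3%:R * 5 = 15 :> R); last by ring.
by apply: E_dominates; exact: big.
Qed.

Variable c0 : R.
Hypothesis omega10 : forall n, (0 < n)%N -> (omega n)%:R * ln 2%:R <= c0 + ln n%:R / 10.
Definition window_bound : R := expR (5 / 24 * (231 / 200 * ell + c0)).

Lemma order_classification (p : 'I_N.+1) (t : nat) : prime p -> (M0 < p)%N -> (t %| p.-1)%N -> (0 < t)%N ->
  dl * N%:R < (t ^ 2)%N%:R -> (t ^ 2)%N%:R < N%:R * lam ^+ 6 ->
  p \notin square_primes N a -> (2 ^ omega p.-1)%N%:R < V ->
  p \in window_primes N y J (3 / 4) window_bound.
Proof.
move=> pp Mp tp t0 tlow tup nsq om.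
have l0 := lam_gt0; have E0 := E_gt0; have l1 := lam_ge1.
have [_ M0low] := M0_bounds; have [y1 yu _ _] := y_bounds; have [yJl _] := yJ_bounds.
clearbody y J M0.
set n := (p : nat).-1 in tp om *.
have pE : n.+1 = p by rewrite prednK // prime_gt0.
have n0 : (0 < n)%N by rewrite -ltnS pE prime_gt1.
pose e := (n %/ t)%N.
have nte : (n = t * e)%N by rewrite mulnC divnK.
have e0 : (0 < e)%N by move: n0; rewrite nte muln_gt0 => /andP[].
have tR : 0 < t%:R :> R by rewrite ltr0n.
have eR : 0 < e%:R :> R by rewrite ltr0n.
have nR : n%:R = t%:R * e%:R :> R by rewrite nte natrM.
have nlow : E ^+ 2 / (2 * lam ^+ 2) <= n%:R.
  rewrite -NE; apply: le_trans M0low _; by rewrite ler_nat -ltnS pE.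
have nup : n%:R <= E ^+ 2.
  by rewrite -NE ler_nat -ltnS pE ltnW // ltnS -?pE.
rewrite natrX in tlow tup.
have t_up : t%:R < E * lam ^+ 3.
  rewrite -(@ltr_pXn2r _ 2) ?nnegrE ?mulr_ge0 ?exprn_ge0 ?(ltW l0) ?(ltW E0) //.
  by rewrite exprMn -exprM -NE.
have t_low : E ^+ 2 / lam < t%:R ^+ 2.
  apply: le_lt_trans tlow; rewrite NE ler_pdivrMr // mulrAC ler_peMl //.
  by rewrite exprn_ge0 // ltW.
have t_low2 : E / (2 * lam ^+ 5) < t%:R.
  rewrite -(@ltr_pXn2r _ 2) ?nnegrE ?divr_ge0 ?mulr_ge0 ?exprn_ge0 ?(ltW l0) ?(ltW E0) //.
  apply: le_lt_trans t_low; rewrite expr_div_n ler_wpM2l ?exprn_ge0 ?(ltW E0) //.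
  rewrite lef_pV2 ?posrE ?exprn_gt0 ?mulr_gt0 ?exprn_gt0 // exprMn -exprM.
  apply: (@le_trans _ _ (lam ^+ 10)); first by rewrite -{1}[lam]expr1 ler_weXn2l.
  by rewrite ler_peMl ?exprn_ge0 ?(ltW l0) // -natrX ler1n.
have e_low : E / (2 * lam ^+ 5) < e%:R.
  rewrite -(ltr_pM2l tR) -nR; apply: lt_le_trans nlow.
  have -> : E ^+ 2 / (2 * lam ^+ 2) = (E * lam ^+ 3) * (E / (2 * lam ^+ 5)).
    by field; rewrite gt_eqF.
  by rewrite ltr_pM2r // divr_gt0 // mulr_gt0 // exprn_gt0.
have e_up : e%:R < E * lam ^+ 3.
  rewrite -(@ltr_pXn2r _ 2) ?nnegrE ?mulr_ge0 ?exprn_ge0 ?(ltW l0) ?(ltW E0) //.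
  rewrite -(@ltr_pM2l _ (t%:R ^+ 2)) ?exprn_gt0 // -exprMn -nR.
  apply: (@le_lt_trans _ _ ((E ^+ 2) ^+ 2)); first by rewrite lerXn2r ?nnegrE ?exprn_ge0 ?(ltW E0).
  apply: (@lt_le_trans _ _ (t%:R ^+ 2 * (E ^+ 2 * lam))).
    have -> : (E ^+ 2) ^+ 2 = (E ^+ 2 / lam) * (E ^+ 2 * lam) by field; rewrite gt_eqF.
    by rewrite ltr_pM2r // mulr_gt0 ?exprn_gt0.
  rewrite ler_wpM2l ?exprn_ge0 ?(ltW tR) // exprMn ler_wpM2l ?exprn_ge0 ?(ltW E0) //.
  by rewrite -exprM -{1}[lam]expr1 ler_weXn2l.
have inW d : E / (2 * lam ^+ 5) < d%:R -> d%:R < E * lam ^+ 3 -> (y < d <= y * 2 ^ J)%N.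
  move=> lo hi; rewrite -(ltr_nat R) -(ler_nat R); apply/andP; split; first exact: le_lt_trans yu lo.
  by apply: le_trans yJl; apply: ltW.
have g0 : (0 < gcdn t e)%N by rewrite gcdn_gt0 t0.
have gV : ln (gcdn t e)%:R <= 21 / 20 * ell.
  rewrite -[leRHS]expRK -/V ler_ln ?posrE ?ltr0n ?expR_gt0 //.
  have : (gcdn t e < a)%N.
    rewrite ltnNge; apply: contra nsq => ag; rewrite inE prime_gt1 //=.
    have gN : (gcdn t e < N.+1)%N.
      apply: leq_ltn_trans (dvdn_leq t0 (dvdn_gcdl _ _)) _.
      by apply: leq_ltn_trans (dvdn_leq n0 tp) _; apply: leq_ltn_trans (leq_pred _) (ltn_ord p).
    apply/existsP; exists (Ordinal gN); rewrite /= ag -/n nte -mulnn.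
    by apply: dvdn_mul; rewrite ?dvdn_gcdl ?dvdn_gcdr.
  rewrite ltnS -(ler_nat R) => /le_trans; apply.
  by have /andP[] : (Num.truncn V)%:R <= V < (Num.truncn V).+1%:R by rewrite truncn_itv // expR_ge0.
have omV : (omega n)%:R * ln 2%:R <= 21 / 20 * ell.
  rewrite -[leRHS]expRK -/V mulr_natl -lnXn ?ltr0n // ler_ln ?posrE ?exprn_gt0 ?expR_gt0 //.
  by rewrite -natrX ltW.
have split_om : ((omega t)%:R + (omega e)%:R) * ln 2%:R <= 231 / 200 * ell + c0.
  have := omega_split t0 e0; rewrite -nte -(ler_nat R) !natrD => h.
  have l20 : 0 <= ln 2%:R :> R by apply: ln_nat_ge0.
  exact: omega_arith (ler_wpM2r l20 h) omV (omega10 g0) gV.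
have good d : 2 * ((omega d)%:R * ln 2%:R) <= 231 / 200 * ell + c0 -> 1 <= window_bound * (3 / 4) ^+ omega d.
  move=> h; apply: le_trans (four_thirds_pow R (omega d)) _.
  rewrite mulrC ler_wpM2r ?exprn_ge0 ?divr_ge0 // /window_bound ler_expR; exact: scale_arith.
rewrite inE pp /=; apply/existsP.
have tN : (t < N.+1)%N.
  by apply: leq_ltn_trans (dvdn_leq n0 tp) _; apply: leq_ltn_trans (leq_pred _) (ltn_ord p).
have en : (e %| n)%N by rewrite nte dvdn_mull.
have eN : (e < N.+1)%N.
  by apply: leq_ltn_trans (dvdn_leq n0 en) _; apply: leq_ltn_trans (leq_pred _) (ltn_ord p).
have [te|et] := leP ((omega t)%:R * ln 2%:R : R) ((omega e)%:R * ln 2%:R).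
  exists (Ordinal tN); rewrite /= inW //= -/n tp /=; apply: good; exact: twice_min split_om te.
exists (Ordinal eN); rewrite /= inW //= -/n en /=; apply: good; rewrite [X in X * _]addrC in split_om; exact: twice_min split_om (ltW et).
Qed.

End Range.

(* FILE B13 *)
Definition low_order_primes (R : realType) (g : int) (N : nat) := [set p : 'I_N.+1 | prime p &&
  [exists t : 'I_N.+1, [&& (0 < t)%N, (t %| p.-1)%N, (p %| `|g ^+ t - 1|)%N &
    (t ^ 2)%N%:R < N%:R * ln N%:R ^+ 6 :> R]]].

Lemma card_ord_lt n m : (#|[set p : 'I_n | (p < m)%N]| <= m)%N.
Proof.
rewrite cardE -(size_map val) -[leqRHS](size_iota 0); apply: uniq_leq_size.
  by rewrite (map_inj_uniq val_inj) enum_uniq.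
by move=> k /mapP[p hp ->]; move: hp; rewrite mem_enum inE mem_iota.
Qed.

Section Count.
Variables (R : realType) (g : int) (hg : 2 <= `|g|).
Variables (N : nat) (dl c0 : R).
Hypothesis N1 : (1 < N)%N.
Let lam : R := ln N%:R.
Let ell : R := ln lam.
Hypotheses (ell1 : 1 <= ell) (big : 33 * ell + 15 <= lam / 2) (dlam : 1 <= dl * lam).
Hypothesis omega10 : forall n, (0 < n)%N -> (omega n)%:R * ln 2%:R <= c0 + ln n%:R / 10.
Let M0 := Num.truncn (N%:R / lam ^+ 2).
Let V : R := expR (21 / 20 * ell).
Let a := (Num.truncn V).+1.
Let y := Num.truncn (expR (lam / 2) / (2 * lam ^+ 5)).
Let J := (Num.truncn (16 * ell)).+4.+1.
Let W := window_primes N y J (3 / 4) (window_bound N c0).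
Let C := euler_const R.
Let G : R := ln (2 * `|g|)%N%:R.
Let rho : R := N%:R / lam.

Let lam0 : 0 < lam. Proof. exact: lam_gt0 ell1 big. Qed.
Let lam1 : lam = expR ell. Proof. exact: lamE ell1 big. Qed.
Let N0 : 0 < N%:R :> R. Proof. exact: N_gt0R. Qed.
Let rho0 : 0 < rho. Proof. exact: divr_gt0. Qed.
Let rhoE : N%:R = rho * expR ell. Proof. by rewrite /rho -lam1 divfK // gt_eqF. Qed.

Lemma lam_le_N : lam <= N%:R. Proof. exact: ln_le_id. Qed.

Lemma dlN_ge1 : 1 <= dl * N%:R.
Proof.
have d0 : 0 < dl by rewrite -(pmulr_lgt0 _ lam0); apply: lt_le_trans dlam.
by apply: le_trans dlam _; rewrite ler_pM2l // lam_le_N.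
Qed.

Lemma small_prime_part : (M0.+1)%:R <= rho * (2 * expR (- ell)).
Proof.
have [h1 h2] := M0_bounds N1 ell1 big; rewrite -/M0 -/lam in h1 h2.
have u : M0%:R <= N%:R / lam ^+ 2.
  have /andP[] // : M0%:R <= N%:R / lam ^+ 2 < M0.+1%:R.
  by rewrite truncn_itv // divr_ge0 // exprn_ge0 // ltW.
have v : 1 <= N%:R / lam ^+ 2.
  by apply: le_trans u; apply: le_trans h1; rewrite ltW // expR_gt1 divr_gt0.
have -> : rho * (2 * expR (- ell)) = N%:R / lam ^+ 2 + N%:R / lam ^+ 2.
  by rewrite expRN -lam1 /rho; field; rewrite gt_eqF.
by rewrite -natr1 lerD.
Qed.

Lemma save_power : expR (- (ell / 20)) = expR ell / V.
Proof. by rewrite /V -expRN -expRD; congr expR; field. Qed.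

Lemma gcd_part : #|square_primes N a|%:R <= rho * (2 * expR (- (ell / 20))).
Proof.
have tr : V < a%:R.
  have /andP[] // : (Num.truncn V)%:R <= V < a%:R by rewrite truncn_itv // expR_ge0.
have a1 : (1 < a)%N.
  rewrite -(ltr_nat R); apply: le_lt_trans tr; apply: ltW; rewrite expR_gt1; apply: mulr_gt0; [exact: divr_gt0 | exact: lt_le_trans ltr01 ell1].
apply: le_trans (gcd_count R N a1) _.
have -> : rho * (2 * expR (- (ell / 20))) = 2 * N%:R / V.
  by rewrite rhoE save_power; ring.
rewrite ler_wpM2l ?mulr_ge0 // lef_pV2 ?posrE ?expR_gt0 ?ltr0n //.
exact: ltW.
Qed.

Lemma omega_part : #|[set p in primes_upto N | V <= (2 ^ omega p.-1)%N%:R]|%:R <=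
  rho * (210 * expR C * expR (- (ell / 20))).
Proof.
have N4 : (4 <= N)%N.
  rewrite -(ler_nat R); apply: le_trans lam_le_N.
  by move: ell1 big; lra.
apply: le_trans (omega_count N4 (expR_gt0 _)) _.
rewrite le_eqVlt; apply/orP; left; apply/eqP.
by rewrite rhoE -/C save_power; ring.
Qed.

Lemma window_part : #|W|%:R <=
  rho * (105 * 64 * expR (5 / 24 * c0 + C) * ((16 * ell + 5) * expR (- (3 * ell / 320)))).
Proof.
have [y1 _ _ lny] := y_bounds ell1 big; have [_ _ Ju] := J_bounds ell1 big.
have [_ yJ] := yJ_bounds N1 ell1 big.
rewrite -/y -/J -/lam -/ell in y1 lny Ju yJ.
have z01 : 0 < (3 / 4 : R) <= 1 by rewrite divr_gt0 // ler_pdivrMr // mul1r ler_nat.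
apply: le_trans (window_count N1 y1 z01 (expR_ge0 _) yJ) _.
rewrite -/C -/lam -/ell /window_bound -/lam -/ell.
have -> : 105 * N%:R / lam = rho * 105 by rewrite /rho; ring.
clearbody y J; rewrite -(mulrA rho 105) ler_pM2l //.
have l64 : 16 / ln y%:R <= 64 * expR (- ell).
  rewrite expRN -lam1.
  have -> : 64 * lam^-1 = 16 / (lam / 4) by field; rewrite gt_eqF.
  by rewrite ler_wpM2l // lef_pV2 ?posrE ?divr_gt0 // (lt_le_trans _ lny) ?divr_gt0.
have e16 : 0 <= 16 * ell + 5 by move: ell1; lra.
apply: (@le_trans _ _ (105 * (expR (5 / 24 * (231 / 200 * ell + c0)) *
   ((16 * ell + 5) * (64 * expR (- ell) * expR (3 / 4 * ell + C)))))).
  rewrite ler_wpM2l // ler_wpM2l ?expR_ge0 //.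
  apply: ler_pM => //.
    by rewrite mulr_ge0 ?expR_ge0 // divr_ge0 // ln_nat_ge0.
  by rewrite ler_wpM2r ?expR_ge0.
rewrite le_eqVlt; apply/orP; left; apply/eqP.
have -> : expR (5 / 24 * (231 / 200 * ell + c0)) =
  expR (5 / 24 * c0 + C) * expR (- (3 * ell / 320)) / (expR (- ell) * expR (3 / 4 * ell + C)).
  by rewrite -expRD -expRD -expRN -expRD; congr expR; field.
have h1 := expR_gt0 (- ell); have h2 := expR_gt0 (3 / 4 * ell + C).
by field; rewrite !gt_eqF.
Qed.

Lemma low_order_part T : (T ^ 2 <= Num.truncn (dl * N%:R))%N ->
  #|small_order_primes g N T M0|%:R <= rho * (2 * dl * G).
Proof.
move=> T2; have [h1 _] := M0_bounds N1 ell1 big; rewrite -/M0 -/lam in h1.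
have M00 : (0 < M0)%N by rewrite -(ltr_nat R); apply: lt_le_trans h1; apply: expR_gt0.
have := @small_order_count g N T M0 hg R M00; rewrite -/G => h.
have lnM : lam / 2 <= ln M0%:R by rewrite -[leLHS]expRK ler_ln ?posrE ?expR_gt0 ?ltr0n.
have G0 : 0 <= G by apply: ln_nat_ge0.
have TR : (T ^ 2)%N%:R <= dl * N%:R.
  apply: (@le_trans _ _ (Num.truncn (dl * N%:R))%:R); first by rewrite ler_nat.
  have d0 : 0 <= dl * N%:R by apply: le_trans dlN_ge1.
  by have /andP[] : (Num.truncn (dl * N%:R))%:R <= dl * N%:R < (Num.truncn (dl * N%:R)).+1%:R by rewrite truncn_itv.
rewrite -(ler_pM2r (divr_gt0 lam0 (ltr0Sn R 1))).
apply: (@le_trans _ _ (#|small_order_primes g N T M0|%:R * ln M0%:R)).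
  by rewrite ler_wpM2l.
apply: le_trans h _; apply: (@le_trans _ _ (dl * N%:R * G)); first by rewrite ler_wpM2r.
by rewrite le_eqVlt; apply/orP; left; apply/eqP; rewrite /rho; field; rewrite gt_eqF.
Qed.

Lemma low_order_cover T : (Num.truncn (dl * N%:R) < T.+1 ^ 2)%N ->
  low_order_primes R g N \subset
   [set p : 'I_N.+1 | (p < M0.+1)%N] :|: small_order_primes g N T M0 :|: square_primes N a
   :|: [set p in primes_upto N | V <= (2 ^ omega p.-1)%N%:R] :|: W.
Proof.
move=> T2; apply/subsetP => p; rewrite inE => /andP[pp /existsP[t /and4P[t0 tp pg tN]]].
rewrite !inE ltnS pp /=; have [//|Mp] := leqP p M0; rewrite /=.
have [tT|Tt] := leqP t T.
  have /orP[] : true || false by []; last by [].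
  move=> _; apply/orP; left; apply/orP; left; apply/orP; left.
  by apply/existsP; exists (Ordinal (tT : (t < T.+1)%N)); rewrite /= t0.
have [sq|nsq] := boolP (p \in square_primes N a).
  by move: sq; rewrite inE => ->; rewrite orbT.
have [om|om] := leP V (2 ^ omega p.-1)%N%:R; first by rewrite orbT.
apply/orP; right; have : p \in W; last by rewrite inE pp.
apply: (order_classification N1 ell1 big dlam omega10 pp Mp tp t0 _ tN nsq om).
have /andP[_ u] : (Num.truncn (dl * N%:R))%:R <= dl * N%:R < (Num.truncn (dl * N%:R)).+1%:R.
  by rewrite truncn_itv // (le_trans _ dlN_ge1).
apply: lt_le_trans u _; rewrite ler_nat; apply: leq_trans T2 _.
by rewrite leq_sqr.
Qed.

Lemma low_order_bound : #|low_order_primes R g N|%:R <=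
  rho * (2 * expR (- ell) + 2 * dl * G + 2 * expR (- (ell / 20)) + 210 * expR C * expR (- (ell / 20)) +
    105 * 64 * expR (5 / 24 * c0 + C) * ((16 * ell + 5) * expR (- (3 * ell / 320)))).
Proof.
have tr0 : (0 < Num.truncn (dl * N%:R))%N.
  by rewrite truncn_gt0 dlN_ge1.
have [T T0 /andP[T1 T2]] := root_nat (isT : (0 < 2)%N) tr0.
apply: (@le_trans _ _ (M0.+1%:R + #|small_order_primes g N T M0|%:R + #|square_primes N a|%:R +
   #|[set p in primes_upto N | V <= (2 ^ omega p.-1)%N%:R]|%:R + #|W|%:R)).
  have cM := card_ord_lt N.+1 M0.+1.
  rewrite -!natrD ler_nat; apply: leq_trans (subset_leq_card (low_order_cover T2)) _.
  do 3!(apply: leq_trans (leq_card_setU _ _) _; rewrite leq_add2r).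
  by apply: leq_trans (leq_card_setU _ _) _; rewrite leq_add2r.
apply: le_trans (lerD (lerD (lerD (lerD small_prime_part (low_order_part T1)) gcd_part) omega_part) window_part) _.
by rewrite -!mulrDr.
Qed.

End Count.

Lemma linear_le_exp (R : realType) (c D : R) : 0 < c -> exists K, forall x, K <= x -> D * (x + 1) <= expR (c * x).
Proof.
move=> c0; exists (1 + 8 * `|D| / c ^+ 2) => x Kx.
have D0 := normr_ge0 D.
have q0 : 0 <= 8 * `|D| / c ^+ 2 by rewrite mulr_ge0 ?mulr_ge0 // invr_ge0 sqr_ge0.
have x1 : 1 <= x by apply: le_trans Kx; rewrite lerDl.
have h := @expR_ge1Dx R (c * x / 2).
have cx : 0 < c * x by rewrite mulr_gt0 // (lt_le_trans ltr01).
have -> : expR (c * x) = expR (c * x / 2) ^+ 2.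
  by rewrite -expRM_natl; congr expR; field.
have h2 : c * x / 2 <= expR (c * x / 2) by apply: le_trans h; rewrite lerDr.
apply: (@le_trans _ _ ((c * x / 2) ^+ 2)); last by rewrite lerXn2r ?nnegrE ?expR_ge0 // divr_ge0 // ltW.
have h3 : 8 * `|D| <= c ^+ 2 * x.
  rewrite -ler_pdivrMl ?exprn_gt0 // mulrC; apply: le_trans Kx; by rewrite lerDr.
apply: (@le_trans _ _ (`|D| * (2 * x))).
  apply: (@le_trans _ _ (`|D| * (x + 1))); first by rewrite ler_wpM2r ?ler_norm // addr_ge0 // (le_trans ler01).
  by rewrite ler_wpM2l // mulr2n mulrDl mul1r lerD.
have -> : (c * x / 2) ^+ 2 = (c ^+ 2 * x) * x / 4 by field.
have -> : `|D| * (2 * x) = 8 * `|D| * x / 4 by field.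
by rewrite ler_wpM2r ?invr_ge0 // ler_wpM2r // (le_trans ler01).
Qed.

Lemma lnln_large (R : realType) (K : R) : exists N0, forall N, (N0 <= N)%N -> K <= ln (ln N%:R).
Proof.
exists (Num.truncn (expR (expR K))).+1 => N hN.
have eN : expR (expR K) <= N%:R.
  have /andP[_ /ltW h] : (Num.truncn (expR (expR K)))%:R <= expR (expR K) < (Num.truncn (expR (expR K))).+1%:R.
    by rewrite truncn_itv // expR_ge0.
  by apply: le_trans h _; rewrite ler_nat.
have Npos : 0 < N%:R :> R by apply: lt_le_trans eN; exact: expR_gt0.
have h : expR K <= ln N%:R by rewrite -[leLHS]expRK ler_ln ?posrE ?expR_gt0.
by rewrite -[leLHS]expRK ler_ln ?posrE ?expR_gt0 // (lt_le_trans _ h) ?expR_gt0.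
Qed.

Lemma saving_arith (R : realType) (ell X b K eps e1 e2 : R) :
  1 <= ell -> 0 < X -> 0 <= b -> 0 <= K -> e1 <= X -> e2 <= X ->
  (4 + b + 16 * K) * ((ell + 1) * X) <= eps / 2 ->
  2 * e1 + eps / 2 + 2 * e2 + b * e2 + K * ((16 * ell + 5) * X) <= eps.
Proof.
move=> ell1 X0 b0 K0 h1 h2; set Y := (ell + 1) * X.
have XY : X <= Y by rewrite ler_peMl ?(ltW X0) // lerDr (le_trans ler01).
have hb : b * e2 <= b * Y by rewrite ler_wpM2l // (le_trans h2).
have hK : K * ((16 * ell + 5) * X) <= K * (16 * Y).
  by rewrite ler_wpM2l // /Y mulrA ler_pM2r //; move: ell1; clear; lra.
rewrite 2!mulrDl -mulrA (mulrCA 16); move: h1 h2 XY hb hK; clearbody Y; clear.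
by move: (b * e2) (b * Y) (K * _) (K * _) => u v w z; lra.
Qed.

Theorem few_low_orders (R : realType) (g : int) (eps : R) : 2 <= `|g| -> 0 < eps ->
  exists N0, forall N, (N0 <= N)%N -> #|low_order_primes R g N|%:R <= eps * (N%:R / ln N%:R).
Proof.
move=> hg e0; have [c0 om] := omega_ln10 R.
set G : R := ln (2 * `|g|)%N%:R.
have G0 : 0 < G.
  have g2 : (2 <= `|g|)%N by rewrite -lez_nat abszE.
  by rewrite ln_gt0 // ltr1n; lia.
pose dl := eps / (4 * G).
have d0 : 0 < dl by rewrite divr_gt0 // mulr_gt0.
pose C := euler_const R.
pose D1 : R := 4 + 210 * expR C.
pose D2 : R := 16 * (105 * 64 * expR (5 / 24 * c0 + C)).
have [K1 hK1] := @linear_le_exp R (3 / 320) (2 / eps * (D1 + D2)) (ltac:(lra)).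
have [K2 hK2] := @linear_le_exp R 1 66 ltr01.
have [K3 hK3] := @linear_le_exp R 1 dl^-1 ltr01.
have [N0 hN] := lnln_large (Num.max 1 (Num.max K1 (Num.max K2 K3))).
exists (maxn 2 N0) => N; rewrite geq_max => /andP[N2 /hN].
rewrite !ge_max; set lam : R := ln N%:R; set ell : R := ln lam => /and4P[ell1 /hK1 k1 /hK2 k2 /hK3 k3].
have lam0 : 0 < lam by rewrite ln_gt0 // ltr1n.
have lamE : expR ell = lam by rewrite lnK.
rewrite !mul1r lamE in k2 k3.
have big : 33 * ell + 15 <= lam / 2 by lra.
have dlam : 1 <= dl * lam.
  have : dl^-1 * 1 <= lam by apply: le_trans k3; rewrite ler_pM2l ?invr_gt0 //; lra.
  by rewrite mulr1 -ler_pdivrMl // mulr1.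
have := low_order_bound hg N2 ell1 big dlam om; rewrite -/lam -/ell -/G -/C => /le_trans; apply.
rewrite [leRHS]mulrC ler_pM2l; last by rewrite divr_gt0 // ltr0n (ltn_trans _ N2).
have -> : 2 * dl * G = eps / 2 by rewrite /dl; field; rewrite gt_eqF.
set X := expR (- (3 * ell / 320)).
have X0 : 0 < X by apply: expR_gt0.
have m1 : expR (- ell) <= X by rewrite ler_expR; move: ell1; clear; lra.
have m2 : expR (- (ell / 20)) <= X by rewrite ler_expR; move: ell1; clear; lra.
have k4 : (D1 + D2) * ((ell + 1) * X) <= eps / 2.
  have : 2 / eps * (D1 + D2) * (ell + 1) * X <= 1.
    rewrite /X expRN ler_pdivrMr ?expR_gt0 // mul1r.
    by rewrite (_ : 3 * ell / 320 = 3 / 320 * ell) //; field.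
  have -> : 2 / eps * (D1 + D2) * (ell + 1) * X = (D1 + D2) * ((ell + 1) * X) / (eps / 2).
    by field; rewrite gt_eqF.
  by rewrite ler_pdivrMr ?mul1r // divr_gt0.
apply: (saving_arith ell1 X0 _ _ m1 m2 k4); by apply: mulr_ge0 (expR_ge0 _); rewrite ?mulr_ge0.
Qed.

(* FILE B14 *)
Lemma card_unity_set (F : finFieldType) (x : F) t : t.-primitive_root x -> #|unity_set F t| = t.
Proof.
move=> xt; have -> : unity_set F t = (fun i : 'I_t => x ^+ i) @: [set: 'I_t].
  apply/setP => z; rewrite inE; apply/eqP/imsetP => [/(prim_rootP xt)[i ->]|[i _ ->]]; first by exists i.
  by rewrite exprAC (prim_expr_order xt) expr1n.
rewrite card_imset ?cardsT ?card_ord // => i j /eqP; rewrite (eq_prim_root_expr xt) !modn_small // => /eqP.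
exact: val_inj.
Qed.

Lemma unity_set_powers (F : finFieldType) (x : F) t y : t.-primitive_root x -> y \in unity_set F t ->
  exists2 k, (0 < k <= t)%N & y = x ^+ k.
Proof.
move=> xt; rewrite inE => /eqP /(prim_rootP xt)[i ->].
have t0 := prim_order_gt0 xt; have [i0|i0] := posnP i.
  by exists t; rewrite ?t0 ?leqnn // i0 (prim_expr_order xt).
by exists i; rewrite // i0 ltnW.
Qed.

Section ModPrime.
Variables (p : nat) (pp : prime p).
Local Notation F := 'F_p.

Lemma intr_Fp_eq (a b : int) : (a%:~R == b%:~R :> F) = (a == b %[mod p])%Z.
Proof. by rewrite eqz_mod_dvd (dvdz_pcharf (pchar_Fp pp)) rmorphB /= subr_eq0. Qed.

Definition primes_below := [set l : 'I_p | prime l].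

Lemma not_representable_bound (g : int) t a : (`|g| < p)%N -> g != 0 ->
  t.-primitive_root (g%:~R : F) -> (p <= t ^ 2)%N -> ~ representable g p a ->
  ((#|primes_below| - 1) * t ^ 2 <= 2 ^ 20 * p ^ 2 * (trunc_log 2 t).+1)%N.
Proof.
move=> gp g0 xt pt2 nrep; have t0 := prim_order_gt0 xt.
have tp : (t %| p.-1)%N.
  rewrite (prim_order_dvd xt) -(inj_eq (mulfI (_ : (g%:~R : F) != 0))); last first.
    rewrite -(dvdz_pcharf (pchar_Fp pp)); apply/negP => /(@dvdn_leq p).
    by rewrite absz_gt0 g0 leqNgt gp => /(_ isT).
  by rewrite mulr1 -exprS prednK ?prime_gt0 // -[X in _ ^+ X](card_Fp pp) expf_card.
have tle : (t <= p.-1)%N by rewrite dvdn_leq // -ltnS prednK ?prime_gt1 // prime_gt0.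
pose f (l : 'I_p) : F := a%:~R - (l : nat)%:R.
have finj : injective f.
  move=> l m /addrI /oppr_inj /eqP; rewrite -[_%:R]/(((l : nat) : int)%:~R) -[X in _ == X]/(((m : nat) : int)%:~R).
  by rewrite intr_Fp_eq !modz_nat !modn_small // => /eqP [] /val_inj.
have := @sumset_complement F p t (pchar_Fp pp) (card_Fp pp) t0 (card_unity_set xt) pt2 (f @: primes_below).
rewrite (card_imset _ finj); apply => z h1 h2 h3 /imsetP[l]; rewrite inE => lp ->.
move=> /(unity_set_powers xt)[k /andP[k0 kt] ->] /(unity_set_powers xt)[m /andP[m0 mt] ->].
move=> /(unity_set_powers xt)[n /andP[n0 nt] ->].
apply/negP => /eqP e; apply: nrep; exists (l : nat), k, m, n.
split; rewrite ?k0 ?m0 ?n0 ?(leq_trans _ tle) //; apply/eqP.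
rewrite -intr_Fp_eq !rmorphD /= !rmorphXn /=.
by rewrite -addrA -addrA [_ ^+ k + _]addrA -e /f addrC subrK.
Qed.
End ModPrime.

Lemma card_primes_below (R : realType) p : odd p -> (1 < p)%N ->
  (p%:R - 1) / 4 <= #|primes_below p|%:R * ln p%:R :> R.
Proof.
move=> podd p1; pose n := p./2.
have pn : p = n.*2.+1 by rewrite -[LHS]odd_double_half podd.
have n0 : (0 < n)%N by rewrite /n half_gt0.
have := prime_count_lower R n; rewrite -pn.
have -> : (\sum_(0 <= q < p | prime q) 1)%N = #|primes_below p|.
  by rewrite big_mkord sum1_card; apply: eq_card => l; rewrite inE.
have lnp : ln n.*2%:R <= ln p%:R :> R.
  by rewrite ler_ln ?posrE ?ltr0n ?double_gt0 ?(ltnW p1) // ler_nat pn.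
have l2 := ln2_ge_half R.
move=> h; apply: (@le_trans _ _ (#|primes_below p|%:R * ln n.*2%:R)); last by rewrite ler_wpM2l.
apply: le_trans h; apply: (@le_trans _ _ (n%:R * 2^-1)); last by rewrite ler_wpM2l.
by rewrite pn -natr1 -muln2 natrM; lra.
Qed.

Lemma large_order_arith (R : realType) (lam p N P t2 L : R) :
  1 <= lam -> 3 * 2 ^+ 24 < lam ^+ 4 -> 32 * lam <= p -> p <= N ->
  (p - 1) / 4 <= P * lam -> N * lam ^+ 6 <= t2 -> L <= 3 * lam -> 0 <= L ->
  (P - 1) * t2 <= 2 ^+ 20 * p ^+ 2 * L -> False.
Proof.
move=> lam1 big plam pN hP ht hL L0 h.
have lam0 : 0 < lam by lra.
have p0 : 0 < p by lra.
have P1 : p / 16 <= (P - 1) * lam by lra.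
have P0 : 0 <= P - 1.
  by rewrite -(pmulr_lge0 _ lam0); apply: le_trans P1; rewrite divr_ge0 // ltW.
have t2p : p * lam ^+ 6 <= t2.
  by apply: le_trans ht; rewrite ler_wpM2r // exprn_ge0 // ltW.
have h1 : (P - 1) * (p * lam ^+ 6) <= 2 ^+ 20 * p ^+ 2 * (3 * lam).
  apply: le_trans (ler_wpM2l P0 t2p) _; apply: le_trans h _.
  by rewrite ler_wpM2l // mulr_ge0 // exprn_ge0 // ltW.
have h2 : p / 16 * (p * lam ^+ 5) <= 2 ^+ 20 * p ^+ 2 * (3 * lam).
  apply: le_trans h1; rewrite (_ : (P - 1) * _ = (P - 1) * lam * (p * lam ^+ 5)); last by ring.
  by rewrite ler_wpM2r // mulr_ge0 ?exprn_ge0 // ltW.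
have pl : 0 < p ^+ 2 * lam by rewrite mulr_gt0 ?exprn_gt0.
have : lam ^+ 4 * (p ^+ 2 * lam) <= 3 * 2 ^+ 24 * (p ^+ 2 * lam).
  have -> : lam ^+ 4 * (p ^+ 2 * lam) = 16 * (p / 16 * (p * lam ^+ 5)) by field.
  have -> : 3 * 2 ^+ 24 * (p ^+ 2 * lam) = 16 * (2 ^+ 20 * p ^+ 2 * (3 * lam)) by ring.
  by rewrite ler_pM2l.
by rewrite ler_pM2r // leNgt big.
Qed.

Lemma large_order_not_exceptional (R : realType) (g : int) N (p : 'I_N.+1) :
  let lam : R := ln N%:R in
  1 <= lam -> 3 * 2 ^+ 24 < lam ^+ 4 -> 32 * lam <= (p : nat)%:R -> g != 0 -> (`|g| < p)%N -> prime p ->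
  p \notin low_order_primes R g N -> ~ exceptional g p.
Proof.
move=> lam lam1 big plam g0 gp pp nlow [a nrep].
pose x : 'F_p := g%:~R.
have x0 : x != 0.
  rewrite -(dvdz_pcharf (pchar_Fp pp)); apply/negP => /(@dvdn_leq p).
  by rewrite absz_gt0 g0 leqNgt gp => /(_ isT).
have p1 : (0 < p.-1)%N by rewrite -ltnS prednK ?prime_gt1 ?prime_gt0.
have xp : x ^+ p.-1 = 1.
  by apply: (mulfI x0); rewrite mulr1 -exprS prednK ?prime_gt0 // -[X in _ ^+ X](card_Fp pp) expf_card.
have [t xt tp] := prim_order_exists p1 xp; have t0 := prim_order_gt0 xt.
have tle : (t <= p.-1)%N by apply: dvdn_leq.
have pN : (p <= N)%N by rewrite -ltnS.
have tN : (t < N.+1)%N by rewrite ltnS (leq_trans tle) // (leq_trans (leq_pred _)).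
have N0 : 0 < N%:R :> R by rewrite ltr0n (leq_trans (prime_gt0 pp)).
have ht : N%:R * lam ^+ 6 <= (t ^ 2)%N%:R.
  rewrite leNgt; apply: contra nlow => h; rewrite inE pp /=; apply/existsP; exists (Ordinal tN).
  rewrite /= t0 tp h andbT /=.
  have : (p%:Z %| g ^+ t - 1)%Z.
    by rewrite (dvdz_pcharf (pchar_Fp pp)) rmorphB rmorphXn /= -/x (prim_expr_order xt) subrr.
  by [].
have pt2 : (p <= t ^ 2)%N.
  rewrite -(ler_nat R); apply: le_trans ht; apply: (@le_trans _ _ N%:R); first by rewrite ler_nat.
  by rewrite ler_peMr ?(ltW N0) // exprn_ege1.
have := not_representable_bound pp gp g0 xt pt2 nrep.
have p2 : (2 < p)%N by rewrite -(ltr_nat R); apply: lt_le_trans plam; lra.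
have podd : odd p by have := even_prime pp; move: p2; case: (odd p) => // p2 [e|//]; rewrite e in p2.
have := @card_primes_below R p podd (prime_gt1 pp).
set P := #|_| => hP; rewrite -(ler_nat R) => h.
have P1 : (0 < P)%N.
  have := lt_le_trans (_ : 0 < (p%:R - 1) / 4) hP.
  rewrite divr_gt0 ?subr_gt0 ?ltr1n ?prime_gt1 // => /(_ isT).
  by case: (P) => // ; rewrite mul0r ltxx.
apply: (large_order_arith lam1 big plam _ _ ht (L := (trunc_log 2 t).+1%:R) _ _ _ (P := P%:R)).
- by rewrite ler_nat.
- by apply: le_trans hP _; rewrite ler_wpM2l // ler_ln ?posrE ?ler_nat // ltr0n prime_gt0.
- have lt : (trunc_log 2 t)%:R * ln 2%:R <= lam.
    rewrite mulr_natl -lnXn ?ltr0n // ler_ln ?posrE ?exprn_gt0 // -natrX ler_nat.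
    by apply: leq_trans (trunc_logP (ltnSn 1) t0) _.
  have l2 := ln2_ge_half R.
  have : (trunc_log 2 t)%:R * 2^-1 <= lam by apply: le_trans lt; rewrite ler_wpM2l.
  by rewrite -[(trunc_log 2 t).+1%:R]natr1; move: (trunc_log 2 t)%:R lam1 => T; lra.
- by [].
- by move: h; rewrite (natrM _ (P - 1)) natrB // (natrM _ (2 ^ 20 * p ^ 2)%N) (natrM _ (2 ^ 20)) (natrX _ 2 20) (natrX _ p 2).
Qed.

Lemma threshold_arith (R : realType) (lam u v : R) : 1 <= lam -> u <= 32 * lam -> 0 <= v ->
  u + 1 + (v + 1) <= (34 + v) * lam.
Proof.
move=> lam1 hu v0; have : v <= v * lam by rewrite ler_peMr.
by rewrite mulrDl; move: (v * lam) => w h; lra.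
Qed.

Lemma threshold_power (R : realType) : 3 * 2 ^+ 24 < 128 ^+ 4 :> R.
Proof.
have -> : 128 = 2 ^+ 7 :> R by rewrite -natrX.
rewrite -exprM; have -> : (7 * 4 = 4 + 24)%N by [].
by rewrite exprD ltr_pM2r; [rewrite -natrX ltr_nat|apply: exprn_gt0].
Qed.

Theorem exceptional_count (R : realType) (g : int) (eps : R) : 2 <= `|g| -> 0 < eps ->
  exists N0, forall N, (N0 <= N)%N ->
  (\sum_(0 <= p < N.+1 | prime p && `[< exceptional g p >]) 1)%N%:R <= eps * (N%:R / ln N%:R).
Proof.
move=> hg e0.
have e20 : 0 < eps / 2 by rewrite divr_gt0.
have [N1 hN1] := few_low_orders hg e20.
pose D := 1 + (34 + `|g|%N%:R) / (eps / 2).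
have g0 : g != 0 by apply: contraTneq hg => ->; rewrite normr0.
have [K hK] := @linear_le_exp R (1 / 2) D (ltac:(lra)).
have [N2 hN2] := lnln_large (Num.max 128 K).
exists (maxn 2 (maxn N1 N2)) => N; rewrite !geq_max => /and3P[N_2 /hN1 low /hN2].
set lam : R := ln N%:R in low *; rewrite ge_max => /andP[ell128 ellK].
have lam0 : 0 < lam by rewrite ln_gt0 // ltr1n.
have lam_ell : ln lam <= lam.
  by have := @expR_ge1Dx R (ln lam); rewrite lnK // => h; apply: le_trans h; rewrite lerDr.
have lam128 : 128 <= lam by apply: le_trans lam_ell.
have N0 : 0 < N%:R :> R by rewrite ltr0n ltnW.
have lam1 : 1 <= lam by lra.
pose s := ((Num.truncn (32 * lam)).+1 + `|g|.+1)%N.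
have sle : s%:R <= (34 + `|g|%N%:R) * lam.
  have /andP[h _] : (Num.truncn (32 * lam))%:R <= 32 * lam < (Num.truncn (32 * lam)).+1%:R.
    by rewrite truncn_itv // mulr_ge0 // ltW.
  rewrite /s natrD -[(Num.truncn (32 * lam)).+1%:R]natr1 -[(`|g|%N).+1%:R]natr1.
  exact: threshold_arith.
have sN : s%:R <= eps / 2 * (N%:R / lam).
  have D1 : 1 <= D by rewrite lerDl divr_ge0 ?addr_ge0 // ltW.
  have h : 34 + `|g|%N%:R <= eps / 2 * D by rewrite mulrDr [_ * (_ / _)]mulrC divfK ?gt_eqF // lerDr ltW // mulr1.
  apply: le_trans sle _; apply: (@le_trans _ _ (eps / 2 * D * lam)); first by rewrite ler_wpM2r // ltW.
  rewrite -mulrA ler_pM2l // ler_pdivlMr //.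
  have := hK lam (le_trans ellK lam_ell) => k.
  have -> : N%:R = expR (1 / 2 * lam) ^+ 2.
    by rewrite -expRM_natl (_ : 2%:R * (1 / 2 * lam) = lam) ?lnK ?posrE //; field.
  have D0 : 0 <= D by apply: le_trans D1.
  have l0 : 0 <= lam by apply: ltW.
  have l10 : 0 <= lam + 1 by rewrite addr_ge0.
  have P0 : 0 <= D * (lam + 1) by rewrite mulr_ge0.
  apply: (@le_trans _ _ ((D * (lam + 1)) ^+ 2)); last by rewrite lerXn2r // nnegrE expR_ge0.
  rewrite expr2; apply: ler_pM => //; first by rewrite mulr_ge0.
    by rewrite ler_wpM2l // lerDl.
  by apply: (@le_trans _ _ (lam + 1)); [rewrite lerDl|rewrite ler_peMl].
apply: (@le_trans _ _ (s%:R + #|low_order_primes R g N|%:R)); last first.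
  by rewrite [eps]splitr mulrDl lerD.
rewrite -natrD ler_nat big_mkord sum1_card.
apply: leq_trans (leq_add (card_ord_lt N.+1 s) (leqnn _)).
apply: leq_trans (leq_card_setU _ _); apply/subset_leq_card/subsetP => p.
rewrite unfold_in => /andP[pp /asboolP ex]; rewrite inE inE.
have [//|sp] := ltnP p s; rewrite /=.
apply/negPn/negP => nlow; apply: (large_order_not_exceptional lam1 _ _ g0 _ pp nlow) => //.
- apply: (@lt_le_trans _ _ (128 ^+ 4)); last by rewrite lerXn2r ?nnegrE // ltW.
  exact: threshold_power.
- have /andP[_ /ltW h] : (Num.truncn (32 * lam))%:R <= 32 * lam < (Num.truncn (32 * lam)).+1%:R.
    by rewrite truncn_itv // mulr_ge0 // ltW.
  by apply: le_trans h _; rewrite ler_nat (leq_trans _ sp) // leq_addr.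
by apply: leq_trans sp; rewrite leq_addl.
Qed.

(* FILE B15 *)
Theorem corollary4p4 (R : realType) (g : int) (hg : 2 <= `|g|) :
  (fun Q : R => (num_exceptional g Q)%:R : R^o)
    =o_ (pinfty_nbhs R) (fun Q : R => Q / ln Q : R^o).
Proof.
apply/eqoP => eps e0.
have e20 : 0 < eps / 2 by rewrite divr_gt0.
have [N0 hN0] := @exceptional_count R g (eps / 2) hg e20.
near=> Q.
have Q2 : 2 <= Q by near: Q; apply: nbhs_pinfty_ge; exact: num_real.
have QN : N0%:R <= Q by near: Q; apply: nbhs_pinfty_ge; exact: num_real.
have Q0 : 0 <= Q by apply: le_trans Q2.
have Qp : 0 < Q by apply: lt_le_trans Q2.
pose N := Num.truncn Q.
have /andP[NQ QN1] : N%:R <= Q < N.+1%:R by rewrite truncn_itv.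
have N2 : (2 <= N)%N by rewrite -ltnS -(ltr_nat R); apply: le_lt_trans QN1.
have hN : (N0 <= N)%N by rewrite -ltnS -(ltr_nat R); apply: le_lt_trans QN1.
rewrite /num_exceptional -/N [X in X <= _]ger0_norm // ger0_norm; last first.
  by rewrite divr_ge0 // ln_ge0 // (le_trans _ Q2) // ler1n.
apply: le_trans (hN0 N hN) _; rewrite -mulrA ler_pM2l //.
have lN : 0 < ln N%:R :> R by rewrite ln_gt0 // ltr1n.
have lQ : 0 < ln Q by rewrite ln_gt0 // (lt_le_trans _ Q2) // ltr1n.
have lQN : ln Q <= 2 * ln N%:R.
  rewrite mulr_natl -lnXn ?ltr0n ?(ltnW N2) //.
  rewrite ler_ln ?posrE ?exprn_gt0 ?ltr0n ?(ltnW N2) //.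
  apply: le_trans (ltW QN1) _; rewrite -natrX ler_nat.
  by apply: (@leq_trans (N * 2)%N); [rewrite muln2 -addnn -addn1 leq_add2l ltnW|rewrite -mulnn leq_mul2l N2 orbT].
rewrite ler_pdivlMr //; apply: le_trans NQ.
have NE : 2^-1 * (N%:R / ln N%:R) * (2 * ln N%:R) = N%:R :> R.
  by field; rewrite gt_eqF.
rewrite -[leRHS]NE ler_wpM2l // mulr_ge0 ?invr_ge0 // divr_ge0 // ltW.
Unshelve. all: by end_near.
Qed.
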